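(* Let $X=(X_t)_{t\ge0}$ be a one-dimensional Lévy process in the domain of attraction of the $\alpha$-stable law $S_\alpha(1)$ for $\alpha\in(0,1)$, i.e. $X_T/a_T\xrightarrow{d}S_\alpha(1)$ as $T\to\infty$ for some positive function $a_T=T^{1/\alpha}l(T)$ with $l$ slowly varying at infinity, where $(S_\alpha(t))_{t\ge0}$ is an $\alpha$-stable process. Define $$\Lambda_T^1:=\bigg(\frac{\Upsilon_T^\frown}{a_T},\frac{\overline C_T^\frown}{a_T},\frac{C_T^\frown(T)}{a_T},\frac{\gamma_T^\frown}{T}\bigg),\qquad \Lambda^1:=\big(2\overline S_\alpha(1)-S_\alpha(1),\ \overline S_\alpha(1),\ S_\alpha(1),\ \gamma^{\alpha\frown}\big),$$ $$\Lambda_T^2:=\bigg(\frac{\Upsilon_T^\smile}{a_T},\frac{\underline C_T^\smile}{a_T},\frac{C_T^\smile(T)}{a_T},\frac{\gamma_T^\smile}{T}\bigg),\qquad \Lambda^2:=\big(S_\alpha(1)-2\underline S_\alpha(1),\ \underline S_\alpha(1),\ S_\alpha(1),\ \gamma^{\alpha\smile}\big).$$ Then the joint convergence $(\Lambda_T^1,\Lambda_T^2)\xrightarrow{d}(\Lambda^1,\Lambda^2)$ holds as $T\to\infty$.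
   Context: Stable laws and processes are understood to be non-degenerate. For a Lévy process $X$ and $T>0$, the concave majorant $C_T^\frown$ (resp. convex minorant $C_T^\smile$) is the pointwise smallest concave (resp. largest convex) function on $[0,T]$ with $C_T^\frown(t)\ge X_t$ (resp. $C_T^\smile(t)\le X_t$) for all $t\in[0,T]$. $\Upsilon_T^\frown$ (resp. $\Upsilon_T^\smile$) is the length of the graph of $C_T^\frown$ (resp. $C_T^\smile$) over $[0,T]$. $\overline C_T^\frown:=\sup_{t\in[0,T]}C_T^\frown(t)$ and $\gamma_T^\frown$ is the (first) time at which this supremum is attained; $\underline C_T^\smile:=\inf_{t\in[0,T]}C_T^\smile(t)$ and $\gamma_T^\smile$ is the (first) time at which this infimum is attained. $\overline S_\alpha(1):=\sup_{t\in[0,1]}S_\alpha(t)$, $\underline S_\alpha(1):=\inf_{t\in[0,1]}S_\alpha(t)$, and $\gamma^{\alpha\frown}$ (resp. $\gamma^{\alpha\smile}$) is the a.s. unique time at which $(S_\alpha(t))_{t\in[0,1]}$ attains its supremum (resp. infimum), where attainment may be by the left limit. *)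

(* Defs.v *)
From HB Require Import structures.
From mathcomp Require Import all_boot all_order all_algebra.
From mathcomp Require Import all_classical all_reals all_analysis.

Set Implicit Arguments.
Unset Strict Implicit.
Unset Printing Implicit Defensive.

Import Order.TTheory GRing.Theory Num.Theory.
Import numFieldNormedType.Exports.

Local Open Scope classical_set_scope.
Local Open Scope ring_scope.

Section paths.
Context {R : realType}.
Implicit Types (f : R -> R) (a b T t : R).

(* Taking B i = setT below shows that the product rule for all coordinates
   contains the product rule for every subfamily. *)
Definition independent d (Omega : measurableType d) (P : probability Omega R)
    (n : nat) (Y : 'I_n -> Omega -> R) :=
  forall B : 'I_n -> set R, (forall i, measurable (B i)) ->
    P [set w | forall i, B i (Y i w)] =
    (\prod_(i < n) fine (P (Y i @^-1` B i)))%:E.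

Definition cadlag f :=
  forall t, 0 <= t ->
    f x @[x --> t^'+] --> f t /\ (0 < t -> cvg (f x @[x --> t^'-])).

(* Only nonnegative times matter; X t is unconstrained for t < 0. *)
Definition levy_process d (Omega : measurableType d) (P : probability Omega R)
    (X : R -> Omega -> R) :=
  [/\ (forall t, 0 <= t -> measurable_fun setT (X t)),
      {ae P, forall w, X 0 w = 0},
      {ae P, forall w, cadlag (X^~ w)},
      (forall (n : nat) (t : nat -> R), 0 <= t 0%N ->
        (forall i, t i <= t i.+1) ->
        independent P (fun (i : 'I_n) w => X (t i.+1) w - X (t i) w)) &
      (forall s t (B : set R), 0 <= s -> 0 <= t -> measurable B ->
        P [set w | B (X (s + t) w - X s w)] = P [set w | B (X t w)])].

(* Equality of finite-dimensional distributions; measurable rectangles form a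
   pi-system generating the Borel sets of R^n. *)
Definition same_fdd d d' (Omega : measurableType d) (Omega' : measurableType d')
    (P : probability Omega R) (P' : probability Omega' R)
    (X : R -> Omega -> R) (Y : R -> Omega' -> R) :=
  forall (n : nat) (t : 'I_n -> R) (B : 'I_n -> set R),
    (forall i, 0 <= t i) -> (forall i, measurable (B i)) ->
    P [set w | forall i, B i (X (t i) w)] =
    P' [set w | forall i, B i (Y (t i) w)].

(* Stability in the wide sense: the drift b * t is allowed. *)
Definition stable_process d (Omega : measurableType d) (P : probability Omega R)
    (alpha : R) (S : R -> Omega -> R) :=
  [/\ levy_process P S,
      (forall m : R, ~ {ae P, forall w, S 1 w = m}) &
      (forall c : R, 0 < c -> exists b : R,
        same_fdd P P (fun t => S (c * t))
                     (fun t w => c `^ alpha^-1 * S t w + b * t))].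

Definition slowly_varying (l : R -> R) :=
  exists2 A : R, (forall x, A <= x -> 0 < l x) &
    measurable_fun `[A, +oo[ l /\
    (forall c, 0 < c -> l (c * x) / l x @[x --> +oo] --> (1 : R)).

(* Several functionals below are well behaved, and measurable, only on the
   almost sure event where the paths are cadlag.  Since P need not be complete,
   random elements are therefore handled through Borel measurable versions. *)
Definition version d (Omega : measurableType d) (P : probability Omega R)
    (E : topologicalType) (Y Y' : Omega -> E) :=
  (forall U : set E, open U -> measurable (Y' @^-1` U)) /\
  {ae P, forall w, Y w = Y' w}.

Definition cvg_in_law d d' (Omega : measurableType d)
    (Omega' : measurableType d') (P : probability Omega R)
    (P' : probability Omega' R) (E : topologicalType)
    (Y : R -> Omega -> E) (Z : Omega' -> E) :=
  exists (Y' : R -> Omega -> E) (Z' : Omega' -> E),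
    [/\ forall T, 0 < T -> version P (Y T) (Y' T),
        version P' Z Z' &
        forall f : E -> R, continuous f ->
          (exists M : R, forall x, `|f x| <= M) ->
          ('E_P[f \o Y' T] @[T --> +oo%R] --> 'E_P'[f \o Z'])%E].

Definition concave_majorants f T : set (R -> R) :=
  [set c | @convex_function R R^o `[0, T] (fun t => - c t) /\
           forall t, 0 <= t <= T -> f t <= c t].

Definition concave_majorant f T t : R :=
  inf [set c t | c in concave_majorants f T].

Definition convex_minorants f T : set (R -> R) :=
  [set c | @convex_function R R^o `[0, T] c /\
           forall t, 0 <= t <= T -> c t <= f t].

Definition convex_minorant f T t : R :=
  sup [set c t | c in convex_minorants f T].

(* Length of the polygonal line through the points of the graph of f above
   a :: s, and arc length as the supremum over the partitions of [a, b]. *)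
Definition polygonal_length f a (s : seq R) : R :=
  \sum_(p <- zip (a :: s) s)
    Num.sqrt ((p.2 - p.1) ^+ 2 + (f p.2 - f p.1) ^+ 2).

Definition graph_length f a b : R :=
  sup [set polygonal_length f a s | s in itv_partition a b].

Definition sup_on f T : R := sup [set f t | t in `[0, T]].
Definition inf_on f T : R := inf [set f t | t in `[0, T]].

Definition first_argmax f T : R :=
  inf [set t | 0 <= t <= T /\ f t = sup_on f T].
Definition first_argmin f T : R :=
  inf [set t | 0 <= t <= T /\ f t = inf_on f T].

(* Here the extremum may be attained by a left limit.  When the time of
   attainment is unique, the set is a singleton and inf returns its element. *)
Definition time_of_sup f T : R :=
  inf [set t | 0 <= t <= T /\
    (f t = sup_on f T \/ 0 < t /\ f x @[x --> t^'-] --> sup_on f T)].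
Definition time_of_inf f T : R :=
  inf [set t | 0 <= t <= T /\
    (f t = inf_on f T \/ 0 < t /\ f x @[x --> t^'-] --> inf_on f T)].

Definition Lambda1_ (a : R -> R) T f : R * R * R * R :=
  let C := concave_majorant f T in
  (graph_length C 0 T / a T, sup_on C T / a T, C T / a T, first_argmax C T / T).

Definition Lambda2_ (a : R -> R) T f : R * R * R * R :=
  let C := convex_minorant f T in
  (graph_length C 0 T / a T, inf_on C T / a T, C T / a T, first_argmin C T / T).

Definition Lambda1 f : R * R * R * R :=
  (2 * sup_on f 1 - f 1, sup_on f 1, f 1, time_of_sup f 1).

Definition Lambda2 f : R * R * R * R :=
  (f 1 - 2 * inf_on f 1, inf_on f 1, f 1, time_of_inf f 1).

Lemma concave_majorantP f T : (exists M, forall t, 0 <= t <= T -> f t <= M) ->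
  concave_majorants f T (concave_majorant f T) /\
  forall c, concave_majorants f T c ->
    forall t, 0 <= t <= T -> concave_majorant f T t <= c t.
Proof.
move=> [M fM].
have ne t : [set c t | c in concave_majorants f T] !=set0.
  exists M; exists (fun=> M) => //; split => // p x y _ _.
  by rewrite convmm.
have lb t : 0 <= t <= T -> lbound [set c t | c in concave_majorants f T] (f t).
  by move=> tT _ [c [_ fc] <-]; exact: fc.
have le c : concave_majorants f T c ->
    forall t, 0 <= t <= T -> concave_majorant f T t <= c t.
  by move=> fc t tT; apply: ge_inf; [exists (f t); exact: lb|exists c].
split; last exact: le.
split; last by move=> t tT; apply: lb_le_inf => //; exact: lb.
move=> p x y xT yT; rewrite -convN lerN2.
apply: lb_le_inf => // _ [c fc <-].
have [cc _] := fc.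
have := cc p x y xT yT; rewrite -convN lerN2; apply: le_trans.
move: xT yT; rewrite !inE/= !in_itv/= => xT yT.
rewrite !convRE lerD// ler_wpM2l//.
- exact: le.
- by rewrite subr_ge0.
- exact: le.
Qed.

Lemma convex_minorantP f T : (exists M, forall t, 0 <= t <= T -> M <= f t) ->
  convex_minorants f T (convex_minorant f T) /\
  forall c, convex_minorants f T c ->
    forall t, 0 <= t <= T -> c t <= convex_minorant f T t.
Proof.
move=> [M fM].
have ne t : [set c t | c in convex_minorants f T] !=set0.
  exists M; exists (fun=> M) => //; split => // p x y _ _.
  by rewrite convmm.
have ub t : 0 <= t <= T -> ubound [set c t | c in convex_minorants f T] (f t).
  by move=> tT _ [c [_ fc] <-]; exact: fc.
have le c : convex_minorants f T c ->
    forall t, 0 <= t <= T -> c t <= convex_minorant f T t.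
  by move=> fc t tT; apply: ub_le_sup; [exists (f t); exact: ub|exists c].
split; last exact: le.
split; last by move=> t tT; apply: ge_sup => //; exact: ub.
move=> p x y xT yT.
apply: ge_sup => // _ [c fc <-].
have [cc _] := fc.
apply: (le_trans (cc p x y xT yT)).
move: xT yT; rewrite !inE/= !in_itv/= => xT yT.
rewrite !convRE lerD// ler_wpM2l//.
- exact: le.
- by rewrite subr_ge0.
- exact: le.
Qed.

End paths.

(* Main.v *)
(* Put Z t = X (T * t) / a T.  The graph over [0, T] of a concave function C
   with C 0 = 0 has length 2 sup C - C T up to an error of at most T, and
   T / a T tends to 0 because 1 / alpha > 1.  The concave majorant has the
   supremum, the end value and almost surely the time of supremum of the path,
   and the convex minorant is handled by replacing the path with its opposite.
   So everything reduces to the supremum, its time and the end value of Z and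
   of - Z.

   Uniformly in large T, these are close to Lipschitz functions of the finitely
   many dyadic increments of Z: a first-passage argument replaces the supremum
   by the maximum over a dyadic skeleton, and the time of the supremum is
   approximated by the average over s of min (1, (M 1 - M s) / e), where M is
   the running maximum.  The latter fails only when two maxima nearly tie, which
   is unlikely because the law of an increment is not concentrated: a stable law
   has no atom.  Finally, the increments are independent and converge in law one
   by one, so the expectation of a bounded Lipschitz function of them converges. *)

Require Import Defs.
From HB Require Import structures.
From mathcomp Require Import all_boot all_order all_algebra.
From mathcomp Require Import all_classical all_reals all_analysis.
From mathcomp Require Import measurable_realfun ring lra.

Set Implicit Arguments.
Unset Strict Implicit.
Unset Printing Implicit Defensive.

Import Order.TTheory GRing.Theory Num.Theory.
Import numFieldNormedType.Exports.

Local Open Scope classical_set_scope.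
Local Open Scope ring_scope.

(** * Concave majorants and arc length *)

(** No topology on paths and no functional limit theorem enter: the limit is reached through
    Lipschitz functions of finitely many independent increments. The price is that every
    approximation error has to be small uniformly in large T. For a time [y = T * s] this needs
    [a y] to be small against [a T] when [A <= y <= h * T], a one-sided Potter bound extracted from
    the measurability of [l]. Times below [A] form a fixed range, on which X is tight while [a T]
    tends to infinity. The bound on near ties must be uniform in T as well. A concentration function
    is a supremum over all centres x, but its square is at most the probability that two increments
    of the same length nearly agree. That event is dominated by a Lipschitz function of the
    increments, so its bound passes from the stable process to the scaled one. Suprema, times of
    suprema and arc lengths are measurable only up to null sets; this is why the pathwise estimates
    are stated outside measurable exceptional events. *)

Section concave_majorants.
Context {R : realType}.
Implicit Types (f c C : R -> R) (T t x y z M : R).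

(** The three-point inequality multiplied by [z - x]: it has no division and is linear in the values
    of [c]. *)
Definition concave_on T c := forall x y z, 0 <= x -> x < y -> y < z -> z <= T ->
  (z - y) * c x + (y - x) * c z <= (z - x) * c y.

Lemma concave_onP T c :
  @convex_function R R^o `[0, T] (fun t => - c t) <-> concave_on T c.
Proof.
split=> [cc x y z x0 xy yz zT|cc p x y].
  have zx : 0 < z - x by lra.
  have p0 : 0 <= (z - y) / (z - x) by rewrite divr_ge0; lra.
  have p1 : (z - y) / (z - x) <= 1 by rewrite ler_pdivrMr//; lra.
  have xT : (x : R^o) \in `[0, T]%classic by rewrite inE/= in_itv/=; lra.
  have zT' : (z : R^o) \in `[0, T]%classic by rewrite inE/= in_itv/=; lra.
  have : - c ((z - y) / (z - x) * x + (1 - (z - y) / (z - x)) * z) <=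
      (z - y) / (z - x) * (- c x) + (1 - (z - y) / (z - x)) * (- c z).
    exact: (cc (Itv01 p0 p1) x z xT zT').
  have -> : (z - y) / (z - x) * x + (1 - (z - y) / (z - x)) * z = y.
    by field; lra.
  rewrite !mulrN -opprD lerN2.
  rewrite -(ler_pM2l zx); apply: le_trans.
  rewrite le_eqVlt; apply/orP; left; apply/eqP.
  by field; lra.
rewrite !inE/= !in_itv/= => /andP[x0 xT] /andP[y0 yT].
have p0 : 0 <= p%:num by [].
have p1 : p%:num <= 1 by [].
change (- c (p%:num * x + (1 - p%:num) * y) <=
  p%:num * (- c x) + (1 - p%:num) * (- c y)).
rewrite !mulrN -opprD lerN2.
move: (p%:num) p0 p1 => {}p p0 p1.
have [->|pN0] := eqVneq p 0; first by rewrite subr0 !mul0r !mul1r !add0r.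
have [->|pN1] := eqVneq p 1; first by rewrite subrr !mul0r !mul1r !addr0.
have {}p0 : 0 < p by rewrite lt_neqAle eq_sym pN0.
have {}p1 : p < 1 by rewrite lt_neqAle pN1.
have [xy|xy|->] := ltgtP x y.
- have yx : 0 < y - x by lra.
  rewrite -(ler_pM2l yx).
  apply: (le_trans _ (cc x (p * x + (1 - p) * y) y x0 _ _ yT)).
  + by rewrite le_eqVlt; apply/orP; left; apply/eqP; ring.
  + by have := mulr_gt0 yx (_ : 0 < 1 - p); nra.
  + by nra.
- have yx : 0 < x - y by lra.
  rewrite -(ler_pM2l yx).
  apply: (le_trans _ (cc y (p * x + (1 - p) * y) x y0 _ _ xT)).
  + by rewrite le_eqVlt; apply/orP; left; apply/eqP; ring.
  + by nra.
  + by nra.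
- by rewrite -!mulrDl addrC subrK !mul1r.
Qed.

Lemma concave_majorantsE f T c : concave_majorants f T c <->
  concave_on T c /\ forall t, 0 <= t <= T -> f t <= c t.
Proof. by split=> -[/concave_onP cc fc]; split => //; apply/concave_onP. Qed.

Section majorant.
Variables (f : R -> R) (T M : R).
Hypotheses (T0 : 0 < T) (fM : forall t, 0 <= t <= T -> f t <= M).
Let C := concave_majorant f T.

Lemma concave_majorant_concave : concave_on T C.
Proof.
have [h _] := @concave_majorantP R f T (ex_intro _ M fM).
by have /concave_majorantsE[] := h.
Qed.

Lemma concave_majorant_ge t : 0 <= t <= T -> f t <= C t.
Proof.
have [h _] := @concave_majorantP R f T (ex_intro _ M fM).
by have /concave_majorantsE[_] := h; exact.
Qed.

Lemma concave_majorant_le c t : concave_on T c ->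
  (forall t, 0 <= t <= T -> f t <= c t) -> 0 <= t <= T -> C t <= c t.
Proof.
move=> cc fc.
have [_ h] := @concave_majorantP R f T (ex_intro _ M fM).
by apply: h; apply/concave_majorantsE.
Qed.

Lemma concave_on_cst m : concave_on T (fun=> m).
Proof. by move=> x y z *; rewrite -mulrDl; nra. Qed.

Lemma concave_majorant_le_bound t : 0 <= t <= T -> C t <= M.
Proof. by apply: concave_majorant_le => //; exact: concave_on_cst. Qed.

Lemma concave_majorant0 : C 0 = f 0.
Proof.
apply: le_anti; apply/andP; split; last first.
  by apply: concave_majorant_ge; rewrite lexx ltW.
(* A concave function on a closed interval may drop at an end point, so this competitor is concave
   and pins the majorant to [f 0] there. *)
pose c x := if x <= 0 then f 0 else M.
have c0 : c 0 = f 0 by rewrite /c lexx.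
rewrite -c0; apply: concave_majorant_le; rewrite ?lexx ?ltW//.
- move=> x y z x0 xy yz zT; rewrite /c.
  rewrite (_ : (y <= 0) = false); last by apply/negbTE; rewrite -ltNge; lra.
  rewrite (_ : (z <= 0) = false); last by apply/negbTE; rewrite -ltNge; lra.
  have fM0 : f 0 <= M by apply: fM; rewrite lexx ltW.
  by case: ifP => _; nra.
- move=> t /andP[t0 tT]; rewrite /c; case: ifP => [t0'|_].
    by rewrite (_ : t = 0)//; lra.
  by apply: fM; rewrite t0.
Qed.

Lemma concave_majorantT : C T = f T.
Proof.
apply: le_anti; apply/andP; split; last first.
  by apply: concave_majorant_ge; rewrite lexx ltW.
pose c x := if T <= x then f T else M.
have c0 : c T = f T by rewrite /c lexx.
rewrite -c0; apply: concave_majorant_le; rewrite ?lexx ?ltW//.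
- move=> x y z x0 xy yz zT; rewrite /c.
  rewrite (_ : (T <= y) = false); last by apply/negbTE; rewrite -ltNge; lra.
  rewrite (_ : (T <= x) = false); last by apply/negbTE; rewrite -ltNge; lra.
  have fM0 : f T <= M by apply: fM; rewrite lexx ltW.
  by case: ifP => _; nra.
- move=> t /andP[t0 tT]; rewrite /c; case: ifP => [t0'|_].
    by rewrite (_ : t = T)//; lra.
  by apply: fM; rewrite t0.
Qed.

(* The least concave majorant is below the minimum of the constant [M] and
   the line through [(0, m)] and [(u, M)]. *)
Lemma concave_majorant_lt_left m u t : 0 <= t -> t < u -> u <= T -> m < M ->
  (forall s, 0 <= s <= u -> f s <= m) -> C t < M.
Proof.
move=> t0 tu uT mM fm.
pose c x := Num.min M (m + (M - m) / u * x).
have u0 : 0 < u by lra.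
have k0 : 0 < (M - m) / u by rewrite divr_gt0; lra.
have ku : (M - m) / u * u = M - m by field; lra.
have -> : M = m + (M - m) / u * u by rewrite ku; lra.
apply: (@le_lt_trans _ _ (c t)); last by rewrite /c gt_min ltrD2l ltr_pM2l// tu orbT.
apply: concave_majorant_le; last by rewrite t0; lra.
- move=> x y z x0 xy yz zT; rewrite /c.
  move: ((M - m) / u) k0 {ku c} => k k0.
  have A w : Num.min M (m + k * w) <= M by rewrite ge_min lexx.
  have B w : Num.min M (m + k * w) <= m + k * w by rewrite ge_min lexx orbT.
  (* The value at [y] is one of the two affine functions, and at [x] and [z] the minimum is at most
     that same function. *)
  rewrite {3}/Num.min; case: ifP => _.
    by have := A x; have := A z; nra.
  by have := B x; have := B z; nra.
- move=> s /andP[s0 sT]; rewrite /c le_min fM ?s0//=.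
  have [su|us] := leP s u.
    by apply: (le_trans (fm _ _)); rewrite ?s0//; nra.
  by apply: (le_trans (fM _)); rewrite ?s0//; nra.
Qed.

Lemma sup_on_concave_majorant : sup_on C T = sup_on f T.
Proof.
have T1 : (0 : R) <= 0 <= T by apply/andP; split => //; exact: ltW.
have supC : has_sup [set C t | t in `[0, T]].
  split; first by exists (C 0), 0 => //=; rewrite in_itv/=.
  by exists M => _ [t /= + <-]; rewrite in_itv/=; exact: concave_majorant_le_bound.
have supf : has_sup [set f t | t in `[0, T]].
  split; first by exists (f 0), 0 => //=; rewrite in_itv/=.
  by exists M => _ [t /= + <-]; rewrite in_itv/=; exact: fM.
apply/eqP; rewrite eq_le; apply/andP; split; apply: ge_sup => //.
- by case: supC.
- move=> _ [t /= + <-]; rewrite in_itv/=.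
  apply: concave_majorant_le; first exact: concave_on_cst.
  move=> s sT; apply: sup_ubound; first by case: supf.
  by exists s => //=; rewrite in_itv/=.
- by case: supf.
- move=> _ [t /= + <-]; rewrite in_itv/= => tT.
  apply: (le_trans (concave_majorant_ge tT)); apply: sup_ubound; first by case: supC.
  by exists t => //=; rewrite in_itv/=.
Qed.

End majorant.

End concave_majorants.

(** * Arc length of the graph of a concave function *)

Section arc_length.
Context {R : realType}.
Implicit Types (f c C g : R -> R) (T t x y z M a b : R).

Definition chord f x y : R := Num.sqrt ((y - x) ^+ 2 + (f y - f x) ^+ 2).

Lemma chord_ge f x y : `|f y - f x| <= chord f x y.
Proof. by rewrite -sqrtr_sqr ler_wsqrtr// lerDr sqr_ge0. Qed.

Lemma chord_le f x y : chord f x y <= `|y - x| + `|f y - f x|.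
Proof.
have h0 : 0 <= `|y - x| + `|f y - f x| by rewrite addr_ge0.
rewrite -[leRHS]ger0_norm// -[leRHS]sqrtr_sqr ler_wsqrtr//.
rewrite [leRHS]sqrrD !real_normK ?num_real// lerD2r lerDl.
by rewrite mulrn_wge0// mulr_ge0.
Qed.

Lemma chord_triangle f x y z : chord f x z <= chord f x y + chord f y z.
Proof.
rewrite /chord.
have -> : z - x = (y - x) + (z - y) by ring.
have -> : f z - f x = (f y - f x) + (f z - f y) by ring.
move: (y - x) (z - y) (f y - f x) (f z - f y) => a b u v.
have A0 : 0 <= a ^+ 2 + u ^+ 2 by rewrite addr_ge0// sqr_ge0.
have B0 : 0 <= b ^+ 2 + v ^+ 2 by rewrite addr_ge0// sqr_ge0.
set p := Num.sqrt (a ^+ 2 + u ^+ 2); set q := Num.sqrt (b ^+ 2 + v ^+ 2).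
have pq0 : 0 <= p + q by rewrite addr_ge0// sqrtr_ge0.
rewrite -[leRHS]ger0_norm// -[leRHS]sqrtr_sqr ler_wsqrtr//.
rewrite [leRHS]sqrrD !sqr_sqrtr//.
suff : a * b + u * v <= p * q by rewrite -mulr_natr; nra.
rewrite (le_trans (ler_norm _))// -sqrtr_sqr -sqrtrM// ler_wsqrtr//.
have := sqr_ge0 (a * v - b * u); nra.
Qed.

Lemma chordxx f x : chord f x x = 0.
Proof. by rewrite /chord !subrr expr0n/= addr0 sqrtr0. Qed.

Lemma polygonal_length_cons f a x s :
  polygonal_length f a (x :: s) = chord f a x + polygonal_length f x s.
Proof. by rewrite /polygonal_length/= big_cons. Qed.

Lemma polygonal_length_nil f a : polygonal_length f a [::] = 0.
Proof. by rewrite /polygonal_length/= big_nil. Qed.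

Lemma path_last_le a s : path <%O a s -> a <= last a s.
Proof.
elim: s a => [|x s ih] a /=; first by rewrite lexx.
by move=> /andP[ax /ih]; apply: le_trans; exact: ltW.
Qed.

Section concave.
Variables (C : R -> R) (T M : R).
Hypotheses (cC : concave_on T C) (CM : forall t, 0 <= t <= T -> C t <= M).

(** On a decreasing stretch each chord is at most its run plus its drop, and both telescope. *)
Lemma polygonal_length_decr a s : 0 <= a -> path <%O a s -> last a s <= T ->
  (forall y z, a <= y -> y <= z -> z <= T -> C z <= C y) ->
  polygonal_length C a s <= (last a s - a) + (C a - C (last a s)).
Proof.
elim: s a => [|x s ih] a a0 /=.
  by rewrite polygonal_length_nil !subrr addr0.
move=> /andP[ax xs] lT dC; rewrite polygonal_length_cons.
have xl := path_last_le xs.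
have {ih} := ih x (le_trans a0 (ltW ax)) xs lT.
move=> /(_ (fun y z xy => dC y z (le_trans (ltW ax) xy))).
have := chord_le C a x.
have /dC : a <= a by [].
move=> /(_ x (ltW ax) (le_trans xl lT)) Cxa.
have -> : `|x - a| = x - a by rewrite gtr0_norm// subr_gt0.
have -> : `|C x - C a| = - (C x - C a) by rewrite ler0_norm// subr_le0.
by lra.
Qed.

(** A chord is at most its run plus its variation, and a concave function rises and then falls, so
    its total variation is at most [(M - C a) + (M - C b)], where [b] is the last point. The
    induction follows the rise; the first drop hands over to [polygonal_length_decr]. *)
Lemma polygonal_length_concave_le a s : 0 <= a -> path <%O a s ->
  last a s <= T ->
  polygonal_length C a s <= (last a s - a) + (2 * M - C a - C (last a s)).
Proof.
elim: s a => [|x s ih] a a0 /=.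
  rewrite polygonal_length_nil subrr add0r => _ aT.
  by have := CM (_ : 0 <= a <= T); rewrite a0 aT => /(_ isT); lra.
move=> /andP[ax xs] lT; rewrite polygonal_length_cons.
have xl := path_last_le xs.
have x0 : 0 <= x by lra.
have xT : x <= T by lra.
have := chord_le C a x.
have -> : `|x - a| = x - a by rewrite gtr0_norm// subr_gt0.
have [Cax|Cxa] := leP (C a) (C x).
  rewrite ger0_norm ?subr_ge0//.
  by have := ih x x0 xs lT; lra.
have Ca : C a <= M by apply: CM; lra.
rewrite ltr0_norm ?subr_lt0//.
(* The drop from [a] to [x] makes every later slope nonpositive. *)
have dC y z : x <= y -> y <= z -> z <= T -> C z <= C y.
  move=> xy yz zT; move: yz; rewrite le_eqVlt => /orP[/eqP<-//|yz].
  move: xy; rewrite le_eqVlt => /orP[/eqP xy|xy].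
    by rewrite -{y}xy in yz *; have := @cC a x z a0 ax yz zT; nra.
  have yT : y <= T by lra.
  have h2 := @cC x y z x0 xy yz zT.
  have h1 : C y <= C x by have := @cC a x y a0 ax xy yT; nra.
  by nra.
by have := @polygonal_length_decr x s x0 xs lT dC; lra.
Qed.

Hypothesis T0 : 0 < T.

Lemma has_sup_polygonal_length :
  has_sup [set polygonal_length C 0 s | s in itv_partition 0 T].
Proof.
split.
  by exists (polygonal_length C 0 [:: T]), [:: T] => //; exact: itv_partition1.
exists (T + (2 * M - C 0 - C T)) => _ [s /= [sp /eqP sl] <-].
have := polygonal_length_concave_le (lexx 0) sp.
by rewrite sl subr0; exact.
Qed.

Lemma graph_length_le : graph_length C 0 T <= T + (2 * M - C 0 - C T).
Proof.
apply: ge_sup; first by case: has_sup_polygonal_length.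
move=> _ [s /= [sp /eqP sl] <-].
have := polygonal_length_concave_le (lexx 0) sp.
by rewrite sl subr0; exact.
Qed.

Lemma polygonal_length_le s : itv_partition 0 T s ->
  polygonal_length C 0 s <= graph_length C 0 T.
Proof.
move=> sp; apply: sup_ubound; last by exists s.
by case: has_sup_polygonal_length.
Qed.

(** Two chords, up to [t] and down from it, already have this length. The end points are separate
    cases because partitions are strictly increasing. *)
Lemma graph_length_ge t : 0 <= t <= T ->
  2 * C t - C 0 - C T <= graph_length C 0 T.
Proof.
move=> /andP[+ +]; rewrite le_eqVlt => /orP[/eqP<- _|t0].
- have := polygonal_length_le (itv_partition1 T0).
  rewrite polygonal_length_cons polygonal_length_nil addr0.
  by have := chord_ge C 0 T; have := ler_norm (-(C T - C 0)); rewrite normrN => *; lra.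
rewrite le_eqVlt => /orP[/eqP->|tT].
- have := polygonal_length_le (itv_partition1 T0).
  rewrite polygonal_length_cons polygonal_length_nil addr0.
  by have := chord_ge C 0 T; have := ler_norm (C T - C 0) => *; lra.
- have /polygonal_length_le : itv_partition 0 T [:: t; T].
    by rewrite /itv_partition/= t0 tT eqxx.
  rewrite !polygonal_length_cons polygonal_length_nil addr0.
  have := chord_ge C 0 t; have := ler_norm (C t - C 0).
  have := chord_ge C t T; have := ler_norm (-(C T - C t)); rewrite normrN.
  by lra.
Qed.

(** A chord ending at [x] has a slope between those of the chords over [[x, T]] and [[0, x]]. The
    left side is what matters: mesh points and left limits both approach [x] from below. *)
Lemma concave_left_lipschitz x : 0 < x < T ->
  exists K, forall y, 0 <= y <= x -> `|C x - C y| <= K * (x - y).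
Proof.
move=> /andP[x0 xT].
exists (`|(C T - C x) / (T - x)| + `|(C x - C 0) / x|) => y /andP[y0].
rewrite le_eqVlt => /orP[/eqP->|yx]; first by rewrite !subrr normr0 mulr0.
have Tx : 0 < T - x by lra.
have h1 : (x - y) * ((C T - C x) / (T - x)) <= C x - C y.
  rewrite mulrA ler_pdivrMr//.
  by have := @cC y x T y0 yx xT (lexx T); lra.
have h2 : C x - C y <= (x - y) * ((C x - C 0) / x).
  rewrite mulrA ler_pdivlMr//.
  move: y0; rewrite le_eqVlt => /orP[/eqP<-|y0]; first by lra.
  by have := @cC 0 y x (lexx _) y0 yx (ltW xT); lra.
have := ler_norm ((C x - C 0) / x).
have := ler_norm (- ((C T - C x) / (T - x))); rewrite normrN.
move: h1 h2; set k := (C T - C x) / (T - x); set k' := (C x - C 0) / x.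
have := normr_ge0 k; have := normr_ge0 k'.
move=> *; rewrite ler_norml; apply/andP; split; nra.
Qed.

End concave.
End arc_length.

(** * Arc length as a limit along uniform meshes *)

Section mesh_length.
Context {R : realType}.
Implicit Types (f c C g : R -> R) (T t x y z M a b : R).

Definition mesh T n k : R := T * k%:R / n.+1%:R.

Definition mesh_length f T n : R :=
  \sum_(0 <= k < n.+1) chord f (mesh T n k) (mesh T n k.+1).

Lemma mesh0 T n : mesh T n 0 = 0.
Proof. by rewrite /mesh mulr0 mul0r. Qed.

Lemma meshT T n : mesh T n n.+1 = T.
Proof. by rewrite /mesh mulfK// pnatr_eq0. Qed.

Lemma mesh_lt T n i j : 0 < T -> (i < j)%N -> mesh T n i < mesh T n j.
Proof.
move=> T0 ij; rewrite /mesh ltr_pM2r ?invr_gt0 ?ltr0n//.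
by rewrite ltr_pM2l// ltr_nat.
Qed.

Lemma mesh_itv T n k : 0 < T -> (k <= n.+1)%N -> 0 <= mesh T n k <= T.
Proof.
move=> T0 kn; apply/andP; split.
  by rewrite /mesh divr_ge0// mulr_ge0// ltW.
by rewrite /mesh ler_pdivrMr ?ltr0n// ler_pM2l// ler_nat.
Qed.

Lemma polygonal_length_map f (g : nat -> R) i k :
  polygonal_length f (g i) [seq g j | j <- iota i.+1 k] =
  \sum_(i <= j < i + k) chord f (g j) (g j.+1).
Proof.
elim: k i => [|k ih] i; first by rewrite addn0 big_geq// polygonal_length_nil.
rewrite /= polygonal_length_cons ih -addSnnS [RHS]big_ltn//.
by rewrite addSn ltnS leq_addr.
Qed.

Lemma mesh_partition T n : 0 < T ->
  itv_partition 0 T [seq mesh T n j | j <- iota 1 n.+1].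
Proof.
move=> T0; split.
  have h k i : path <%O (mesh T n i) [seq mesh T n j | j <- iota i.+1 k].
    by elim: k i => [//|k ih] i /=; rewrite mesh_lt//= ih.
  by rewrite -(mesh0 T n) h.
rewrite -[in eqbLHS](mesh0 T n) last_map.
by rewrite -{2}(meshT T n) -nth_last size_iota nth_iota// add1n.
Qed.

Lemma mesh_lengthE f T n :
  mesh_length f T n = polygonal_length f 0 [seq mesh T n j | j <- iota 1 n.+1].
Proof. by rewrite -[in RHS](mesh0 T n) polygonal_length_map. Qed.

Lemma chord_sum f (g : nat -> R) i j : (i <= j)%N ->
  chord f (g i) (g j) <= \sum_(i <= l < j) chord f (g l) (g l.+1).
Proof.
move=> /subnKC <-; elim: (j - i)%N => [|k ih].
  by rewrite addn0 chordxx big_geq.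
rewrite addnS big_nat_recr ?leq_addr//=.
by rewrite (le_trans (chord_triangle _ _ (g (i + k)%N) _))// lerD2r.
Qed.

Definition mesh_index T n x : nat := Num.truncn (n.+1%:R * x / T).

Lemma mesh_index0 T n : mesh_index T n 0 = 0%N.
Proof. by rewrite /mesh_index mulr0 mul0r truncn0. Qed.

Lemma mesh_indexT T n : 0 < T -> mesh_index T n T = n.+1.
Proof. by move=> T0; rewrite /mesh_index mulfK ?gt_eqF// natrK. Qed.

Lemma mesh_index_le T n x y : 0 < T -> x <= y ->
  (mesh_index T n x <= mesh_index T n y)%N.
Proof.
by move=> T0 xy; apply: le_truncn; rewrite ler_pM2r ?invr_gt0// ler_pM2l ?ltr0n.
Qed.

Lemma mesh_index_itv T n x : 0 < T -> 0 <= x ->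
  x - T / n.+1%:R <= mesh T n (mesh_index T n x) <= x.
Proof.
move=> T0 x0.
have n0 : 0 < n.+1%:R :> R by rewrite ltr0n.
have h0 : 0 <= n.+1%:R * x / T by rewrite divr_ge0 ?mulr_ge0// ltW.
have /andP[h1 h2] := truncn_itv h0.
rewrite /mesh /mesh_index; move: h1 h2; set k := Num.truncn _.
rewrite ler_pdivlMr// ltr_pdivrMr// -natr1 => h1 h2.
apply/andP; split; last by rewrite ler_pdivrMr//; lra.
by rewrite lerBlDr -mulrDl ler_pdivlMr//; lra.
Qed.

Lemma cvg_mesh_index T x : 0 < T -> 0 <= x ->
  mesh T n (mesh_index T n x) @[n --> \oo] --> x.
Proof.
move=> T0 x0.
apply: (@squeeze_cvgr _ _ _ _ (fun n => x - T / n.+1%:R) (fun=> x)).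
- by near=> n; exact: mesh_index_itv.
- rewrite -[X in _ --> X]subr0; apply: cvgB; first exact: cvg_cst.
  rewrite -(mulr0 T); apply: cvgM; first exact: cvg_cst.
  exact: cvg_harmonic.
- exact: cvg_cst.
Unshelve. all: by end_near. Qed.

Lemma cvg_chord f (u v : nat -> R) x y : u n @[n --> \oo] --> x ->
  v n @[n --> \oo] --> y -> f (u n) @[n --> \oo] --> f x ->
  f (v n) @[n --> \oo] --> f y -> chord f (u n) (v n) @[n --> \oo] --> chord f x y.
Proof.
move=> ux vy fux fvy; rewrite /chord.
have sq (w : nat -> R) (l : R) : w n @[n --> \oo] --> l ->
    (w n) ^+ 2 @[n --> \oo] --> l ^+ 2.
  by move=> wl; rewrite expr2; under eq_fun do rewrite expr2; exact: cvgM.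
apply: (@continuous_cvg _ _ _ _ _ _ Num.sqrt); first exact: sqrt_continuous.
by apply: cvgD; apply: sq; exact: cvgB.
Qed.

Section concave.
Variables (C : R -> R) (T M : R).
Hypotheses (cC : concave_on T C) (CM : forall t, 0 <= t <= T -> C t <= M).
Hypothesis T0 : 0 < T.

Let r n x := mesh T n (mesh_index T n x).

Lemma cvg_concave_mesh x : 0 <= x <= T ->
  C (mesh T n (mesh_index T n x)) @[n --> \oo] --> C x.
Proof.
move=> /andP[]; rewrite le_eqVlt => /orP[/eqP<- _|x0].
  by under eq_fun do rewrite mesh_index0 mesh0; exact: cvg_cst.
rewrite le_eqVlt => /orP[/eqP->|xT].
  by under eq_fun do rewrite mesh_indexT// meshT; exact: cvg_cst.
have [|K CK] := @concave_left_lipschitz _ C T cC x; first by rewrite x0.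
have K0 : 0 <= K.
  have := CK 0; rewrite lexx ltW// subr0 => /(_ isT).
  by have := normr_ge0 (C x - C 0); nra.
apply/cvgrPdist_le => e e0.
have /cvgrPdist_le := cvg_mesh_index T0 (ltW x0).
have eK : 0 < e / (K + 1) by rewrite divr_gt0//; lra.
move=> /(_ _ eK); apply: filterS => n.
have /andP[_ h] := mesh_index_itv n T0 (ltW x0).
rewrite ger0_norm ?subr_ge0// ler_pdivlMr; last by lra.
move=> h2; apply: (le_trans (CK _ _)).
  rewrite h andbT /mesh divr_ge0// mulr_ge0//; exact: ltW.
by move: h h2; set m := mesh _ _ _; nra.
Qed.

Lemma cvg_polygonal_round a s : 0 <= a -> path <%O a s -> last a s <= T ->
  \sum_(p <- zip (a :: s) s) chord C (r n p.1) (r n p.2) @[n --> \oo] -->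
  polygonal_length C a s.
Proof.
elim: s a => [|x s ih] a a0 /=.
  move=> _ _; rewrite polygonal_length_nil.
  by under eq_fun do rewrite big_nil; exact: cvg_cst.
move=> /andP[ax xs] lT; rewrite polygonal_length_cons.
have xl := path_last_le xs.
under eq_fun do rewrite big_cons.
apply: cvgD; last by apply: ih => //; lra.
apply: cvg_chord.
- by apply: cvg_mesh_index => //=; lra.
- by apply: cvg_mesh_index => //=; lra.
- by apply: cvg_concave_mesh => /=; lra.
- by apply: cvg_concave_mesh => /=; lra.
Qed.

Lemma polygonal_round_le a s n : 0 <= a -> path <%O a s ->
  \sum_(p <- zip (a :: s) s) chord C (r n p.1) (r n p.2) <=
  \sum_(mesh_index T n a <= k < mesh_index T n (last a s))
     chord C (mesh T n k) (mesh T n k.+1).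
Proof.
elim: s a => [|x s ih] a a0 /=; first by rewrite big_nil big_geq.
move=> /andP[ax xs]; rewrite big_cons/=.
rewrite (@big_cat_nat _ _ _ (mesh_index T n x))/=; last 2 first.
- by apply: mesh_index_le => //; exact: ltW.
- by apply: mesh_index_le => //; exact: path_last_le.
apply: lerD; last by apply: ih => //; lra.
by apply: chord_sum; apply: mesh_index_le => //; exact: ltW.
Qed.

Lemma mesh_length_le n : mesh_length C T n <= graph_length C 0 T.
Proof.
rewrite mesh_lengthE; apply: (polygonal_length_le cC CM T0).
exact: mesh_partition.
Qed.

(** Arc length is a supremum over uncountably many partitions; written as the limit of a sequence it
    inherits measurability. Rounding the points of a nearly optimal partition down to the mesh
    changes its length little, since [C] is left-continuous inside the interval and the end points
    are mesh points. By the triangle inequality the rounded polygon is no longer than the mesh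
    polygon. *)
Lemma cvg_mesh_length :
  mesh_length C T n @[n --> \oo] --> graph_length C 0 T.
Proof.
apply/cvgrPdist_le => e e0.
have e2 : 0 < e / 2 by lra.
have [_ [s [sp /eqP sl] <-] gs] :=
  sup_adherent e2 (has_sup_polygonal_length cC CM T0).
have := cvg_polygonal_round (lexx 0) sp; rewrite sl => /(_ (lexx _)).
move/cvgrPdist_le => /(_ _ e2); apply: filterS => n.
have := polygonal_round_le n (lexx 0) sp.
rewrite sl mesh_index0 mesh_indexT// -/(mesh_length C T n) => h1.
rewrite ler_norml => /andP[h2 h3].
rewrite ger0_norm ?subr_ge0 ?mesh_length_le//.
by move: gs h1 h2 h3; rewrite /graph_length; lra.
Qed.

End concave.
End mesh_length.

(** * Cadlag paths and their dyadic skeletons *)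

Section cadlag_paths.
Context {R : realType}.
Implicit Types (f c C g : R -> R) (T t x y z M a b e : R).

Definition sup_int f a b : R := sup [set f t | t in `[a, b]].

Lemma cadlag_right f t e : cadlag f -> 0 <= t -> 0 < e ->
  exists2 r, 0 < r & forall y, t <= y < t + r -> `|f y - f t| <= e.
Proof.
move=> cf t0 e0; have [/cvgrPdist_le/(_ _ e0)[r /= r0 H] _] := cf t t0.
exists r => // y /andP[]; rewrite le_eqVlt => /orP[/eqP<- _|ty yr].
  by rewrite subrr normr0 ltW.
rewrite distrC; apply: H => //=.
by rewrite ltr0_norm ?subr_lt0//; lra.
Qed.

Lemma cvg_leftP f t l e : f x @[x --> t^'-] --> l -> 0 < e ->
  exists2 r, 0 < r & forall y, t - r < y < t -> `|f y - l| <= e.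
Proof.
move=> fl e0; have /cvgrPdist_le/(_ _ e0)[r /= r0 H] := fl.
exists r => // y /andP[ty yr]; rewrite distrC; apply: H => //=.
by rewrite gtr0_norm ?subr_gt0//; lra.
Qed.

Lemma cadlag_left f t : cadlag f -> 0 < t ->
  exists l : R, f x @[x --> t^'-] --> l.
Proof.
by move=> cf t0; have [_ /(_ t0)/cvg_ex[l fl]] := cf t (ltW t0); exists l.
Qed.

(** Continuation: at the supremum of the [u] up to which [f] is bounded, the left limit and
    right-continuity bound [f] on both sides, so that supremum cannot be below [T]. *)
Lemma cadlag_bounded f T : cadlag f ->
  exists M, forall t, 0 <= t <= T -> `|f t| <= M.
Proof.
move=> cf; have [T0|T0] := ltP T 0.
  by exists 0 => t /andP[t0 tT]; lra.
pose B := [set u | 0 <= u <= T /\ exists M, forall t, 0 <= t <= u -> `|f t| <= M].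
have B0 : B 0.
  split; first by rewrite lexx.
  by exists `|f 0| => t /andP[t0 t0']; have -> : t = 0 by lra.
have supB : has_sup B by split; [exists 0|exists T => u [/andP[]]].
have s0 : 0 <= sup B by apply: sup_ubound => //; case: supB.
have sT : sup B <= T by apply: ge_sup; [exists 0|move=> u [/andP[]]].
have [r r0 fr] := cadlag_right cf s0 ltr01.
have [r' r'0 [M' fM']] : exists2 r', 0 < r' & exists M, forall y, 0 <= y ->
    sup B - r' < y < sup B -> `|f y| <= M.
  have [->|/eqP sN0] := eqVneq (sup B) 0.
    by exists 1 => //; exists 0 => y; lra.
  have {}sN0 : 0 < sup B by rewrite lt_neqAle s0 eq_sym; apply/andP; split => //; apply/eqP.
  have [l fl] := cadlag_left cf sN0.
  have [r' r'0 fr'] := cvg_leftP fl ltr01.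
  exists r' => //; exists (`|l| + 1) => y y0 /fr' h.
  by have := ler_normD (f y - l) l; rewrite subrK; lra.
have [u [/andP[u0 uT] [M fM]] ul] := sup_adherent r'0 supB.
pose M1 := Num.max M (Num.max M' (`|f (sup B)| + 1)).
have fM1 y : 0 <= y -> y < sup B + r -> `|f y| <= M1.
  move=> y0 yr; rewrite /M1 !le_max.
  have [yu|uy] := leP y u; first by rewrite fM// y0.
  have [ys|sy] := ltP y (sup B).
    by rewrite (fM' y y0) ?orbT// ys andbT (lt_trans ul).
  have := fr y; rewrite sy yr => /(_ isT) h.
  have := ler_normD (f y - f (sup B)) (f (sup B)); rewrite subrK => h2.
  by apply/orP; right; apply/orP; right; lra.
exists M1 => t /andP[t0 tT]; apply: (fM1) => //.
rewrite ltNge; apply/negP => st.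
have : B (sup B + r / 2).
  split; first by apply/andP; split; lra.
  by exists M1 => y /andP[y0 yr]; apply: fM1 => //; lra.
by move/(ub_le_sup (proj2 supB)); lra.
Qed.

Lemma le_sup_int f a b t : cadlag f -> 0 <= a -> a <= t <= b -> f t <= sup_int f a b.
Proof.
move=> cf a0 /andP[at_ tb]; have [M fM] := cadlag_bounded b cf; apply: sup_ubound.
  exists M => _ [y /= + <-]; rewrite in_itv/= => /andP[ay yb].
  by apply: (le_trans (ler_norm _)); apply: fM; rewrite yb andbT; lra.
by exists t => //=; rewrite in_itv/= at_.
Qed.

Lemma sup_int_le f a b m : a <= b -> (forall t, a <= t <= b -> f t <= m) ->
  sup_int f a b <= m.
Proof.
move=> ab fm; apply: ge_sup; first by exists (f a), a => //=; rewrite in_itv/= lexx.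
by move=> _ [y /= + <-]; rewrite in_itv/=; exact: fm.
Qed.

Lemma sup_int_subset f a b a' b' : cadlag f -> 0 <= a' -> a' <= a -> a <= b ->
  b <= b' -> sup_int f a b <= sup_int f a' b'.
Proof.
move=> cf a0 aa ab bb; apply: sup_int_le => // t /andP[at_ tb].
by apply: le_sup_int => //; apply/andP; split; lra.
Qed.

Lemma sup_int_gt f a b m : a <= b -> m < sup_int f a b ->
  exists2 t, a <= t <= b & m < f t.
Proof.
move=> ab /sup_gt[|_ [t /= + <-] mt]; last by rewrite in_itv/=; exists t.
by exists (f a), a => //=; rewrite in_itv/= lexx.
Qed.

Definition sup_times f T := [set t | 0 <= t <= T /\
  (f t = sup_on f T \/ 0 < t /\ f x @[x --> t^'-] --> sup_on f T)].

(** Let [g] be the infimum of the [u] whose running supremum is already the full one. If neither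
    [f g] nor the left limit at [g] equals the supremum, then [f] stays below some smaller bound
    before [g] and, by right-continuity, also shortly after it; this contradicts the choice of
    [g]. *)
Lemma sup_times_nonempty f T : cadlag f -> 0 <= T -> sup_times f T !=set0.
Proof.
move=> cf T0; apply: contrapT => /set0P/negP/negPn/eqP A0.
have noA t : 0 <= t <= T ->
    f t <> sup_on f T /\ (0 < t -> ~ (f x @[x --> t^'-] --> sup_on f T)).
  move=> tT; split; first by move=> ft; rewrite -[False]/(set0 t) -A0; split => //; left.
  by move=> t0 ft; rewrite -[False]/(set0 t) -A0; split => //; right.
set S := sup_on f T in noA.
have fS t : 0 <= t <= T -> f t <= S by move=> tT; apply: le_sup_int.
pose B := [set u | 0 <= u <= T /\ sup_int f 0 u = S].
have BT : B T by split => //; rewrite T0 lexx.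
have infB : has_inf B by split; [exists T|exists 0 => u [/andP[]]].
have g0 : 0 <= inf B by apply: lb_le_inf; [exists T|move=> u [/andP[]]].
have gT : inf B <= T by apply: ge_inf => //; case: infB.
set g := inf B in g0 gT *.
have gg : 0 <= g <= T by rewrite g0.
have [fgS noL] := noA g gg.
have {}fgS : f g < S by rewrite lt_neqAle fS// andbT; apply/eqP.
have e0 : 0 < (S - f g) / 2 by lra.
have [r r0 fr] := cadlag_right cf g0 e0.
have [m mS fm] : exists2 m, m < S & forall y, 0 <= y < g -> f y <= m.
  have [->|/eqP gN0] := eqVneq g 0; first by exists (S - 1); [lra|move=> y; lra].
  have {}gN0 : 0 < g by rewrite lt_neqAle g0 eq_sym; apply/andP; split => //; apply/eqP.
  have [l fl] := cadlag_left cf gN0.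
  have lS : l < S.
    rewrite ltNge; apply/negP => Sl; apply: (noL gN0).
    suff <- : l = S by [].
    apply/eqP; rewrite eq_le Sl andbT; apply/ler_addgt0Pr => e e1.
    have [q q0 fq] := cvg_leftP fl e1.
    pose y := Num.max (g - q / 2) (g / 2).
    have yg : y < g by rewrite /y gt_max; apply/andP; split; lra.
    have yq : g - q < y by rewrite /y lt_max; apply/orP; left; lra.
    have y0 : 0 <= y by rewrite /y le_max; apply/orP; right; lra.
    have := fq y; rewrite yg yq => /(_ isT); rewrite ler_norml => /andP[].
    have fyS : f y <= S by apply: (fS); rewrite y0/=; lra.
    lra.
  have e1 : 0 < (S - l) / 2 by lra.
  have [q q0 fq] := cvg_leftP fl e1.
  pose u := Num.max 0 (g - q / 2).
  have ug : u < g by rewrite /u gt_max gN0/=; lra.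
  have u0 : 0 <= u by rewrite /u le_max lexx.
  have uT : 0 <= u <= T by rewrite u0/=; lra.
  have uS : sup_int f 0 u < S.
    rewrite lt_neqAle; apply/andP; split; last by apply: sup_int_subset => //; lra.
    apply/eqP => uB; have : B u by [].
    by move/(ge_inf (proj2 infB)); rewrite -/g; lra.
  exists (Num.max (sup_int f 0 u) (l + (S - l) / 2)).
    by rewrite gt_max uS/=; lra.
  move=> y /andP[y0 yg]; rewrite le_max.
  have [yu|uy] := leP y u; first by rewrite le_sup_int// y0.
  have yq : g - q < y.
    by apply: le_lt_trans uy; rewrite /u le_max; apply/orP; right; lra.
  have := fq y; rewrite yg yq => /(_ isT); rewrite ler_norml => /andP[_ h].
  by apply/orP; right; lra.
have [b [/andP[b0 bT] bS] bg] := inf_adherent r0 infB.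
have : sup_int f 0 b <= Num.max m (f g + (S - f g) / 2).
  apply: sup_int_le => // t /andP[t0 tb]; rewrite le_max.
  have [tg|gt] := ltP t g; first by rewrite fm// t0.
  have := fr t; rewrite gt (le_lt_trans tb bg) => /(_ isT).
  by rewrite ler_norml => /andP[_ h]; apply/orP; right; lra.
by rewrite bS leNgt gt_max mS/=; lra.
Qed.

Lemma sup_on_subset f u T : cadlag f -> 0 <= u <= T -> sup_on f u <= sup_on f T.
Proof. by move=> cf /andP[u0 uT]; exact: sup_int_subset. Qed.

Lemma sup_times_le f u T : cadlag f -> 0 <= u <= T -> sup_on f u = sup_on f T ->
  exists2 t, sup_times f T t & t <= u.
Proof.
move=> cf /andP[u0 uT] uT'; have [t [/andP[t0 tu] ft]] := sup_times_nonempty cf u0.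
by exists t => //; split; [rewrite t0/=; lra|rewrite -uT'].
Qed.

Lemma sup_on_sup_times f t u T : cadlag f -> sup_times f T t -> t <= u <= T ->
  sup_on f u = sup_on f T.
Proof.
move=> cf [/andP[t0 tT] ft] /andP[tu uT].
apply/eqP; rewrite eq_le sup_on_subset ?(le_trans t0 tu)//=.
case: ft => [<-|[tp ft]]; first by apply: le_sup_int => //; rewrite t0.
apply/ler_addgt0Pr => e e0; have [q q0 fq] := cvg_leftP ft e0.
pose y := Num.max (t - q / 2) (t / 2).
have yg : y < t by rewrite /y gt_max; apply/andP; split; lra.
have yq : t - q < y by rewrite /y lt_max; apply/orP; left; lra.
have y0 : 0 <= y by rewrite /y le_max; apply/orP; right; lra.
have := fq y; rewrite yg yq => /(_ isT); rewrite ler_norml => /andP[].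
have : f y <= sup_on f u by apply: le_sup_int => //; rewrite y0/=; lra.
lra.
Qed.

Lemma time_of_sup_itv f T : cadlag f -> 0 <= T -> 0 <= time_of_sup f T <= T.
Proof.
move=> cf T0; have [t At] := sup_times_nonempty cf T0.
apply/andP; split; first by apply: lb_le_inf; [exists t|move=> u [/andP[]]].
have [/andP[_ tT] _] := At; apply: (le_trans _ tT); apply: ge_inf => //.
by exists 0 => u [/andP[]].
Qed.

(** This turns statements about the time of the supremum into comparisons of suprema, which rescale,
    are measurable and can be approximated on a skeleton. *)
Lemma sup_on_lt f u T : cadlag f -> 0 <= u <= T ->
  (sup_on f u < sup_on f T) = (u < time_of_sup f T).
Proof.
move=> cf uT; have /andP[u0 uT'] := uT.
have T0 : 0 <= T by lra.
have [t0 At0] := sup_times_nonempty cf T0.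
have infA : has_inf (sup_times f T) by split; [exists t0|exists 0 => v [/andP[]]].
apply/idP/idP => [lt|].
  rewrite ltNge; apply/negP; rewrite le_eqVlt => /orP[/eqP E|]; last first.
    move=> /(inf_lt (proj1 infA))[t At tu].
    by move: lt; rewrite (sup_on_sup_times cf At) ?ltxx// ltW.
  (* The case where [u] is the infimum itself: by right-continuity the running supremum stays
     strictly below the full one for a short time after [u], yet a member of [sup_times] lies
     there. *)
  have {}E : u = inf (sup_times f T) by rewrite -E.
  have e0 : 0 < (sup_on f T - sup_on f u) / 2 by lra.
  have [r r0 fr] := cadlag_right cf u0 e0.
  have [t At tr] := inf_adherent r0 infA; rewrite -E in tr.
  have ut : u <= t by rewrite E; apply: ge_inf => //; case: infA.
  have [/andP[_ tT] _] := At.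
  have := sup_on_sup_times cf At (_ : t <= t <= T); rewrite lexx tT => /(_ isT).
  apply/eqP; rewrite lt_eqF//.
  apply: (@le_lt_trans _ _ (sup_on f u + (sup_on f T - sup_on f u) / 2)); last by lra.
  apply: sup_int_le; first by lra.
  move=> v /andP[v0 vt].
  have [vu|uv] := leP v u.
    have : f v <= sup_on f u by apply: le_sup_int => //; rewrite v0.
    by lra.
  have := fr v; rewrite (ltW uv) (le_lt_trans vt tr) => /(_ isT).
  rewrite ler_norml => /andP[_].
  have : f u <= sup_on f u by apply: le_sup_int => //; rewrite u0/=.
  lra.
move=> ug; rewrite lt_neqAle sup_on_subset// andbT; apply/eqP => E.
have [t At tu] := sup_times_le cf uT E.
have : time_of_sup f T <= t by apply: ge_inf => //; case: infA.
lra.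
Qed.

Lemma time_of_supP f T : cadlag f -> 0 <= T -> sup_times f T (time_of_sup f T).
Proof.
move=> cf T0; have gT := time_of_sup_itv cf T0.
have := sup_on_lt cf gT; rewrite ltxx => /negbT; rewrite -leNgt => le.
have E : sup_on f (time_of_sup f T) = sup_on f T.
  by apply/eqP; rewrite eq_le le andbT sup_on_subset.
have [t At tg] := sup_times_le cf gT E.
suff -> : time_of_sup f T = t by [].
apply/eqP; rewrite eq_le; apply/andP; split => //.
by apply: ge_inf => //; exists 0 => u [/andP[]].
Qed.

(** Before the time [g] of the supremum, the running supremum of the path is strictly smaller, so
    [concave_majorant_lt_left] keeps the majorant strictly below. At [g < T] a left limit of the
    path is reached because the majorant is left-continuous there. At [T] the majorant takes the
    value [f T], so a supremum approached only from the left at [T] would not be attained by it;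
    left-continuity of the path at [T] excludes this. *)
Lemma first_argmax_concave_majorant f T : cadlag f -> 0 < T ->
  f x @[x --> T^'-] --> f T ->
  first_argmax (concave_majorant f T) T = time_of_sup f T.
Proof.
move=> cf T0 fT; have [M fM'] := cadlag_bounded T cf.
have fM t : 0 <= t <= T -> f t <= sup_on f T by move=> *; exact: le_sup_int.
set g := time_of_sup f T; set C := concave_majorant f T.
have CM t : 0 <= t <= T -> C t <= sup_on f T.
  exact: concave_majorant_le_bound.
have cC : concave_on T C := concave_majorant_concave fM.
have fC t : 0 <= t <= T -> f t <= C t by exact: (concave_majorant_ge fM).
have [gT gA] := time_of_supP cf (ltW T0); rewrite -/g in gT gA.
have Cg : C g = sup_on f T.
  apply/eqP; rewrite eq_le CM//=.
  case: gA => [<-|[g0 fg]]; first exact: fC.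
  have /andP[_ gT'] := gT.
  have [E|{}gT'] : g = T \/ g < T.
    by move: gT'; rewrite le_eqVlt => /orP[/eqP|]; [left|right].
    have -> : sup_on f T = f T.
      by rewrite E in fg; exact: (cvg_unique _ fg fT).
    by rewrite E fC// lexx ltW.
  have [|K CK] := @concave_left_lipschitz _ C T cC g; first by rewrite g0.
  have K0 : 0 <= K.
    have := CK 0; rewrite lexx (ltW g0) subr0 => /(_ isT).
    by have := normr_ge0 (C g - C 0); nra.
  apply/ler_addgt0Pr => e e0.
  have e2 : 0 < e / 2 by lra.
  have [q q0 fq] := cvg_leftP fg e2.
  pose d := Num.min (g / 2) (Num.min (q / 2) (e / 2 / (K + 1))).
  have d1 : d <= g / 2 by rewrite /d ge_min lexx.
  have d2 : d <= q / 2 by rewrite /d !ge_min lexx !orbT.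
  have d3 : d * (K + 1) <= e / 2.
    by rewrite -ler_pdivlMr; [rewrite /d !ge_min lexx !orbT|lra].
  have d0 : 0 < d.
    rewrite /d !lt_min; apply/andP; split; first by lra.
    by apply/andP; split; [lra|rewrite divr_gt0//; lra].
  have := CK (g - d); have -> : g - (g - d) = d by ring.
  have -> : 0 <= g - d <= g by apply/andP; split; lra.
  move=> /(_ isT); rewrite ler_norml => /andP[h1 _].
  have := fq (g - d); have -> : g - q < g - d < g by apply/andP; split; lra.
  move=> /(_ isT); rewrite ler_norml => /andP[h2 _].
  have : f (g - d) <= C (g - d) by apply: fC; apply/andP; split; lra.
  nra.
have supC : sup_on C T = sup_on f T := sup_on_concave_majorant T0 fM.
apply/eqP; rewrite eq_le; apply/andP; split.
  by apply: ge_inf; [exists 0 => u [/andP[]]|split => //; rewrite supC].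
apply: lb_le_inf; first by exists g; split => //; rewrite supC.
move=> t [/andP[t0 tT]]; rewrite supC => Ct; rewrite leNgt; apply/negP => tg.
have : C t < sup_on f T.
  apply: (@concave_majorant_lt_left _ f T _ fM (sup_on f ((t + g) / 2)) ((t + g) / 2)) => //.
  - by lra.
  - by move: gT => /andP[]; lra.
  - rewrite sup_on_lt//; first by rewrite -/g; lra.
    by move: gT => /andP[]; lra.
  - by move=> s sg; apply: le_sup_int.
by rewrite Ct ltxx.
Qed.

End cadlag_paths.

(** * Dyadic maxima and the time of the supremum *)

Section skeletons.
Context {R : realType}.
Implicit Types (f c C g : R -> R) (T t x y z M a b e d : R) (p r j k i : nat).

Definition dy r k : R := k%:R / 2 ^+ r.

Lemma dy_ge0 r k : 0 <= dy r k.
Proof. by rewrite divr_ge0// exprn_ge0. Qed.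

Lemma dy0 r : dy r 0 = 0.
Proof. by rewrite /dy mul0r. Qed.

Lemma dy1 r : dy r (2 ^ r) = 1.
Proof. by rewrite /dy natrX divff// expf_eq0/= pnatr_eq0 andbF. Qed.

Lemma ler_dy r i k : (dy r i <= dy r k) = (i <= k)%N.
Proof. by rewrite ler_pM2r ?ler_nat// invr_gt0 exprn_gt0. Qed.

Lemma dyM r j k : dy (r + j) (k * 2 ^ j) = dy r k.
Proof.
rewrite /dy natrM natrX exprD; field.
by rewrite !expf_eq0/= !pnatr_eq0 !andbF.
Qed.

Lemma dyB r i k : (i <= k)%N -> dy r k - dy r i = dy r (k - i).
Proof. by move=> ik; rewrite /dy -mulrBl natrB. Qed.

(** The seed of the maximum is its first term, so it adds no value when [i <= k]. *)
Definition gmax f r i k : R := \big[Num.max/f (dy r i)]_(i <= l < k.+1) f (dy r l).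

Lemma gmax_ge f r i k l : (i <= l <= k)%N -> f (dy r l) <= gmax f r i k.
Proof. by move=> lk; apply: le_bigmax_seq => //; rewrite mem_index_iota. Qed.

Lemma gmax_le f r i k m : (i <= k)%N ->
  (forall l, (i <= l <= k)%N -> f (dy r l) <= m) -> gmax f r i k <= m.
Proof.
move=> ik fm; rewrite /gmax big_nat_cond; apply: bigmax_le.
  by apply: fm; rewrite leqnn.
by move=> l; rewrite andbT => h; exact: fm.
Qed.

Lemma gmax_le_sup_int f r i k : cadlag f -> (i <= k)%N ->
  gmax f r i k <= sup_int f (dy r i) (dy r k).
Proof.
move=> cf ik; apply: gmax_le => // l /andP[il lk].
by apply: le_sup_int => //; rewrite ?dy_ge0// !ler_dy il.
Qed.

Lemma exists_dy x e p : 0 <= x -> 0 < e ->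
  \forall j \near \oo, exists l, x < dy (p + j) l <= x + e.
Proof.
move=> x0 e0.
have /cvgrPdist_lt /(_ _ e0) : (2^-1 : R) ^+ j @[j --> \oo] --> (0 : R).
  by apply: cvg_expr; rewrite ger0_norm ?invr_ge0//; lra.
apply: filterS => j; rewrite sub0r normrN ger0_norm ?exprn_ge0 ?invr_ge0// => je.
have p0 : 0 < 2 ^+ (p + j) :> R by rewrite exprn_gt0.
have xp : 0 <= x * 2 ^+ (p + j) by rewrite mulr_ge0// ltW.
have /andP[h1 h2] := truncn_itv xp.
exists (Num.truncn (x * 2 ^+ (p + j))).+1; rewrite /dy.
rewrite ltr_pdivlMr// h2/= ler_pdivrMr// mulrDl -natr1 lerD//.
rewrite -ler_pdivrMr// mul1r -exprVn; apply: le_trans (ltW je).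
by rewrite exprD ler_piMl ?exprn_ge0 ?invr_ge0// exprn_ile1// ?invr_ge0//; lra.
Qed.

(** By right-continuity a nearly maximal value is nearly reached at dyadic points just to the right.
    At the right end there is no room, but that point is itself dyadic. *)
Lemma cvg_gmax f p i k : cadlag f -> (i <= k)%N ->
  gmax f (p + j) (i * 2 ^ j) (k * 2 ^ j) @[j --> \oo] -->
  sup_int f (dy p i) (dy p k).
Proof.
move=> cf ik; apply/cvgrPdist_le => e e0.
have le j : gmax f (p + j) (i * 2 ^ j) (k * 2 ^ j) <= sup_int f (dy p i) (dy p k).
  rewrite -(dyM p j i) -(dyM p j k); apply: gmax_le_sup_int => //.
  by rewrite leq_mul2r ik orbT.
have e2 : 0 < e / 2 by lra.
have [t /andP[it tk] ft] : exists2 t, dy p i <= t <= dy p k &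
    sup_int f (dy p i) (dy p k) - e / 2 < f t.
  by apply: sup_int_gt; [rewrite ler_dy|lra].
have t0 : 0 <= t := le_trans (dy_ge0 _ _) it.
have close j l : (i * 2 ^ j <= l <= k * 2 ^ j)%N -> `|f (dy (p + j) l) - f t| <= e / 2 ->
    `|sup_int f (dy p i) (dy p k) - gmax f (p + j) (i * 2 ^ j) (k * 2 ^ j)| <= e.
  move=> /(gmax_ge f (p + j)) h; rewrite ler_norml => /andP[h1 _].
  by rewrite ger0_norm ?subr_ge0//; lra.
move: tk; rewrite le_eqVlt => /orP[/eqP tk|tk].
  apply: nearW => j; apply: (close j (k * 2 ^ j)%N).
    by rewrite leqnn andbT leq_mul2r ik orbT.
  by rewrite dyM -tk subrr normr0 ltW.
have [q q0 fq] := cadlag_right cf t0 e2.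
have d0 : 0 < Num.min (q / 2) (dy p k - t).
  by rewrite lt_min; apply/andP; split; lra.
apply: filterS (exists_dy p t0 d0) => j [l /andP[tl lt]].
apply: (close j l).
  rewrite -!(ler_dy (p + j)) !dyM; apply/andP; split; first by lra.
  apply: (le_trans lt); rewrite -lerBrDl.
  by rewrite ge_min lexx orbT.
apply: fq; rewrite (ltW tl)/=; apply: (le_lt_trans lt); rewrite ltrD2l.
by rewrite gt_min; apply/orP; left; lra.
Qed.

(* A Lipschitz substitute, when D is the running maximum of f, for the proportion
   of the k such that D k < D (2 ^ p), that is, k / 2 ^ p < time_of_sup f 1. *)
Definition location e p (D : nat -> R) : R :=
  (2 ^+ p)^-1 * \sum_(k < 2 ^ p) Num.min 1 ((D (2 ^ p)%N - D k) / e).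

Lemma location_lipschitz e p (D D' : nat -> R) d : 0 < e ->
  (forall k, (k <= 2 ^ p)%N -> `|D k - D' k| <= d) ->
  `|location e p D - location e p D'| <= 2 * d / e.
Proof.
move=> e0 DD; rewrite /location -mulrBr normrM ger0_norm ?invr_ge0 ?exprn_ge0//.
rewrite ler_pdivrMl ?exprn_gt0// -sumrB (le_trans (ler_norm_sum _ _ _))//.
have -> : 2 ^+ p * (2 * d / e) = \sum_(k < 2 ^ p) (2 * d / e).
  by rewrite sumr_const card_ord -[RHS]mulr_natl natrX.
apply: ler_sum => k _.
have /ler_normlP[h1 h2] := DD k (ltnW (ltn_ord k)).
have /ler_normlP[h3 h4] := DD _ (leqnn (2 ^ p)).
have h : `|(D (2 ^ p)%N - D k) / e - (D' (2 ^ p)%N - D' k) / e| <= 2 * d / e.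
  rewrite -mulrBl normrM (@gtr0_norm _ e^-1) ?invr_gt0//.
  by rewrite ler_pM2r ?invr_gt0// ler_norml; apply/andP; split; lra.
move: h; move: (_ / e) (_ / e) (_ / e) => x y m.
rewrite !ler_norml => /andP[h5 h6]; rewrite /Num.min.
by case: ifP => [|/negbT]; case: ifP => [|/negbT]; rewrite -?leNgt => *; apply/andP; split; lra.
Qed.

(** The sum counts the natural numbers below [x], so it is the ceiling of [x]. *)
Lemma sum_lt_nat n x : 0 <= x <= n%:R ->
  x <= (\sum_(k < n) (k%:R < x)%R%:R) <= x + 1.
Proof.
elim: n => [|n ih] /andP[x0 xn].
  by rewrite big_ord0; apply/andP; split; lra.
rewrite big_ord_recr/=; have [nx|xn'] := ltP n%:R x.
  have -> : \sum_(i < n) (i%:R < x)%R%:R = n%:R :> R.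
    rewrite (eq_bigr (fun=> 1)); first by rewrite sumr_const card_ord.
    by move=> i _; rewrite (lt_trans _ nx)// ltr_nat.
  by move: xn; rewrite -natr1 /= => xn; apply/andP; split; lra.
by rewrite addr0; apply: ih; rewrite x0.
Qed.

Lemma sum_bool_le1 n (b : nat -> bool) :
  (forall i k, (i < k)%N -> (k < n)%N -> b i -> b k -> False) ->
  \sum_(k < n) (b k)%:R <= 1 :> R.
Proof.
elim: n => [|n ih] h; first by rewrite big_ord0.
rewrite big_ord_recr/=; case bn: (b n).
  rewrite big1 ?add0r// => i _.
  by case bi: (b i) => //; have := h i n (ltn_ord i) (ltnSn n) bi bn.
by rewrite addr0; apply: ih => i k ik kn; apply: h => //; exact: ltnW.
Qed.

(** The maximum up to one end of a dyadic cell nearly equals the maximum from its other end on. The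
    increment over the cell in between supplies the randomness that makes this unlikely. *)
Definition tie e p f k := `|sup_int f (dy p k.+1) 1 - sup_on f (dy p k)| < e.

Lemma sup_on_split f u T : cadlag f -> 0 <= u <= T ->
  sup_on f T = Num.max (sup_on f u) (sup_int f u T).
Proof.
move=> cf /andP[u0 uT]; apply/eqP; rewrite eq_le ge_max.
rewrite sup_on_subset ?u0//= (_ : sup_int f u T <= sup_on f T) ?andbT; last first.
  exact: sup_int_subset.
apply: sup_int_le; first by lra.
move=> t /andP[t0 tT]; rewrite le_max; have [tu|ut] := leP t u.
  by rewrite le_sup_int// t0.
by rewrite (@le_sup_int _ f u T) ?orbT// (ltW ut).
Qed.

(** Let [D k] be the missing part of the running supremum. A term of [location] differs from the
    indicator of [0 < D k] only if [0 < D k < e]. Two such indices [i < k] would give a tie at [i],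
    because [0 < D i.+1] puts the supremum after the cell. So at most one term is wrong, and the
    ceiling costs another unit: two units in all, divided by [2 ^ p]. *)
Lemma time_of_sup_location e p f : cadlag f -> 0 < e ->
  (forall k, (k < 2 ^ p)%N -> ~ tie e p f k) ->
  `|time_of_sup f 1 - location e p (fun k => sup_on f (dy p k))| <= 2 / 2 ^+ p.
Proof.
move=> cf e0 notie; rewrite /location dy1.
have p0 : 0 < 2 ^+ p :> R by rewrite exprn_gt0.
have dy01 k : (k <= 2 ^ p)%N -> 0 <= dy p k <= 1.
  by move=> kp; rewrite dy_ge0/= -(dy1 p) ler_dy.
have [g0 g1] := andP (time_of_sup_itv cf (@ler01 R)).
set g := time_of_sup f 1 in g0 g1 *.
have pg : 0 <= 2 ^+ p * g <= (2 ^ p)%:R.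
  by rewrite natrX ger_pMr// g1 andbT mulr_ge0// ltW.
have := sum_lt_nat pg; set Sg := \sum_(k < _) _ => /andP[S1 S2].
pose D k := sup_on f 1 - sup_on f (dy p k).
have D_ge0 k : (k <= 2 ^ p)%N -> 0 <= D k.
  by move=> kp; rewrite subr_ge0 sup_on_subset// dy01.
have Dlt (k : 'I_(2 ^ p)) : (k%:R < 2 ^+ p * g) = (0 < D k).
  by rewrite subr_gt0 sup_on_lt ?dy01// 1?ltnW// -/g /dy ltr_pdivrMr// mulrC.
have : `|\sum_(k < 2 ^ p) Num.min 1 (D k / e) - Sg| <= 1.
  rewrite -sumrB (le_trans (ler_norm_sum _ _ _))//.
  apply: (le_trans _ (@sum_bool_le1 (2 ^ p) (fun k => 0 < D k < e) _)).
    apply: ler_sum => k _; rewrite Dlt.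
    have := D_ge0 k (ltnW (ltn_ord k)).
    rewrite le_eqVlt => /orP[/eqP <-|Dk].
      by rewrite mul0r /Num.min ltNge ler01/= ltxx subrr normr0.
    rewrite Dk/=; have [De|eD] := ltP (D k) e.
      have De1 : D k / e < 1 by rewrite ltr_pdivrMr// mul1r.
      have De0 : 0 < D k / e by rewrite divr_gt0.
      by rewrite /Num.min ltNge (ltW De1)/= ler_norml; apply/andP; split; lra.
    have De1 : 1 <= D k / e by rewrite ler_pdivlMr// mul1r.
    rewrite /Num.min; case: ifP => [_|/negbT]; first by rewrite subrr normr0.
    rewrite -leNgt => De2; have -> : D k / e = 1 by lra.
    by rewrite subrr normr0.
  move=> i k ik kp /andP[Di0 Die] /andP[Dk0 Dke].
  apply: (notie i (ltn_trans ik kp)); rewrite /tie.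
  have iS : (i < 2 ^ p)%N := ltn_trans ik kp.
  have Di1 : 0 < D i.+1.
    apply: (lt_le_trans Dk0); rewrite lerD2l lerN2 sup_on_subset//.
    by rewrite dy_ge0/= ler_dy.
  have := sup_on_split cf (dy01 _ iS).
  move: Di1; rewrite /D subr_gt0 => Di1 E.
  have {E} E : sup_on f 1 = sup_int f (dy p i.+1) 1.
    move: E; rewrite /Num.max; case: ifP => // _ E.
    by move: Di1; rewrite E ltxx.
  rewrite -E -/(D i) ger0_norm// D_ge0//; exact: ltnW.
rewrite ler_norml => /andP[T1 T2].
have -> : g - (2 ^+ p)^-1 * \sum_(k < 2 ^ p) Num.min 1 (D k / e) =
  (2 ^+ p * g - \sum_(k < 2 ^ p) Num.min 1 (D k / e)) / 2 ^+ p.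
  by field; rewrite gt_eqF.
rewrite normrM (@gtr0_norm _ (2 ^+ p)^-1) ?invr_gt0//.
rewrite ler_pM2r ?invr_gt0// ler_norml; apply/andP; split; lra.
Qed.

End skeletons.

(** * Rescaling of time and space *)

Section scaling.
Context {R : realType}.
Implicit Types (f c C g : R -> R) (T t x y z M a b e d : R).

Definition rescale T a f t := f (T * t) / a.

Lemma cadlag_rescale T a f : 0 < T -> 0 < a -> cadlag f -> cadlag (rescale T a f).
Proof.
move=> T0 a0 cf t t0; have Tt : 0 <= T * t by rewrite mulr_ge0// ltW.
split => [|tp].
  apply/cvgrPdist_le => e e0.
  have ea : 0 < e * a by rewrite mulr_gt0.
  have [r r0 fr] := cadlag_right cf Tt ea.
  exists (r / T) => /=; first by rewrite divr_gt0.
  move=> y /= + ty; rewrite ltr0_norm ?subr_lt0// opprB ltr_pdivlMr// => yr.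
  rewrite /rescale -mulrBl normrM (@gtr0_norm _ a^-1) ?invr_gt0//.
  rewrite ler_pdivrMr// distrC; apply: fr; rewrite ler_pM2l// (ltW ty)/=.
  lra.
have Ttp : 0 < T * t by rewrite mulr_gt0.
have [l fl] := cadlag_left cf Ttp; apply/cvg_ex; exists (l / a).
apply/cvgrPdist_le => e e0.
have ea : 0 < e * a by rewrite mulr_gt0.
have [r r0 fr] := cvg_leftP fl ea.
exists (r / T) => /=; first by rewrite divr_gt0.
move=> y /= + ty; rewrite gtr0_norm ?subr_gt0// ltr_pdivlMr// => yr.
rewrite /rescale -mulrBl normrM (@gtr0_norm _ a^-1) ?invr_gt0//.
rewrite ler_pdivrMr// distrC; apply: fr; rewrite ltr_pM2l// ty andbT.
lra.
Qed.

Lemma sup_on_rescale T a f u : 0 < T -> 0 < a -> cadlag f -> 0 <= u ->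
  sup_on (rescale T a f) u = sup_on f (T * u) / a.
Proof.
move=> T0 a0 cf u0; have cz := cadlag_rescale T0 a0 cf.
apply/eqP; rewrite eq_le; apply/andP; split.
  apply: sup_int_le => // t /andP[t0 tu].
  rewrite ler_pM2r ?invr_gt0//; apply: le_sup_int => //.
  by rewrite mulr_ge0 ?ler_pM2l// ltW.
rewrite ler_pdivrMr//; apply: sup_int_le; first by rewrite mulr_ge0// ltW.
move=> t /andP[t0 tu]; rewrite -ler_pdivrMr//.
have -> : f t / a = rescale T a f (t / T) by rewrite /rescale mulrCA divff ?gt_eqF// mulr1.
by apply: le_sup_int => //; rewrite divr_ge0 ?(ltW T0)//= ler_pdivrMr// mulrC.
Qed.

(** Each side is determined by the [u] below it, and [sup_on_lt] reduces [u < time] to suprema,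
    which rescale. *)
Lemma time_of_sup_rescale T a f : 0 < T -> 0 < a -> cadlag f ->
  time_of_sup (rescale T a f) 1 = time_of_sup f T / T.
Proof.
move=> T0 a0 cf; have cz := cadlag_rescale T0 a0 cf.
have /andP[g0 gT] := time_of_sup_itv cf (ltW T0).
have /andP[h0 h1] := time_of_sup_itv cz (@ler01 R).
have key u : 0 <= u <= 1 -> (u < time_of_sup (rescale T a f) 1) = (u < time_of_sup f T / T).
  move=> /andP[u0 u1]; rewrite -sup_on_lt ?u0// !sup_on_rescale// mulr1.
  rewrite ltr_pM2r ?invr_gt0// sup_on_lt//; first by rewrite ltr_pdivlMr// mulrC.
  by rewrite mulr_ge0 ?(ltW T0)//= ger_pMr.
apply/eqP; rewrite eq_le; apply/andP; split; rewrite leNgt.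
  by rewrite key ?ltxx// divr_ge0 ?(ltW T0)//= ler_pdivrMr// mul1r.
by rewrite -key ?ltxx// h0.
Qed.

Lemma graph_length_concave_majorant T f : cadlag f -> f 0 = 0 -> 0 < T ->
  `|graph_length (concave_majorant f T) 0 T - (2 * sup_on f T - f T)| <= T.
Proof.
move=> cf f0 T0.
have fM t : 0 <= t <= T -> f t <= sup_on f T by move=> tT; exact: le_sup_int.
have cC := concave_majorant_concave fM.
have CM t : 0 <= t <= T -> concave_majorant f T t <= sup_on f T.
  exact: concave_majorant_le_bound.
have := graph_length_le cC CM T0.
rewrite (concave_majorant0 T0 fM) (concave_majorantT T0 fM) f0 => h1.
have h2 : 2 * sup_on f T - f T <= graph_length (concave_majorant f T) 0 T.
  rewrite lerBlDr -ler_pdivlMl//; apply: sup_int_le; first exact: ltW.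
  move=> t tT; rewrite ler_pdivlMl//.
  have := graph_length_ge cC CM T0 tT.
  rewrite (concave_majorant0 T0 fM) (concave_majorantT T0 fM) f0.
  by have := concave_majorant_ge fM tT; lra.
by rewrite ler_norml; apply/andP; split; lra.
Qed.

Lemma Lambda1_rescale (a : R -> R) T f : cadlag f -> 0 < T -> 0 < a T ->
  f x @[x --> T^'-] --> f T ->
  let z := rescale T (a T) f in
  Lambda1_ a T f = (graph_length (concave_majorant f T) 0 T / a T,
    sup_on z 1, z 1, time_of_sup z 1).
Proof.
move=> cf T0 a0 fT z.
have fM t : 0 <= t <= T -> f t <= sup_on f T by move=> tT; exact: le_sup_int.
rewrite /Lambda1_ (sup_on_concave_majorant T0 fM) (concave_majorantT T0 fM).
rewrite first_argmax_concave_majorant// /z sup_on_rescale// time_of_sup_rescale//.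
by rewrite /rescale mulr1.
Qed.

End scaling.

(** * Convex minorants through the opposite path *)

Section opposite.
Context {R : realType}.
Implicit Types (f c C g : R -> R) (T t x y z M a b e d : R).

Lemma cadlag_opp f : cadlag f -> cadlag (fun t => - f t).
Proof.
move=> cf t /cf[h1 h2]; split; first exact: cvgN.
by move=> /h2 h; exact: is_cvgN.
Qed.

Lemma inf_onE f T : inf_on f T = - sup_on (fun t => - f t) T.
Proof. by rewrite /inf_on /inf /sup_on image_comp. Qed.

Lemma time_of_infE f T : time_of_inf f T = time_of_sup (fun t => - f t) T.
Proof.
rewrite /time_of_inf /time_of_sup inf_onE; congr inf.
apply/seteqP; split => t /= [tT h]; split => //.
  case: h => [->|[t0 ft]]; first by left; rewrite opprK.
  by right; split => //; rewrite -[X in _ --> X]opprK; exact: cvgN.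
case: h => [<-|[t0 ft]]; first by left; rewrite opprK.
right; split => //; apply: cvg_trans (cvgN ft); apply: near_eq_cvg.
by apply: nearW => y /=; rewrite opprK.
Qed.

Lemma first_argminE f T : first_argmin f T = first_argmax (fun t => - f t) T.
Proof.
rewrite /first_argmin /first_argmax inf_onE; congr inf.
apply/seteqP; split => t /= [tT h]; split => //; first by rewrite h opprK.
by rewrite -h opprK.
Qed.

Lemma convex_minorantE f T :
  convex_minorant f T = fun t => - concave_majorant (fun t => - f t) T t.
Proof.
apply/funext => t; rewrite /convex_minorant /concave_majorant /inf opprK.
congr sup; rewrite image_comp; apply/seteqP; split => _ /= [c [cc fc] <-].
  exists (fun t => - c t) => /=; last by rewrite opprK.
  split; last by move=> s /fc; rewrite lerN2.
  by rewrite (_ : (fun t => - - c t) = c)//; apply/funext => y; rewrite opprK.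
exists (fun t => - c t) => //; split => // s /fc; rewrite lerNl; exact.
Qed.

Lemma graph_length_opp f a b : graph_length (fun t => - f t) a b = graph_length f a b.
Proof.
rewrite /graph_length; congr sup; congr image; apply/funext => s.
apply: eq_bigr => p _; congr Num.sqrt; congr (_ + _).
by rewrite -opprD sqrrN.
Qed.

Lemma Lambda2_E (a : R -> R) T f :
  let: (l, s, v, g) := Lambda1_ a T (fun t => - f t) in
  Lambda2_ a T f = (l, - s, - v, g).
Proof.
rewrite /Lambda1_ /Lambda2_ convex_minorantE /=.
set C := concave_majorant _ _.
rewrite graph_length_opp inf_onE first_argminE.
have -> : (fun t => - - C t) = C by apply/funext => t; rewrite opprK.
by rewrite !mulNr.
Qed.

Lemma Lambda2E f :
  let: (l, s, v, g) := Lambda1 (fun t => - f t) in Lambda2 f = (l, - s, - v, g).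
Proof.
by rewrite /Lambda1 /Lambda2 inf_onE time_of_infE opprK mulrN opprK addrC.
Qed.

End opposite.

(** * Regular variation *)

Lemma measurable_bool_set d (T : measurableType d) (b : T -> bool) :
  measurable_fun setT b -> measurable [set w | b w].
Proof. by move=> /(_ measurableT [set true]); rewrite setTI; exact. Qed.

Section slow_variation.
Context {R : realType}.
Implicit Types (l a : R -> R) (A c e q x y : R).

Let mu := @lebesgue_measure R.

Lemma lebesgue_measure_dilation c (A : set R) : 0 < c -> measurable A ->
  mu ((fun w => w / c) @^-1` A) = (c%:E * mu A)%E.
Proof.
move=> c0 mA.
have ci0 : 0 <= c^-1 by rewrite invr_ge0 ltW.
pose f : R -> measurableTypeR R := fun w => w / c.
have mf : measurable_fun setT f by exact: measurable_funM.
have : mu A = (c^-1%:E * pushforward mu f A)%E.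
  apply: (eq_trans (@lebesgue_measure_unique _
    (mscale (NngNum ci0) (pushforward mu f)) _ A mA)) => // _ [[a b]] _ <-.
  change (mu `]a, b] = (c^-1%:E * mu (f @^-1` `]a, b]))%E).
  have -> : f @^-1` `]a, b] = `]a * c, b * c]%classic.
    by apply/seteqP; split => w /=; rewrite /f !in_itv/= ltr_pdivlMr// ler_pdivrMr.
  rewrite /mu !lebesgue_measure_itv/= !lte_fin ltr_pM2r//.
  case: ifP => _; last by rewrite mule0.
  by rewrite -!EFinB -EFinM; congr EFin; rewrite -mulrBl mulrC mulfK// gt_eqF.
move=> ->; rewrite muleA -EFinM divff ?gt_eqF// mul1e.
by [].
Qed.

(* Otherwise l (c n * x n) < l (x n) / 2 for some x n -> oo and c n in [1, 2].
   For large n, the sets of v in [1, 4] where l (v * x n) is close to l (x n),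
   and of u where l (u * (c n * x n)) is close to l (c n * x n), have almost full
   measure, so that v = u * c n for some members v and u. *)
Lemma slowly_varying_le l : slowly_varying l ->
  exists2 A, 0 < A & forall x c, A <= x -> 1 <= c <= 2 -> 0 < l x /\ l x <= 2 * l (c * x).
Proof.
move=> [A0 lpos [ml lim]].
pose A1 := Num.max A0 1.
have A1A0 : A0 <= A1 by rewrite /A1 le_max lexx.
have A11 : 1 <= A1 by rewrite /A1 le_max lexx orbT.
apply: contrapT => H.
have step (n : nat) : exists p : R * R, [/\ A1 <= p.1, n%:R <= p.1, 1 <= p.2 <= 2 &
    2 * l (p.2 * p.1) < l p.1].
  apply: contrapT => K; apply: H; exists (Num.max A1 n%:R).
    by rewrite lt_max (lt_le_trans ltr01 A11).
  move=> x c; rewrite ge_max => /andP[Ax nx] c12.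
  split; first exact: (lpos _ (le_trans A1A0 Ax)).
  rewrite leNgt; apply/negP => lt.
  by apply: K; exists (x, c).
have [u uP] := choice step; pose x n := (u n).1; pose c n := (u n).2.
have x1 n : A1 <= x n by have [] := uP n.
have xn n : n%:R <= x n by have [] := uP n.
have c12 n : 1 <= c n <= 2 by have [] := uP n.
have lx n : 2 * l (c n * x n) < l (x n) by have [] := uP n.
(* [l] is measurable on this half-line only; the extension by 0 is measurable everywhere. *)
pose L := l \_ `[A0, +oo[.
have mL : measurable_fun setT L by apply/(measurable_restrictT _ _).1 => //; exact: measurable_itv.
have LE z : A0 <= z -> L z = l z.
  by move=> Az; rewrite /L patchE mem_set//= in_itv/= Az.
(* The [v] whose ratio [l (v * y k) / l (y k)] is within 1/4 of 1 for all [k >= n]. These sets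
   increase to [[1, 4]], so their measure eventually exceeds 5/2 out of 3. *)
pose G (y : nat -> R) n := [set v : R | 1 <= v <= 4] `&`
  \bigcap_(k in [set k | (n <= k)%N])
    [set v | 3 / 4 * l (y k) <= L (v * y k) <= 5 / 4 * l (y k)].
have mG (y : nat -> R) n : measurable (G y n).
  apply: measurableI.
    have -> : [set v : R | 1 <= v <= 4] = `[1, 4]%classic.
      by apply/seteqP; split => v /=; rewrite in_itv.
    exact: measurable_itv.
  apply: bigcap_measurableType => k _.
  have mLk : measurable_fun setT (fun v : R => L (v * y k)).
    by apply: (measurableT_comp mL); exact: measurable_funM.
  apply: measurable_bool_set.
  by apply: measurable_and; exact: measurable_fun_ler.
have muG (y : nat -> R) : (forall n, A1 <= y n) -> (forall n, n%:R <= y n) ->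
    \forall n \near \oo, ((5 / 2)%:E < mu (G y n))%E.
  move=> y1 yn.
  have ndG : nondecreasing_seq (G y).
    move=> n m nm; apply/subsetPset => v [v14 Gv]; split => // k /= mk.
    by apply: Gv; exact: (leq_trans nm).
  have GU : \bigcup_n G y n = `[1, 4]%classic.
    apply/seteqP; split => [v [n _ [/= + _]]|v /=]; first by rewrite in_itv.
    rewrite in_itv/= => v14.
    have v0 : 0 < v by lra.
    have e4 : 0 < 1 / 4 :> R by lra.
    have /cvgrPdist_le/(_ _ e4)[M [_ HM]] := lim v v0.
    pose N := Num.truncn (`|M| + 1).
    exists N.+1 => //; split => // k /= Nk.
    have yM : M < y k.
      apply: (lt_le_trans _ (yn k)).
      have : `|M| + 1 < N.+1%:R by exact: truncnS_gt.
      have : N.+1%:R <= k%:R :> R by rewrite ler_nat.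
      by have := ler_norm M; lra.
    have lyk : 0 < l (y k) by apply: lpos; exact: le_trans (y1 k).
    have := HM _ yM; rewrite LE; last first.
      have := y1 k; move: (y k) => z z1.
      by apply: (le_trans (le_trans A1A0 z1)); rewrite ler_peMl//; lra.
    rewrite distrC ler_norml => /andP[].
    rewrite lerBrDr lerBlDr ler_pdivlMr// ler_pdivrMr// => h1 h2.
    by apply/andP; split; lra.
  have : mu (G y n) @[n --> \oo] --> mu (\bigcup_n G y n).
    have mU : measurable (\bigcup_n G y n) by apply: bigcup_measurable => k _; exact: mG.
    apply: nondecreasing_cvg_mu => [i| |]; [exact: mG|exact: mU|exact: ndG].
  rewrite GU /mu lebesgue_measure_itv/= lte_fin (_ : 1 < 4 = true); last by lra.
  have : ((5 / 2)%:E < (4 : R)%:E - 1%:E)%E by rewrite -EFinB lte_fin; lra.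
  by move=> h cvG; exact: cvG _ (open_ereal_gt' h).
have xx : forall n, n%:R <= c n * x n.
  by move=> n; have := xn n; have := c12 n; have := x1 n; nra.
have x11 : forall n, A1 <= c n * x n.
  by move=> n; have := c12 n; have := x1 n; nra.
have near1 := muG x x1 xn.
have near2 := muG (fun n => c n * x n) x11 xx.
near \oo => N.
have B1 : ((5 / 2)%:E < mu (G x N))%E by near: N.
have B2 : ((5 / 2)%:E < mu (G (fun n => (c n * x n)%R) N))%E by near: N.
set E := G x N in B1; set F := G _ N in B2.
pose F' := F `&` `[1, 2]%classic.
have mF' : measurable F' by apply: measurableI => //; exact: mG.
have cN0 : 0 < c N by have := c12 N; lra.
(* [D] is [c N * F']. As [F'] lies in [[1, 2]] and [c N <= 2], both [D] and [E] lie in [[1, 4]], of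
   measure 3. Their measures exceed 1/2 and 5/2, so they meet. *)
pose D := (fun w => w / c N) @^-1` F'.
have muD : mu D = ((c N)%:E * mu F')%E by exact: lebesgue_measure_dilation.
have mD : measurable D.
  have mdiv : measurable_fun setT (fun w : R => w / c N) by exact: measurable_funM.
  by have := mdiv measurableT F' mF'; rewrite setTI.
have muF' : ((1 / 2)%:E < mu F')%E.
  have FS : F `<=` F' `|` `]2, 4]%classic.
    move=> v Fv; have [/= /andP[v1 v4] _] := Fv.
    have [v2|v2] := leP v 2; first by left; split => //=; rewrite in_itv/= v1.
    by right => /=; rewrite in_itv/= v2.
  have mF : measurable F by exact: mG.
  pose I24 : set R := `]2, 4]%classic.
  have m24 : measurable (`]2, 4]%classic : set R) by exact: measurable_itv.
  have le1 : (mu F <= mu F' + mu I24)%E.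
    apply: (le_trans _ (measureU2 mu mF' m24)).
    exact: (le_measure mu (mem_set mF) (mem_set (measurableU _ _ mF' m24)) FS).
  have := lt_le_trans B2 le1.
  have -> : mu I24 = 2%:E.
    by rewrite /mu /I24 lebesgue_measure_itv/= lte_fin ifT -?EFinB; [congr EFin|]; lra.
  case: (mu F') => [r| |]; [|by move=> _; rewrite ltry|by []].
  by rewrite -EFinD !lte_fin; lra.
have muD' : ((1 / 2)%:E < mu D)%E.
  rewrite muD; apply: (lt_le_trans muF'); apply: lee_pemull => //.
  by rewrite lee_fin; have := c12 N; lra.
have mE : measurable E by exact: mG.
have /set0P[w [Ew Dw]] : E `&` D != set0.
  apply/negP => /eqP ED0.
  have muED : mu (E `|` D) = (mu E + mu D)%E := measureU mu mE mD ED0.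
  have S14 : E `|` D `<=` `[1, 4]%classic.
    move=> w [[/= + _]|]; first by rewrite in_itv.
    move=> [_ /=]; rewrite !in_itv/= ler_pdivlMr// ler_pdivrMr// => w12.
    by have := c12 N; move: w12; set cc := c N; lra.
  pose I14 : set R := `[1, 4]%classic.
  have m14 : measurable (`[1, 4]%classic : set R) by exact: measurable_itv.
  have : (mu (E `|` D) <= mu I14)%E.
    exact: (le_measure mu (mem_set (measurableU _ _ mE mD)) (mem_set m14) S14).
  have -> : mu I14 = 3%:E.
    by rewrite /mu /I14 lebesgue_measure_itv/= lte_fin ifT -?EFinB; [congr EFin|]; lra.
  rewrite muED leNgt; apply/negP/negPn.
  apply: (@le_lt_trans _ _ ((5 / 2)%:E + (1 / 2)%:E)%E); first by rewrite -EFinD lee_fin; lra.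
  exact: lteD.
have [_ /(_ N (leqnn N))/= h1] := Ew.
have [[/= w12 /(_ N (leqnn N))/= h2] _] := Dw.
have wx : w / c N * (c N * x N) = w * x N by field; rewrite gt_eqF.
rewrite wx in h2.
(* Contradiction: [3/4 * l (x N) <= l (w * x N) <= 5/4 * l (c N * x N) < 5/8 * l (x N)]. *)
have := lx N; move: h1 h2 => /andP[h1 _] /andP[_ h2].
have lcx : 0 < l (c N * x N) by apply: lpos; exact: (le_trans A1A0 (x11 N)).
by lra.
Unshelve. all: by end_near. Qed.

End slow_variation.

(** * Growth of the norming function *)

Section regular_variation.
Context {R : realType}.
Variables (alpha : R) (l a : R -> R).
Hypotheses (alpha01 : 0 < alpha < 1) (svl : slowly_varying l).
Hypothesis aE : forall T, 0 < T -> 0 < a T /\ a T = T `^ alpha^-1 * l T.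

Lemma regular_variation c : 0 < c ->
  a (c * T) / a T @[T --> +oo] --> c `^ alpha^-1.
Proof.
move=> c0; have [A lpos [_ lim]] := svl.
rewrite -[X in _ --> X]mulr1.
apply: cvg_trans (cvgM (cvg_cst (c `^ alpha^-1)) (lim c c0)).
apply: near_eq_cvg; near=> T.
have T0 : 0 < T by near: T; exact: nbhs_pinfty_gt.
have cT0 : 0 < c * T by rewrite mulr_gt0.
have lT : 0 < l T by apply: lpos; near: T; apply: nbhs_pinfty_ge; exact: num_real.
have [_ ->] := aE T0; have [_ ->] := aE cT0.
rewrite /= powRM ?(ltW c0) ?(ltW T0)//; field.
by rewrite !gt_eqF// powR_gt0.
Unshelve. all: by end_near. Qed.

(** Here [k] is the integer part of the binary logarithm of [x / y]. Since [a (2 * x) / a x] tends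
    to [2 ^ (1 / alpha) > 2], each doubling multiplies [a] by at least [1 / q] with [q < 1 / 2]. The
    remaining ratio lies in [[1, 2]] and costs the factor 2 of [slowly_varying_le]. *)
Lemma regular_variation_growth : exists A q : R, [/\ 0 < A, 0 < q < 1 / 2 &
  forall y x, A <= y -> y <= x -> exists k : nat,
    x < 2 ^+ k.+1 * y /\ a y <= 2 * q ^+ k * a x].
Proof.
have [A0 A00 lle] := slowly_varying_le svl.
have alpha1 : 1 < alpha^-1 by have /andP[a0 a1] := alpha01; rewrite invf_gt1.
set s := 2 `^ alpha^-1.
have s2 : 2 < s.
  have ln2 : 0 < ln (2 : R) by rewrite ln_gt0//; lra.
  rewrite -[ltLHS](@lnK _ 2) ?posrE//.
  by rewrite /s /powR gt_eqF// ltr_expR ltr_pMl.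
(* Strictly between the limit [s^-1] of [a x / a (2 * x)] and 1/2. *)
pose q := (s^-1 + 1 / 2) / 2.
have s0 : 0 < s by lra.
have sV : s^-1 < 1 / 2 by rewrite div1r ltf_pV2 ?posrE.
have q0 : 0 < s^-1 by rewrite invr_gt0.
have lim2 := regular_variation (ltr0Sn R 1).
have : (a (2 * T) / a T)^-1 @[T --> +oo] --> s^-1.
  by apply: cvgV lim2; rewrite gt_eqF.
have sq : s^-1 < q by rewrite /q; lra.
move=> /cvgr_lt/(_ _ sq)[A1 [_ HA1]].
pose A := Num.max A0 (`|A1| + 1).
have AA0 : A0 <= A by rewrite /A le_max lexx.
have AA1 : A1 < A.
  by rewrite /A lt_max; apply/orP; right; have := ler_norm A1; lra.
have A_gt0 : 0 < A by lra.
have step x : A <= x -> a x <= q * a (2 * x).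
  move=> Ax; have x0 : 0 < x by lra.
  have [ax _] := aE x0; have [a2x _] := aE (ltac:(lra) : 0 < 2 * x).
  have := HA1 x (lt_le_trans AA1 Ax); rewrite invf_div ltr_pdivrMr// => /ltW.
  by [].
have steps k x : A <= x -> a x <= q ^+ k * a (2 ^+ k * x).
  move=> Ax; elim: k => [|k ih]; first by rewrite !expr0 !mul1r.
  apply: (le_trans ih); rewrite exprSr -mulrA ler_pM2l ?exprn_gt0//; last by lra.
  rewrite exprS -mulrA; apply: step; apply: (le_trans Ax).
  by rewrite ler_peMl ?exprn_ege1//; lra.
have last x c : A <= x -> 1 <= c <= 2 -> a x <= 2 * a (c * x).
  move=> Ax c12; have x0 : 0 < x by lra.
  have [lx lcx] := lle x c (le_trans AA0 Ax) c12.
  have c0 : 0 < c by lra.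
  have [_ ->] := aE x0; have [_ ->] := aE (mulr_gt0 c0 x0).
  rewrite powRM ?(ltW c0) ?(ltW x0)//.
  have xp : 0 < x `^ alpha^-1 by rewrite powR_gt0.
  have cp : 1 <= c `^ alpha^-1.
    by rewrite -[leLHS](powRr0 c); apply: ler_powR => //; lra.
  have lcx0 : 0 < l (c * x) by lra.
  have := ler_wpM2l (ltW xp) lcx.
  have := mulr_gt0 xp lcx0; move: (x `^ _) (c `^ _) (l _) (l _) cp {xp lx lcx lcx0}.
  by move=> u v w z v1 z0 uw; nra.
exists A, q; split => //; first by apply/andP; split; rewrite /q; lra.
move=> y x Ay yx; have y0 : 0 < y by lra.
have xy0 : 1 <= x / y by rewrite ler_pdivlMr// mul1r.
have [n1 n2] := andP (truncn_itv (le_trans ler01 xy0)).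
have n0 : (0 < Num.truncn (x / y))%N by rewrite truncn_gt0.
have /= /andP[k1 k2] := trunc_log_bounds (ltnSn 1) n0.
set k := trunc_log 2 _ in k1 k2; exists k.
have pk : 0 < 2 ^+ k :> R by rewrite exprn_gt0.
have K1 : 2 ^+ k * y <= x.
  rewrite -ler_pdivlMr//; apply: le_trans n1; rewrite -natrX ler_nat.
  by [].
have K2 : x < 2 ^+ k.+1 * y.
  rewrite -ltr_pdivrMr//; apply: (lt_le_trans n2); rewrite -natrX ler_nat.
  by [].
split => //; apply: (le_trans (steps k y Ay)).
have -> : 2 * q ^+ k * a x = q ^+ k * (2 * a x) by ring.
rewrite ler_pM2l ?exprn_gt0//; last by rewrite /q; lra.
have p0 : 0 < 2 ^+ k * y by rewrite mulr_gt0.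
have {1}-> : x = x / (2 ^+ k * y) * (2 ^+ k * y) by rewrite divfK// gt_eqF.
apply: last.
  by apply: (le_trans Ay); rewrite ler_peMl ?exprn_ege1//; lra.
rewrite ler_pdivlMr// ler_pdivrMr// mul1r K1/= ltW// (lt_le_trans K2)//.
by rewrite exprS mulrA.
Qed.

Lemma regular_variation_bound : exists A K : R, [/\ 0 < A, 0 < K &
  forall y x, A <= y -> y <= x -> a y <= K * a x].
Proof.
have [A [q [A0 /andP[q0 q1] H]]] := regular_variation_growth.
exists A, 2; split => // y x Ay yx; have [k [_ ak]] := H y x Ay yx.
have [ax _] := aE (lt_le_trans A0 (le_trans Ay yx)).
apply: (le_trans ak); rewrite ler_pM2r// ler_piMr// exprn_ile1//; lra.
Qed.

Lemma regular_variation_small e : 0 < e -> exists A h : R, [/\ 0 < A, 0 < h &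
  forall y x, A <= y -> y <= h * x -> a y <= e * a x].
Proof.
move=> e0; have [A [q [A0 /andP[q0 q1] H]]] := regular_variation_growth.
have /cvgrPdist_le/(_ (e / 2)) : q ^+ n @[n --> \oo] --> (0 : R).
  by apply: cvg_expr; rewrite ger0_norm ?ltW//; lra.
move=> /(_ (ltac:(lra)))[n0 _ /(_ n0 (leqnn _))].
rewrite /= sub0r normrN ger0_norm ?exprn_ge0 ?(ltW q0)// => qe.
exists A, (2 ^+ n0.+1)^-1; split => // y x Ay yx.
have p0 : 0 < 2 ^+ n0.+1 :> R by rewrite exprn_gt0.
have p1 : 1 <= 2 ^+ n0.+1 :> R by rewrite exprn_ege1//; lra.
have y0 : 0 < y by lra.
rewrite ler_pdivlMl// in yx.
have yx' : y <= x by nra.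
have [k [xk ak]] := H y x Ay yx'.
have [ax _] := aE (lt_le_trans y0 yx').
have n0k : (n0 <= k)%N.
  have : 2 ^+ n0.+1 * y < 2 ^+ k.+1 * y by exact: le_lt_trans xk.
  by rewrite ltr_pM2r// ltr_eXn2l ?ltr1n => // /ltnW.
apply: (le_trans ak); rewrite ler_pM2r//.
have : q ^+ k <= q ^+ n0 by rewrite ler_wiXn2l//; lra.
lra.
Qed.

(** With the fixed start [A], [T] is at most [2 ^ k.+1 * A] while [a T] is at least
    [a A / (2 * q ^ k)]. The ratio is of order [(2 * q) ^ k], and [2 * q < 1]. *)
Lemma regular_variation_superlinear : T / a T @[T --> +oo] --> 0.
Proof.
have [A [q [A0 /andP[q0 q1] H]]] := regular_variation_growth.
have [aA _] := aE A0.
apply/cvgrPdist_le => e e0.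
have /cvgrPdist_le/(_ (e * a A / (4 * A))) : (2 * q) ^+ n @[n --> \oo] --> (0 : R).
  by apply: cvg_expr; rewrite ger0_norm; lra.
have e1 : 0 < e * a A / (4 * A) by rewrite divr_gt0 ?mulr_gt0.
move=> /(_ e1)[n0 _ /(_ n0 (leqnn _))].
rewrite /= sub0r normrN ger0_norm ?exprn_ge0 ?mulr_ge0 ?(ltW q0)// => qe.
near=> T.
have TA : A <= T by near: T; apply: nbhs_pinfty_ge; exact: num_real.
have Tn : 2 ^+ n0.+1 * A <= T by near: T; apply: nbhs_pinfty_ge; exact: num_real.
have [k [Tk ak]] := H A T (lexx A) TA.
have [aT _] := aE (lt_le_trans A0 TA).
have n0k : (n0 <= k)%N.
  have : 2 ^+ n0.+1 * A < 2 ^+ k.+1 * A by exact: le_lt_trans Tk.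
  by rewrite ltr_pM2r// ltr_eXn2l ?ltr1n => // /ltnW.
rewrite sub0r normrN ger0_norm; last by rewrite divr_ge0// ltW// (lt_le_trans A0).
rewrite ler_pdivrMr//.
have h1 : (2 * q) ^+ k <= (2 * q) ^+ n0 by rewrite ler_wiXn2l//; lra.
have h2 : (2 * q) ^+ k * (4 * A) <= e * a A.
  by rewrite -ler_pdivlMr ?mulr_gt0//; exact: le_trans qe.
have h3 : 2 ^+ k.+1 * A * a A <= 2 ^+ k.+1 * A * (2 * q ^+ k * a T).
  by rewrite ler_pM2l// mulr_gt0// exprn_gt0.
rewrite -(ler_pM2r aA).
apply: (@le_trans _ _ (2 ^+ k.+1 * A * a A)); first by rewrite ler_pM2r// ltW.
apply: (le_trans h3); rewrite exprS.
have -> : 2 * 2 ^+ k * A * (2 * q ^+ k * a T) = (2 * q) ^+ k * (4 * A) * a T.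
  by rewrite exprMn; ring.
have -> : e * a T * a A = e * a A * a T by ring.
by rewrite ler_pM2r.
Unshelve. all: by end_near. Qed.

Lemma regular_variation_pinfty M : \forall T \near +oo, M <= a T.
Proof.
have e0 : 0 < (`|M| + 1)^-1 by rewrite invr_gt0.
move/cvgrPdist_le: regular_variation_superlinear => /(_ _ e0) near1.
near=> T.
have T1 : 1 <= T by near: T; apply: nbhs_pinfty_ge; exact: num_real.
have T0 : 0 < T by lra.
have [aT _] := aE T0.
have : `|0 - T / a T| <= (`|M| + 1)^-1 by near: T.
rewrite sub0r normrN ger0_norm; last by rewrite divr_ge0// ltW.
rewrite ler_pdivrMr// ler_pdivlMl// => h.
have := ler_norm M; have := normr_ge0 M; nra.
Unshelve. all: by end_near. Qed.

End regular_variation.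

(** * Levy processes along a skeleton *)

Section prob.
Context {R : realType} d (Omega : measurableType d) (P : probability Omega R).
Implicit Types (A B : set Omega).

Definition pr A : R := fine (P A).

Lemma prE A : measurable A -> P A = (pr A)%:E.
Proof. by move=> mA; rewrite fineK// fin_num_measure. Qed.

Lemma pr_ge0 A : 0 <= pr A.
Proof. by rewrite fine_ge0// measure_ge0. Qed.

Lemma pr_le1 A : measurable A -> pr A <= 1.
Proof. by move=> mA; rewrite -lee_fin -prE// probability_le1. Qed.

Lemma pr_le_ae A B : measurable A -> measurable B ->
  {ae P, forall w, A w -> B w} -> pr A <= pr B.
Proof.
move=> mA mB [N [mN N0 sub]]; rewrite -lee_fin -!prE//.
have sAB : A `<=` B `|` N.
  move=> w Aw; have [Bw|nBw] := pselect (B w); first by left.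
  by right; apply: sub => /= h; apply: nBw; exact: h.
apply: (@le_trans _ _ (P (B `|` N))).
  by apply: le_measure; rewrite ?inE//; exact: measurableU.
have PN : P N = 0%E by [].
have h : (P (B `|` N) <= P B + P N)%E := measureU2 P mB mN.
by move: h; rewrite PN adde0.
Qed.

Lemma pr_le A B : measurable A -> measurable B -> A `<=` B -> pr A <= pr B.
Proof. by move=> mA mB AB; apply: pr_le_ae => //; apply: aeW => w; exact: AB. Qed.

Lemma pr_eq_ae A B : measurable A -> measurable B ->
  {ae P, forall w, A w <-> B w} -> pr A = pr B.
Proof.
move=> mA mB AB; apply/eqP; rewrite eq_le !pr_le_ae//.
- by apply: filterS AB => w [].
- by apply: filterS AB => w [].
Qed.

Lemma prU A B : measurable A -> measurable B -> pr (A `|` B) <= pr A + pr B.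
Proof.
move=> mA mB; rewrite -lee_fin EFinD -!prE//; last exact: measurableU.
exact: measureU2.
Qed.

Lemma prC A : measurable A -> pr (~` A) = 1 - pr A.
Proof.
move=> mA; apply: EFin_inj; rewrite EFinB -!prE//; last exact: measurableC.
exact: probability_setC.
Qed.

Lemma pr_bigU n (A : nat -> set Omega) B : (forall k, measurable (A k)) ->
  measurable B -> (forall w, B w -> exists2 k, (k < n)%N & A k w) ->
  pr B <= \sum_(k < n) pr (A k).
Proof.
move=> mA mB; elim: n B mB => [|n ih] B mB sB.
  rewrite big_ord0 (_ : B = set0) ?/pr ?measure0//.
  by apply/seteqP; split => // w /sB[].
rewrite big_ord_recr/=.
have mBn : measurable (B `\` A n) by exact: measurableD.
apply: (@le_trans _ _ (pr ((B `\` A n) `|` A n))).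
  apply: pr_le => //; first exact: measurableU.
  by move=> w Bw; have [Aw|nAw] := pselect (A n w); [right|left].
rewrite (le_trans (prU _ _))// lerD2r; apply: ih => // w [/sB[k +] Ak nA].
by rewrite ltnS leq_eqVlt => /orP[/eqP E|kn]; [rewrite E in Ak|exists k].
Qed.

Lemma pr_disjoint n (A : nat -> set Omega) : (forall k, measurable (A k)) ->
  (forall i k w, (i < k < n)%N -> A i w -> A k w -> False) ->
  \sum_(k < n) pr (A k) <= 1.
Proof.
move=> mA dA.
suff [B [mB sB ->]] : exists B, [/\ measurable B,
    forall w, B w -> exists2 k, (k < n)%N & A k w & \sum_(k < n) pr (A k) = pr B].
  exact: pr_le1.
clear -mA dA; elim: n dA => [|n ih] dA.
  exists set0; split => //; rewrite big_ord0 /pr measure0//.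
have [|B [mB sB EB]] := ih.
  by move=> i k w /andP[ik kn]; apply: dA; rewrite ik/= ltnW.
exists (B `|` A n); split; first exact: measurableU.
- by move=> w [/sB[k kn Ak]|An]; [exists k => //; exact: ltnW|exists n].
rewrite big_ord_recr/= EB; apply: EFin_inj.
rewrite EFinD -!prE//; last exact: measurableU.
rewrite measureU//; apply/seteqP; split => // w [/sB[k kn Ak] An].
by apply: (dA k n w) => //; rewrite kn/=.
Qed.

Lemma cvg_pr_nondecr (A : nat -> set Omega) B : (forall k, measurable (A k)) ->
  measurable B -> (forall w, B w <-> exists k, A k w) ->
  (forall n m w, (n <= m)%N -> A n w -> A m w) ->
  pr (A n) @[n --> \oo] --> pr B.
Proof.
move=> mA mB BA ndA.
have BE : B = \bigcup_n A n.
  by apply/seteqP; split => w; [move=> /BA[k Ak]; exists k|move=> [k _ Ak]; apply/BA; exists k].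
apply: fine_cvg; rewrite -prE// BE.
apply: nondecreasing_cvg_mu => //; first by rewrite -BE.
by move=> n m nm; apply/subsetPset => w; exact: ndA.
Qed.

Lemma cvg_pr_nonincr (A : nat -> set Omega) B : (forall k, measurable (A k)) ->
  measurable B -> (forall w, B w <-> forall k, A k w) ->
  (forall n m w, (n <= m)%N -> A m w -> A n w) ->
  pr (A n) @[n --> \oo] --> pr B.
Proof.
move=> mA mB BA niA.
have BE : B = \bigcap_n A n.
  by apply/seteqP; split => w; [move=> /BA Ak n _|move=> Ak; apply/BA => n; exact: Ak].
apply: fine_cvg; rewrite -prE// BE.
apply: nonincreasing_cvg_mu => //; first by rewrite (le_lt_trans (probability_le1 _ _)) ?ltry.
  by rewrite -BE.
by move=> n m nm; apply/subsetPset => w; exact: niA.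
Qed.

Lemma cvg_pr0 (A : nat -> set Omega) : (forall k, measurable (A k)) ->
  {ae P, forall w, ~ forall k, A k w} ->
  (forall n m w, (n <= m)%N -> A m w -> A n w) ->
  pr (A n) @[n --> \oo] --> 0.
Proof.
move=> mA A0 niA.
have mB : measurable (\bigcap_n A n) by apply: bigcap_measurableType => k _; exact: mA.
have <- : pr (\bigcap_n A n) = 0.
  apply/eqP; rewrite eq_le pr_ge0 andbT -[leRHS](_ : pr set0 = 0); last by rewrite /pr measure0.
  apply: pr_le_ae => //; apply: filterS A0 => w nA Aw; apply: nA => k; exact: Aw.
by apply: cvg_pr_nonincr => // w; split => [Ak k|Ak k _]; exact: Ak.
Qed.

End prob.

(** * Independence of one coordinate from the others *)

Section independence.
Context {R : realType} d (Omega : measurableType d) (P : probability Omega R).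

(** A pi-system generating the sigma-algebra of the coordinates other than [i0]. *)
Definition rectangles_off n (Y : 'I_n -> Omega -> R) (i0 : 'I_n) : set (set Omega) :=
  [set A | exists B : 'I_n -> set R, [/\ forall i, measurable (B i), B i0 = setT &
    A = [set w | forall i, B i (Y i w)]]].

Lemma measurable_off n (Y : 'I_n -> Omega -> R) (i0 j : 'I_n) : j != i0 ->
  measurable_fun setT (Y j : g_sigma_algebraType (rectangles_off Y i0) -> R).
Proof.
move=> ji _ B mB; rewrite setTI; apply: sub_sigma_algebra.
exists (fun i => if i == j then B else setT); split.
- by move=> i; case: ifP.
- by rewrite ifN// eq_sym.
- apply/seteqP; split => w /=; first by move=> Bw i; case: eqP => // ->.
  by move=> /(_ j); rewrite eqxx.
Qed.

Lemma measurable_rectangle n (Y : 'I_n -> Omega -> R) (B : 'I_n -> set R) :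
  (forall i, measurable_fun setT (Y i)) -> (forall i, measurable (B i)) ->
  measurable [set w | forall i, B i (Y i w)].
Proof.
move=> mY mB.
rewrite (_ : [set _ | _] = \big[setI/setT]_(i < n) (Y i @^-1` B i)).
  by apply: bigsetI_measurable => i _; rewrite -[X in measurable X]setTI; exact: mY.
apply/seteqP; split => w /=.
  by move=> H; rewrite -bigcap_seq => i _; exact: H.
by rewrite -bigcap_seq => H i; apply: H; rewrite /= mem_index_enum.
Qed.

Lemma sub_measurable_off n (Y : 'I_n -> Omega -> R) (i0 : 'I_n) A :
  (forall i, measurable_fun setT (Y i)) ->
  <<s rectangles_off Y i0 >> A -> measurable A.
Proof.
move=> mY; apply: smallest_sub; first exact: sigma_algebra_measurable.
by move=> _ [B [mB _ ->]]; exact: measurable_rectangle.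
Qed.

(** With [D] the event on coordinate [i0], both [A -> P (A and D)] and [A -> P D * P A] are finite
    measures; they agree on the pi-system of rectangles, hence on the sigma-algebra it generates. *)
Lemma independent_off n (Y : 'I_n -> Omega -> R) (i0 : 'I_n) A B :
  (forall i, measurable_fun setT (Y i)) -> independent P Y ->
  <<s rectangles_off Y i0 >> A -> measurable B ->
  pr P (A `&` Y i0 @^-1` B) = pr P A * pr P (Y i0 @^-1` B).
Proof.
move=> mY iY sA mB.
have mD : measurable (Y i0 @^-1` B) by rewrite -[X in measurable X]setTI; exact: mY.
have mA := sub_measurable_off mY sA.
set D := Y i0 @^-1` B in mD *.
have p0 : 0 <= pr P D := pr_ge0 P D.
have mPD := @measurableI _ _ _ _ mA mD.
apply: EFin_inj; rewrite EFinM -!prE//.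
pose m1 := mrestr P mD.
pose m2 := mscale (NngNum p0) P.
suff : m1 A = m2 A.
  by move=> E; rewrite (E : P (A `&` D) = ((pr P D)%:E * P A)%E) muleC (prE P mD).
pose G := rectangles_off Y i0.
have GT : G setT.
  by exists (fun=> setT); split => //; apply/seteqP; split.
apply: (@g_sigma_algebra_measure_unique _ _ _ G _ (fun=> setT)) => //.
- by move=> X GX; apply: (@sub_measurable_off _ Y i0 X mY); exact: sub_sigma_algebra.
- by rewrite bigcup_const//; exists 0%N.
- move=> _ _ [B1 [mB1 B10 ->]] [B2 [mB2 B20 ->]].
  exists (fun i => B1 i `&` B2 i); split => [i| |].
  + exact: measurableI.
  + by rewrite B10 B20 setIT.
  + by apply/seteqP; split => w /= => [[H1 H2] i|H]; [split|split => i; have [] := H i].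
- move=> _ [B1 [mB1 B10 ->]].
  change (P ([set w | forall i, B1 i (Y i w)] `&` D) =
    ((pr P D)%:E * P [set w | forall i, B1 i (Y i w)])%E).
  have mB1' := measurable_rectangle mY mB1.
  pose B' i := if i == i0 then B else B1 i.
  have mB' i : measurable (B' i) by rewrite /B'; case: ifP.
  have -> : [set w | forall i, B1 i (Y i w)] `&` D = [set w | forall i, B' i (Y i w)].
    apply/seteqP; split => w /=.
      by move=> [H Dw] i; rewrite /B'; case: eqP => [->|].
    move=> H; split; last by have := H i0; rewrite /B' eqxx.
    by move=> i; have := H i; rewrite /B'; case: eqP => // -> _; rewrite B10.
  rewrite iY// iY// (bigD1 i0)//= [in RHS](bigD1 i0)//= /B' eqxx B10.
  rewrite preimage_setT probability_setT/= mul1r -EFinM.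
  congr (_ * _)%:E; apply: eq_bigr => i ii0; by rewrite (negbTE ii0).
- move=> k; change (P (setT `&` D) < +oo)%E.
  by rewrite setTI (le_lt_trans (probability_le1 _ _)) ?ltry.
Qed.

End independence.

Section increments.
Context {R : realType} d (Omega : measurableType d) (P : probability Omega R).
Implicit Types (x e q delta : R) (W : nat -> Omega -> R).

Definition independent_increments W := forall n (s : nat -> nat),
  (forall i, (s i <= s i.+1)%N) ->
  independent P (fun (i : 'I_n) w => W (s i.+1) w - W (s i) w).

Lemma measurable_le_set d' (T : measurableType d') (f g : T -> R) :
  measurable_fun setT f -> measurable_fun setT g ->
  measurable [set w | f w <= g w].
Proof. by move=> mf mg; apply: measurable_bool_set; exact: measurable_fun_ler. Qed.

Lemma measurable_lt_set d' (T : measurableType d') (f g : T -> R) :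
  measurable_fun setT f -> measurable_fun setT g ->
  measurable [set w | f w < g w].
Proof. by move=> mf mg; apply: measurable_bool_set; exact: measurable_fun_ltr. Qed.

(** Stated for any measurable space because it is applied twice: with the given sigma-algebra and
    with the one generated by the past increments. *)
Lemma measurable_first_passage d' (T : measurableType d') (V : nat -> T -> R) x i :
  (forall j, (j <= i)%N -> measurable_fun setT (V j)) ->
  measurable [set w | (forall j, (j < i)%N -> V j w <= x) /\ x < V i w].
Proof.
move=> mV.
rewrite (_ : [set _ | _] = \bigcap_(j in [set j | (j < i)%N]) [set w | V j w <= x]
  `&` [set w | x < V i w]) //.
apply: measurableI; last exact/measurable_lt_set/mV.
apply: bigcap_measurableType => j /= ji.
by apply: measurable_le_set => //; exact/mV/ltnW.
Qed.

(* Split B according to the first i with W i - W 0 > x + e: the increment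
   W (c i) - W i is below - e there, and independent of the past. *)
Lemma first_passage W n (c : nat -> nat) x e delta B :
  (forall j, measurable_fun setT (W j)) -> independent_increments W ->
  (forall i, (i <= n)%N -> (i <= c i)%N) -> 0 <= delta ->
  (forall i, (i <= n)%N -> pr P [set w | W (c i) w - W i w < - e] <= delta) ->
  measurable B ->
  (forall w, B w -> (exists2 i, (i <= n)%N & x + e < W i w - W 0%N w) /\
     forall i, (i <= n)%N -> W (c i) w - W 0%N w <= x) ->
  pr P B <= delta.
Proof.
move=> mW iW ic d0 Wd mB sB.
pose V j w := W j w - W 0%N w.
have mV j : measurable_fun setT (V j) by exact: measurable_funB.
pose E i := [set w | (forall j, (j < i)%N -> V j w <= x + e) /\ x + e < V i w].
pose D i := [set w | W (c i) w - W i w < - e].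
have mE i : measurable (E i) by exact: measurable_first_passage.
have mD i : measurable (D i).
  by apply: measurable_lt_set => //; exact: measurable_funB.
apply: (@le_trans _ _ (\sum_(i < n.+1) pr P (E i `&` D i))).
  apply: (@pr_bigU _ _ _ P n.+1 (fun i => E i `&` D i)) => //.
    by move=> k; exact: measurableI.
  move=> w /sB[[i0 i0n Vi0] Hc].
  have exP : exists i, (i <= n)%N && (x + e < V i w) by exists i0; rewrite i0n.
  case: (ex_minnP exP) => i /andP[in_ Vi] imin.
  exists i => //; split.
    split => // j ji; rewrite leNgt; apply/negP => Vj.
    by have := imin j; rewrite Vj (leq_trans (ltnW ji) in_) leqNgt ji => /(_ isT).
  rewrite /D/=; have := Hc i in_; move: Vi; rewrite /V.
  lra.
apply: (@le_trans _ _ (\sum_(i < n.+1) delta * pr P (E i))); last first.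
  rewrite -mulr_sumr ler_piMr//; apply: (@pr_disjoint _ _ _ P n.+1 E) => // i k w /andP[ik _] [_ h] [/(_ i ik)].
  lra.
apply: ler_sum => i _.
have i_n : (i <= n)%N by rewrite -ltnS.
suff -> : pr P (E i `&` D i) = pr P (E i) * pr P (D i).
  by rewrite mulrC ler_wpM2r ?pr_ge0// Wd.
(* The times [0, ..., i, c i]: unit steps, then the increment after the passage as the last
   coordinate. *)
pose s j := if (j <= i)%N then j else c i.
have s_nd j : (s j <= s j.+1)%N.
  rewrite /s; case: ifP => ji; case: ifP => ji' //.
  - by apply: (leq_trans ji); exact: ic.
  - by move: ji; rewrite (ltnW ji').
have iY := iW i.+1 s s_nd; set Y := (fun j : 'I_i.+1 => _) in iY.
have mY j : measurable_fun setT (Y j) by exact: measurable_funB.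
have DE : D i = Y ord_max @^-1` [set y | y < - e].
  by rewrite /Y/= /s leqnn ltnn.
rewrite DE; apply: independent_off => //; last first.
  rewrite (_ : [set _ | _] = `]-oo, - e[%classic); first exact: measurable_itv.
  by apply/seteqP; split => y /=; rewrite in_itv.
have mV' j : (j <= i)%N ->
    measurable_fun setT (V j : g_sigma_algebraType (rectangles_off Y ord_max) -> R).
  elim: j => [_|j ih ji].
    rewrite (_ : V 0%N = cst 0); first exact: measurable_cst.
    by apply/funext => w; rewrite /V subrr.
  have jo : (j < i.+1)%N by rewrite ltnS ltnW.
  have -> : V j.+1 = V j \+ Y (Ordinal jo).
    apply/funext => w; rewrite /V /Y/= /s ji (ltnW ji).
    by rewrite /=; ring.
  apply: measurable_funD; first by apply: ih; exact: ltnW.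
  by apply: measurable_off; rewrite -val_eqE/= ltn_eqF.
exact: (measurable_first_passage (x + e) mV').
Qed.

(** [U] is cut into disjoint slabs of width [e]. On the slab starting at [u], the event
    [|U + Y| < e] puts [Y] within [2 * e] of [- u], which has conditional probability at most [q].
    Truncating at [|U| < K * e] keeps the number of slabs finite. *)
Lemma independent_sum_concentration (U Y : Omega -> R) e q :
  measurable_fun setT U -> measurable_fun setT Y -> 0 < e ->
  (forall u v (B : set R), measurable B ->
     pr P ([set w | u <= U w < v] `&` Y @^-1` B) =
     pr P [set w | u <= U w < v] * pr P (Y @^-1` B)) ->
  (forall x, pr P [set w | `|Y w - x| <= 2 * e] <= q) ->
  pr P [set w | `|U w + Y w| < e] <= q.
Proof.
move=> mU mY e0 iUY Yq.
have q0 : 0 <= q by apply: le_trans (Yq 0); exact: pr_ge0.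
have mI u v : measurable [set w | u <= U w < v].
  apply: measurable_bool_set; apply: measurable_and.
    exact: measurable_fun_ler.
  exact: measurable_fun_ltr.
have mabs (f : Omega -> R) : measurable_fun setT f -> measurable_fun setT (fun w => `|f w|).
  by move=> mf; exact: measurableT_comp.
have mB : measurable [set w | `|U w + Y w| < e].
  by apply: measurable_lt_set => //; apply: mabs; exact: measurable_funD.
pose BK (K : nat) := [set w | `|U w + Y w| < e] `&` [set w | `|U w| < K%:R * e].
have mBK K : measurable (BK K).
  by apply: measurableI => //; apply: measurable_lt_set => //; exact: mabs.
have cvgB : pr P (BK K) @[K --> \oo] --> pr P [set w | `|U w + Y w| < e].
  apply: cvg_pr_nondecr => // [w|n m w nm [? ?]].
    split => [Bw|[K []]//]; exists (Num.truncn (`|U w| / e)).+1; split => //=.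
    by rewrite -ltr_pdivrMr//; exact: truncnS_gt.
  split => //=; apply: (@lt_le_trans _ _ (n%:R * e)) => //.
  by rewrite ler_pM2r// ler_nat.
have le K : pr P (BK K) <= q.
  pose I (k : nat) := [set w | (k%:R - K%:R) * e <= U w < (k%:R - K%:R + 1) * e].
  pose J (k : nat) := [set w | `|Y w - (- ((k%:R - K%:R) * e))| <= 2 * e].
  have mJ0 x : measurable [set y : R | `|y - x| <= 2 * e].
    apply: measurable_le_set => //; apply: measurableT_comp => //.
    exact: measurable_funB.
  have mJ k : measurable (J k).
    by apply: measurable_le_set => //; apply: mabs; exact: measurable_funB.
  apply: (@le_trans _ _ (\sum_(k < 2 * K) pr P (I k `&` J k))).
    apply: (@pr_bigU _ _ _ P (2 * K)%N (fun k => I k `&` J k)) => //.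
      by move=> k; apply: measurableI => //; exact: mI.
    move=> w [/= UY]; rewrite ltr_norml => /andP[U1 U2].
    have h0 : 0 <= U w / e + K%:R.
      by rewrite -lerBlDr sub0r ler_pdivlMr//; lra.
    have /andP[k1 k2] := truncn_itv h0.
    set k := Num.truncn _ in k1 k2; exists k.
      rewrite -(ltr_nat R) natrM; apply: (le_lt_trans k1).
      by rewrite -ltrBrDr ltr_pdivrMr//; lra.
    have I1 : (k%:R - K%:R) * e <= U w.
      by rewrite -ler_pdivlMr//; lra.
    have I2 : U w < (k%:R - K%:R + 1) * e.
      by rewrite -ltr_pdivrMr//; move: k2; rewrite -natr1; lra.
    split; first by rewrite /I/= I1.
    rewrite /J/= opprK; move: UY; rewrite ltr_norml ler_norml => /andP[h1 h2].
    by apply/andP; split; lra.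
  apply: (@le_trans _ _ (\sum_(k < 2 * K) q * pr P (I k))).
    apply: ler_sum => k _.
    have -> : pr P (I k `&` J k) = pr P (I k) * pr P (J k).
      exact: (iUY _ _ [set y : R | `|y - (- ((k%:R - K%:R) * e))| <= 2 * e] (mJ0 _)).
    by rewrite mulrC ler_wpM2r ?pr_ge0//; exact: Yq.
  rewrite -mulr_sumr ler_piMr//; apply: (@pr_disjoint _ _ _ P (2 * K)%N I) => //.
    by move=> k; exact: mI.
  move=> i k w /andP[ik _] /andP[_ h1] /andP[h2 _].
  have : (i%:R - K%:R + 1) * e <= (k%:R - K%:R) * e.
    have : i.+1%:R <= k%:R :> R by rewrite ler_nat.
    by rewrite -natr1 ler_pM2r//; lra.
  lra.
apply: (cvgr_to_le cvgB); apply: nearW => K; exact: le.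
Qed.

Lemma bigmaxB I (r : seq I) (F : I -> R) x c :
  \big[Num.max/x]_(i <- r) F i - c = \big[Num.max/x - c]_(i <- r) (F i - c).
Proof.
by elim: r => [|i r ih]; rewrite ?big_nil// !big_cons -ih addr_maxl.
Qed.

Lemma measurable_bigmax d' (T : measurableType d') I (r : seq I) (F : I -> T -> R)
    (f : T -> R) (Q : pred I) :
  measurable_fun setT f -> (forall i, Q i -> measurable_fun setT (F i)) ->
  measurable_fun setT (fun w => \big[Num.max/f w]_(i <- r | Q i) F i w).
Proof.
move=> mf mF; elim: r => [|i r ih].
  by under eq_fun do rewrite big_nil.
under eq_fun do rewrite big_cons.
by case Qi: (Q i) => //; apply: measurable_maxr => //; exact: mF.
Qed.

(* The difference of the two maxima is the increment W b - W a plus a function of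
   the other increments. *)
Lemma gap_concentration W (a b n : nat) e q :
  (forall j, measurable_fun setT (W j)) -> independent_increments W ->
  (a <= b <= n)%N -> 0 < e ->
  (forall x, pr P [set w | `|W b w - W a w - x| <= 2 * e] <= q) ->
  pr P [set w | `|\big[Num.max/W b w]_(b <= k < n.+1) W k w -
                  \big[Num.max/W 0%N w]_(0 <= k < a.+1) W k w| < e] <= q.
Proof.
move=> mW iW /andP[ab bn] e0 Yq.
(* Unit steps up to [a], a single step from [a] to [b] as the coordinate of index [a], then unit
   steps from [b] to [n]. *)
pose s j := if (j <= a)%N then j else (b + (j - a.+1))%N.
have s_nd j : (s j <= s j.+1)%N.
  rewrite /s; case: ifP => ja; case: ifP => ja' //.
  - by apply: (leq_trans ja); apply: (leq_trans ab); exact: leq_addr.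
  - by move: ja; rewrite (ltnW ja').
  - by rewrite leq_add2l leq_sub2r.
pose m := (a.+1 + (n - b))%N.
have am : (a < m)%N by rewrite /m addSn ltnS leq_addr.
have iY := iW m s s_nd; set Y := (fun j : 'I_m => _) in iY.
have mY j : measurable_fun setT (Y j) by exact: measurable_funB.
pose i0 := Ordinal am.
have Y0 : Y i0 = fun w => W b w - W a w.
  by apply/funext => w; rewrite /Y/= /s leqnn ltnn subnn addn0.
pose G := g_sigma_algebraType (rectangles_off Y i0).
have mlow j : (j <= a)%N -> measurable_fun setT ((fun w => W j w - W a w) : G -> R).
  move=> ja; rewrite -(subKn ja); elim: (a - j)%N => [|i ih].
    rewrite subn0 (_ : (fun w => _) = cst 0); first exact: measurable_cst.
    by apply/funext => w; rewrite subrr.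
  have [ai|ia] := leqP a i.
    by move: ih; rewrite (eqP (_ : a - i == 0)%N) ?subn_eq0// (eqP (_ : a - i.+1 == 0)%N)// subn_eq0 ltnW.
  have jo : (a - i.+1 < m)%N by rewrite (leq_ltn_trans _ am)// leq_subr.
  rewrite (_ : (fun w => _) = (fun w => (W (a - i)%N w - W a w) - Y (Ordinal jo) w)).
    apply: measurable_funB => //; apply: measurable_off.
    by rewrite -val_eqE/= ltn_eqF// ltn_subrL (leq_ltn_trans _ ia).
  apply/funext => w; rewrite /Y/= /s leq_subr subnSK// leq_subr.
  ring.
have mhigh j : (j <= n - b)%N -> measurable_fun setT ((fun w => W (b + j)%N w - W b w) : G -> R).
  elim: j => [_|j ih jn].
    rewrite addn0 (_ : (fun w => _) = cst 0); first exact: measurable_cst.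
    by apply/funext => w; rewrite subrr.
  have jo : (a.+1 + j < m)%N by rewrite /m ltn_add2l.
  rewrite (_ : (fun w => _) = (fun w => (W (b + j)%N w - W b w) + Y (Ordinal jo) w)).
    apply: measurable_funD; first by apply: ih; exact: ltnW.
    apply: measurable_off.
    by rewrite -val_eqE/= gtn_eqF// addSn ltnS leq_addr.
  apply/funext => w; rewrite /Y/= /s.
  rewrite (_ : (a.+1 + j <= a)%N = false); last by apply/negbTE; rewrite -ltnNge addSn ltnS leq_addr.
  rewrite (_ : (a.+1 + j).+1 <= a = false)%N; last first.
    by apply/negbTE; rewrite -ltnNge addSn ltnS (leq_trans (leq_addr j a))// leqnSn.
  rewrite -addnS !addKn.
  ring.
(* The later maximum is centred at [W b] and the earlier one at [W a], so that only the other
   increments occur in [U]. *)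
pose U w := \big[Num.max/W b w - W b w]_(b <= k < n.+1) (W k w - W b w) -
  \big[Num.max/W 0%N w - W a w]_(0 <= k < a.+1) (W k w - W a w).
have UE w : \big[Num.max/W b w]_(b <= k < n.+1) W k w -
   \big[Num.max/W 0%N w]_(0 <= k < a.+1) W k w = U w + Y i0 w.
  rewrite /U -!bigmaxB Y0; ring.
have mUG : measurable_fun setT (U : G -> R).
  rewrite /U; apply: measurable_funB.
    have -> : (fun w => \big[Num.max/W b w - W b w]_(b <= k < n.+1) (W k w - W b w)) =
        (fun w => \big[Num.max/W b w - W b w]_(k <- index_iota b n.+1 | (b <= k < n.+1)%N) (W k w - W b w)).
      by apply/funext => w; rewrite [LHS]big_nat_cond; apply: eq_bigl => i; rewrite andbT.
    apply: measurable_bigmax => [|k /andP[bk kn]]; first by have := mhigh 0%N isT; rewrite addn0.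
    by have := mhigh (k - b)%N; rewrite subnKC// leq_sub2r//; exact.
  have -> : (fun w => \big[Num.max/W 0%N w - W a w]_(0 <= k < a.+1) (W k w - W a w)) =
      (fun w => \big[Num.max/W 0%N w - W a w]_(k <- index_iota 0 a.+1 | (0 <= k < a.+1)%N) (W k w - W a w)).
    by apply/funext => w; rewrite [LHS]big_nat_cond; apply: eq_bigl => i; rewrite andbT.
  apply: measurable_bigmax => [|k /andP[_ ka]]; first exact: mlow.
  exact: mlow.
under eq_set do rewrite UE.
apply: independent_sum_concentration => //.
- move=> _ B mB; rewrite setTI; apply: (sub_measurable_off mY (i0 := i0)).
  by have := mUG measurableT B mB; rewrite setTI.
- move=> u v B mB; apply: independent_off => //.
  have : measurable [set w : G | u <= U w < v].
    apply: measurable_bool_set; apply: measurable_and.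
      exact: measurable_fun_ler.
    exact: measurable_fun_ltr.
  by [].
- by move=> x; rewrite Y0.
Qed.

End increments.

(** * Maximal inequalities on dyadic skeletons *)

Section levy_skeleton.
Context {R : realType} d (Omega : measurableType d) (P : probability Omega R).
Variable X : R -> Omega -> R.
Hypothesis levyX : levy_process P X.
Implicit Types (x e q delta : R) (p r i j k l n : nat).

Lemma levy_measurable t : 0 <= t -> measurable_fun setT (X t).
Proof. by case: levyX => mX _ _ _ _; exact: mX. Qed.

Lemma levy_measurable_dy r k : measurable_fun setT (X (dy r k)).
Proof. by apply: levy_measurable; exact: dy_ge0. Qed.

Lemma levy_stationary s t (B : set R) : 0 <= s -> 0 <= t -> measurable B ->
  pr P [set w | B (X (s + t) w - X s w)] = pr P [set w | B (X t w)].
Proof. by move=> s0 t0 mB; case: levyX => _ _ _ _ /(_ _ _ _ s0 t0 mB); rewrite /pr => ->. Qed.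

Lemma levy_increments r : independent_increments P (fun j => X (dy r j)).
Proof.
move=> n s snd; case: levyX => _ _ _ + _ => /(_ n (fun i => dy r (s i))).
by move=> H; apply: H => [|i]; [exact: dy_ge0|rewrite ler_dy].
Qed.

Lemma measurable_gmax r i k : measurable_fun setT (fun w => gmax (X^~ w) r i k).
Proof. by apply: measurable_bigmax => *; exact: levy_measurable_dy. Qed.

Lemma increment_tail r i k e delta : (i <= k)%N ->
  pr P [set w | e < `|X (dy r (k - i)) w| ] <= delta ->
  pr P [set w | X (dy r k) w - X (dy r i) w < - e] <= delta.
Proof.
move=> ik; apply: le_trans.
have mI : measurable [set x : R | x < - e].
  rewrite (_ : [set _ | _] = `]-oo, - e[%classic); first exact: measurable_itv.
  by apply/seteqP; split => y /=; rewrite in_itv.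
have -> : dy r k = dy r i + dy r (k - i) :> R by rewrite -(dyB r ik) addrC subrK.
rewrite (levy_stationary (dy_ge0 _ _) (dy_ge0 _ _) mI).
have mX := levy_measurable_dy r (k - i).
apply: pr_le => [||w /= Xe].
- exact: measurable_lt_set.
- by apply: measurable_lt_set => //; exact: measurableT_comp.
- by have := ler_norm (- X (dy r (k - i)) w); rewrite normrN; lra.
Qed.

(** An inequality of Ottaviani type: after rising above [2 * K], the path either falls by more than
    [K] or still ends above [K]. *)
Lemma gmax_tail r n K delta : (n <= 2 ^ r)%N -> 0 <= delta ->
  (forall s, 0 <= s <= 1 -> pr P [set w | K < `|X s w| ] <= delta) ->
  pr P [set w | 2 * K < gmax (X^~ w) r 0 n - X 0 w] <= 3 * delta.
Proof.
move=> nr d0 Xd.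
have dyr k : (k <= n)%N -> 0 <= (dy r k : R) <= 1.
  by move=> kn; rewrite dy_ge0/= -(dy1 r) ler_dy (leq_trans kn).
have mX := levy_measurable_dy r.
have mM := measurable_gmax r 0 n.
have mX0 : measurable_fun setT (X 0) by exact: levy_measurable.
have mabs s : 0 <= s -> measurable [set w | K < `|X s w| ].
  by move=> s0; apply: measurable_lt_set => //; apply: measurableT_comp => //; exact: levy_measurable.
pose A := [set w | 2 * K < gmax (X^~ w) r 0 n - X 0 w].
have mA : measurable A by apply: measurable_lt_set => //; exact: measurable_funB.
pose B := A `&` [set w | X (dy r n) w - X 0 w <= K].
have mB : measurable B.
  by apply: measurableI => //; apply: measurable_le_set => //; exact: measurable_funB.
have prB : pr P B <= delta.
  apply: (@first_passage _ _ _ P (fun j => X (dy r j)) n (fun=> n) K K) => //.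
  - exact: levy_increments.
  - by move=> i in_; apply: increment_tail => //; apply: Xd; apply: dyr; rewrite leq_subr.
  - move=> w [/= Aw Bw]; rewrite dy0; split => [|i _ //].
    apply: contrapT => H; move: Aw; rewrite /A/= ltNge => /negP; apply.
    rewrite lerBlDr; apply: gmax_le => // l /andP[_ ln].
    rewrite leNgt; apply/negP => Xl; apply: H; exists l => //; lra.
have X00 : {ae P, forall w, X 0 w = 0} by case: levyX.
apply: (@le_trans _ _ (pr P (B `|` [set w | K < `|X (dy r n) w| ]))).
  apply: pr_le_ae => //; first by apply: measurableU => //; apply: mabs; exact: dy_ge0.
  apply: filterS X00 => w X0w Aw; rewrite /B.
  have [XK|KX] := leP (X (dy r n) w - X 0 w) K; first by left; split.
  by right => /=; rewrite X0w in KX; have := ler_norm (X (dy r n) w); lra.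
apply: (le_trans (prU _ _ _)) => //; first by apply: mabs; exact: dy_ge0.
by have := Xd _ (dyr n (leqnn n)); lra.
Qed.

(* First passage with c l the next point of the coarse skeleton, for each of the
   levels k * e up to 2 * K. *)
Lemma gmax_refine r i n K e delta1 delta2 L : (n <= 2 ^ r)%N -> 0 < e ->
  0 <= delta1 -> 0 <= delta2 -> 2 * K <= L%:R * e ->
  (forall s, 0 <= s <= dy r 1 -> pr P [set w | e < `|X s w| ] <= delta1) ->
  (forall s, 0 <= s <= 1 -> pr P [set w | K < `|X s w| ] <= delta2) ->
  pr P [set w | 2 * e < gmax (X^~ w) (r + i) 0 (n * 2 ^ i) - gmax (X^~ w) r 0 n]
    <= L.+1%:R * delta1 + 3 * delta2.
Proof.
move=> nr e0 d10 d20 KL X1 X2.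
pose Mf w := gmax (X^~ w) (r + i) 0 (n * 2 ^ i) - X 0 w.
pose Mc w := gmax (X^~ w) r 0 n - X 0 w.
have mX0 : measurable_fun setT (X 0) by exact: levy_measurable.
have mMf : measurable_fun setT Mf by apply: measurable_funB => //; exact: measurable_gmax.
have mMc : measurable_fun setT Mc by apply: measurable_funB => //; exact: measurable_gmax.
pose q := (2 ^ i)%N.
have q0 : (0 < q)%N by rewrite expn_gt0.
(* [l] rounded up to a multiple of [q], hence a point of the coarse skeleton at most [q - 1] fine
   steps later. *)
pose c l := ((l + q.-1) %/ q * q)%N.
have c_ge l : (l <= c l)%N.
  have := divn_eq (l + q.-1) q; rewrite -/(c l).
  have := ltn_pmod (l + q.-1) q0; move: (_ %% q)%N => m mq E.
  move: mq; rewrite -(prednK q0) ltnS => mq.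
  by rewrite -(leq_add2r q.-1) E leq_add2l.
have c_le l : (c l <= l + q.-1)%N by exact: leq_divM.
have c_n l : (l <= n * q)%N -> (c l <= n * q)%N.
  move=> ln; rewrite leq_mul2r; apply/orP; right.
  rewrite -ltnS ltn_divLR// mulSn (leq_ltn_trans (leq_add ln (leqnn _)))//.
  by rewrite addnC ltn_add2r prednK.
(* The fine maximum passes [(k + 1) * e] although all coarse values stay below [k * e]: the path
   must fall by more than [e] before the next coarse point. *)
pose B k := [set w | k%:R * e + e < Mf w] `&` [set w | Mc w <= k%:R * e].
have mB k : measurable (B k).
  by apply: measurableI; [exact: measurable_lt_set|exact: measurable_le_set].
have prB k : pr P (B k) <= delta1.
  apply: (@first_passage _ _ _ P (fun j => X (dy (r + i) j)) (n * q) c (k%:R * e) e) => //.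
  - exact: levy_measurable_dy.
  - exact: levy_increments.
  - move=> l ln; apply: increment_tail => //; apply: X1.
    rewrite dy_ge0/= -(dyM r i) ler_dy mul1n -/q leq_subLR.
    by apply: (leq_trans (c_le l)); rewrite leq_add2l leq_pred.
  - move=> w [/= Bf Bc]; rewrite dy0; split.
      apply: contrapT => H; move: Bf; rewrite ltNge => /negP; apply.
      rewrite lerBlDr; apply: gmax_le => // l /andP[_ ln].
      rewrite leNgt; apply/negP => Xl; apply: H; exists l => //; lra.
    move=> l ln; apply: le_trans Bc; rewrite lerD2r /c /q dyM.
    apply: (gmax_ge (X^~ w)) => /=.
    by have := c_n l ln; rewrite leq_mul2r eqn0Ngt q0.
have Mc0 w : 0 <= Mc w.
  by rewrite subr_ge0 -(dy0 r); apply: (gmax_ge (X^~ w)).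
pose C := [set w | 2 * K < Mc w].
have mC : measurable C by exact: measurable_lt_set.
apply: (@le_trans _ _ (\sum_(k < L.+2) pr P (if (k < L.+1)%N then B k else C))).
  apply: (@pr_bigU _ _ _ P L.+2 (fun k => if (k < L.+1)%N then B k else C)).
  - by move=> k; case: ifP.
  - by apply: measurable_lt_set => //; apply: measurable_funB; exact: measurable_gmax.
  - move=> w /= H.
    have [Kw|wK] := ltP (2 * K) (Mc w); first by exists L.+1; rewrite ?ltnn.
    have h0 : 0 <= Mc w / e by rewrite divr_ge0// ltW.
    pose k := Num.truncn (Mc w / e); have /andP[k1 k2] := truncn_itv h0.
    rewrite -/k in k1 k2.
    rewrite ler_pdivlMr// in k1; rewrite ltr_pdivrMr// in k2.
    (* The level is the least multiple of [e] not below the coarse maximum. It is less than [e]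
       above it, so a gap of [2 * e] leaves more than [e] above the level. *)
    have [E|Ek] := eqVneq (k%:R * e) (Mc w).
      have kL : (k < L.+1)%N.
        by rewrite ltnS -(ler_nat R) -(ler_pM2r e0) E; lra.
      exists k; first exact: ltnW.
      rewrite kL; split => /=; rewrite ?E//; move: H; rewrite /Mf /Mc; lra.
    have kL : (k.+1 < L.+1)%N.
      rewrite ltnS -(ltr_nat R) -(ltr_pM2r e0).
      by apply: (@lt_le_trans _ _ (Mc w)); [rewrite lt_neqAle Ek|lra].
    exists k.+1; first exact: ltnW.
    rewrite kL; split => /=; last exact: ltW.
    move: H k1; rewrite -natr1 mulrDl mul1r /Mf /Mc; lra.
rewrite big_ord_recr/= ltnn; apply: lerD; last exact: gmax_tail.
rewrite (eq_bigr (fun k : 'I_L.+1 => pr P (B k))); last by move=> k _; rewrite ltn_ord.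
apply: (@le_trans _ _ (\sum_(k < L.+1) delta1)); first exact: ler_sum.
by rewrite sumr_const card_ord mulr_natl.
Qed.

End levy_skeleton.

Section levy_location.
Context {R : realType} d (Omega : measurableType d) (P : probability Omega R).
Variable X : R -> Omega -> R.
Hypothesis levyX : levy_process P X.
Implicit Types (x e q delta : R) (p r i j k l n : nat).

(** The bound of [gmax_refine] does not depend on the refinement [i], and the bad events increase
    with [i], so their union obeys the same bound; off the union, the refined maxima tend to the
    supremum. *)
Lemma sup_bad p j k L K e delta1 delta2 : (k <= 2 ^ p)%N -> 0 < e ->
  0 <= delta1 -> 0 <= delta2 -> 2 * K <= L%:R * e ->
  (forall s, 0 <= s <= dy (p + j) 1 -> pr P [set w | e < `|X s w| ] <= delta1) ->
  (forall s, 0 <= s <= 1 -> pr P [set w | K < `|X s w| ] <= delta2) ->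
  exists B, [/\ measurable B, pr P B <= L.+1%:R * delta1 + 3 * delta2 &
   forall w, cadlag (X^~ w) -> ~ B w ->
    `|sup_on (X^~ w) (dy p k) - gmax (X^~ w) (p + j) 0 (k * 2 ^ j)| <= 2 * e].
Proof.
move=> kp e0 d10 d20 KL X1 X2.
pose A i := [set w | 2 * e < gmax (X^~ w) (p + j + i) 0 (k * 2 ^ j * 2 ^ i) -
   gmax (X^~ w) (p + j) 0 (k * 2 ^ j)].
have mA i : measurable (A i).
  by apply: measurable_lt_set => //; apply: measurable_funB; exact: (measurable_gmax levyX).
have kr : (k * 2 ^ j <= 2 ^ (p + j))%N by rewrite expnD leq_mul2r kp orbT.
have prA i : pr P (A i) <= L.+1%:R * delta1 + 3 * delta2.
  exact: (gmax_refine levyX i kr e0 d10 d20 KL X1 X2).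
have mB : measurable (\bigcup_i A i) by exact: bigcup_measurable.
have gmax_mono f n i m : (m <= n)%N ->
    gmax f (p + j + m) 0 (i * 2 ^ m) <= gmax f (p + j + n) 0 (i * 2 ^ n) :> R.
  move=> mn; apply: gmax_le => // l /andP[_ li].
  rewrite -(dyM (p + j + m) (n - m) l) -addnA subnKC//.
  have -> : (i * 2 ^ n = i * 2 ^ m * 2 ^ (n - m))%N by rewrite -mulnA -expnD subnKC.
  by apply: gmax_ge; rewrite leq_mul2r li orbT.
exists (\bigcup_i A i); split => //.
- have : pr P (A i) @[i --> \oo] --> pr P (\bigcup_i A i).
    apply: cvg_pr_nondecr => // [w|n m w nm].
      by split => [[i _ Ai]|[i Ai]]; exists i.
    rewrite /A/= => H; apply: (lt_le_trans H); rewrite lerD2r.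
    exact: gmax_mono.
  by move=> h; apply: (cvgr_to_le h); apply: nearW => i; exact: prA.
- move=> w cf nB.
  have le i : gmax (X^~ w) (p + j + i) 0 (k * 2 ^ j * 2 ^ i) <=
      gmax (X^~ w) (p + j) 0 (k * 2 ^ j) + 2 * e.
    rewrite leNgt; apply/negP => h; apply: nB; exists i => //; rewrite /A/=; lra.
  have h1 : gmax (X^~ w) (p + j) 0 (k * 2 ^ j) <= sup_on (X^~ w) (dy p k).
    by have := @gmax_le_sup_int _ (X^~ w) (p + j) 0 (k * 2 ^ j) cf isT; rewrite dyM dy0.
  have h2 : sup_on (X^~ w) (dy p k) <= gmax (X^~ w) (p + j) 0 (k * 2 ^ j) + 2 * e.
    have := @cvg_gmax _ (X^~ w) (p + j) 0 (k * 2 ^ j) cf isT.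
    rewrite dyM dy0 => h; apply: (cvgr_to_le h); apply: nearW => i.
    by rewrite mul0n; exact: le.
  by rewrite ger0_norm ?subr_ge0//; lra.
Qed.

(** The gap of the path is the limit of the gaps [D i] of its skeletons. A tie is a strict
    inequality, so it holds for all large [i]: it lies in the lower limit of the events [A i], each
    of probability at most [q]. *)
Lemma tie_bad p k e q : (k < 2 ^ p)%N -> 0 < e ->
  (forall x, pr P [set w | `|X (dy p 1) w - x| <= 2 * e] <= q) ->
  exists B, [/\ measurable B, pr P B <= q &
   forall w, cadlag (X^~ w) -> tie e p (X^~ w) k -> B w].
Proof.
move=> kp e0 Xq.
pose D i w := gmax (X^~ w) (p + i) (k.+1 * 2 ^ i) (2 ^ p * 2 ^ i) -
   gmax (X^~ w) (p + i) 0 (k * 2 ^ i).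
have mD i : measurable_fun setT (D i).
  by apply: measurable_funB; exact: (measurable_gmax levyX).
pose A i := [set w | `|D i w| < e].
have mA i : measurable (A i) by apply: measurable_lt_set => //; exact: measurableT_comp.
have mX := levy_measurable_dy levyX.
have prA i : pr P (A i) <= q.
  apply: (@gap_concentration _ _ _ P (fun l => X (dy (p + i) l)) (k * 2 ^ i)
    (k.+1 * 2 ^ i) (2 ^ p * 2 ^ i) e q) => //.
  - exact: levy_increments.
  - by rewrite !leq_mul2r leqnSn kp !orbT.
  - move=> x; rewrite !dyM; apply: le_trans (Xq x).
    have -> : dy p k.+1 = dy p k + dy p 1 :> R.
      by rewrite -(subSnn k) -dyB// addrC subrK.
    have mI : measurable [set y : R | `|y - x| <= 2 * e].
      apply: measurable_le_set => //; apply: measurableT_comp => //.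
      exact: measurable_funB.
    by have := levy_stationary levyX (dy_ge0 p k) (dy_ge0 p 1) mI => /= ->.
pose C i0 := \bigcap_(i in [set i | (i0 <= i)%N]) A i.
have mC i0 : measurable (C i0) by apply: bigcap_measurableType => i _; exact: mA.
have mB : measurable (\bigcup_i C i) by exact: bigcup_measurable.
exists (\bigcup_i C i); split => //.
- have : pr P (C i) @[i --> \oo] --> pr P (\bigcup_i C i).
    apply: cvg_pr_nondecr => // [w|n m w nm Cn i /= mi].
      by split => [[i _ Ai]|[i Ai]]; exists i.
    by apply: Cn => /=; exact: leq_trans mi.
  move=> h; apply: (cvgr_to_le h); apply: nearW => i; apply: le_trans (prA i).
  by apply: pr_le => // w; apply => /=.
- move=> w cf tw.
  have : D i w @[i --> \oo] --> sup_int (X^~ w) (dy p k.+1) 1 - sup_on (X^~ w) (dy p k).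
    apply: cvgB; first by rewrite -(dy1 p); exact: cvg_gmax.
    have := @cvg_gmax _ (X^~ w) p 0 k cf isT; rewrite dy0.
    by under eq_fun do rewrite mul0n.
  move=> /cvg_norm/cvgr_lt/(_ e tw)[i0 _ H].
  by exists i0 => // i /= i0i; exact: H.
Qed.

Definition skeleton_location e p j f : R :=
  location e p (fun k => gmax f (p + j) 0 (k * 2 ^ j)).

(** One exceptional event for the supremum and one for the tie at each of the [2 ^ p + 1] dyadic
    times. The term [4 * e1 / e] is the Lipschitz constant [2 / e] of [location] applied to the
    error [2 * e1]. *)
Lemma location_bad p j L K e e1 delta1 delta2 delta3 : 0 < e -> 0 < e1 ->
  0 <= delta1 -> 0 <= delta2 -> 0 <= delta3 -> 2 * K <= L%:R * e1 ->
  (forall s, 0 <= s <= dy (p + j) 1 -> pr P [set w | e1 < `|X s w| ] <= delta1) ->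
  (forall s, 0 <= s <= 1 -> pr P [set w | K < `|X s w| ] <= delta2) ->
  (forall x, pr P [set w | `|X (dy p 1) w - x| <= 2 * e] <= delta3) ->
  exists B, [/\ measurable B,
    pr P B <= (2 ^ p).+1%:R * (L.+1%:R * delta1 + 3 * delta2 + delta3) &
   forall w, cadlag (X^~ w) -> ~ B w ->
    `|sup_on (X^~ w) 1 - gmax (X^~ w) (p + j) 0 (2 ^ (p + j))| <= 2 * e1 /\
    `|time_of_sup (X^~ w) 1 - skeleton_location e p j (X^~ w)| <=
        2 / 2 ^+ p + 4 * e1 / e].
Proof.
move=> e0 e10 d10 d20 d30 KL X1 X2 X3.
set b := L.+1%:R * delta1 + 3 * delta2.
have b0 : 0 <= b by rewrite addr_ge0 ?mulr_ge0.
have exS k : exists B : set Omega, [/\ measurable B, pr P B <= b & (k <= 2 ^ p)%N ->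
   forall w, cadlag (X^~ w) -> ~ B w ->
    `|sup_on (X^~ w) (dy p k) - gmax (X^~ w) (p + j) 0 (k * 2 ^ j)| <= 2 * e1].
  have [kp|kp] := leqP k (2 ^ p).
    by have [B [mB pB HB]] := sup_bad kp e10 d10 d20 KL X1 X2; exists B.
  by exists set0; split => //; rewrite /pr measure0.
have exT k : exists B : set Omega, [/\ measurable B, pr P B <= delta3 & (k < 2 ^ p)%N ->
   forall w, cadlag (X^~ w) -> tie e p (X^~ w) k -> B w].
  have [kp|kp] := ltnP k (2 ^ p).
    by have [B [mB pB HB]] := tie_bad kp e0 X3; exists B.
  by exists set0; split => //; rewrite /pr measure0.
have [S HS] := choice exS; have [T HT] := choice exT.
pose A k := S k `|` T k.
have mA k : measurable (A k).
  by apply: measurableU; [have [] := HS k|have [] := HT k].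
have prA k : pr P (A k) <= b + delta3.
  have [mS pS _] := HS k; have [mT pT _] := HT k.
  by apply: (le_trans (prU _ _ _)) => //; exact: lerD.
pose B := \bigcup_(k in [set k | (k < (2 ^ p).+1)%N]) A k.
have mB : measurable B by exact: bigcup_measurable.
exists B; split => //.
  apply: (@le_trans _ _ (\sum_(k < (2 ^ p).+1) pr P (A k))).
    by apply: (@pr_bigU _ _ _ P _ A) => // w [k /= kp Ak]; exists k.
  apply: (@le_trans _ _ (\sum_(k < (2 ^ p).+1) (b + delta3))).
    by apply: ler_sum => k _; exact: prA.
  by rewrite sumr_const card_ord mulr_natl.
move=> w cf nB.
have close k : (k <= 2 ^ p)%N ->
    `|sup_on (X^~ w) (dy p k) - gmax (X^~ w) (p + j) 0 (k * 2 ^ j)| <= 2 * e1.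
  move=> kp; have [_ _ /(_ kp w cf)] := HS k; apply => Sw.
  by apply: nB; exists k => //; left.
split.
  by have := close _ (leqnn _); rewrite dy1 -expnD.
have notie k : (k < 2 ^ p)%N -> ~ tie e p (X^~ w) k.
  move=> kp tk; have [_ _ /(_ kp w cf tk) Tw] := HT k.
  by apply: nB; exists k; [exact: ltnW|right].
have h1 := time_of_sup_location cf e0 notie.
have h2 := @location_lipschitz _ e p (fun k => sup_on (X^~ w) (dy p k))
  (fun k => gmax (X^~ w) (p + j) 0 (k * 2 ^ j)) (2 * e1) e0 close.
rewrite -/(skeleton_location _ _ _ _) in h2.
have := ler_distD (location e p (fun k => sup_on (X^~ w) (dy p k)))
  (time_of_sup (X^~ w) 1) (skeleton_location e p j (X^~ w)).
have -> : 4 * e1 / e = 2 * (2 * e1) / e by rewrite mulrA -natrM.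
lra.
Qed.

End levy_location.

(** * Stable laws and convergence of the increments *)

Section expectation_toolkit.
Context {R : realType} d (Omega : measurableType d) (P : probability Omega R).
Implicit Types (f g : Omega -> R) (M e c x : R) (A B : set Omega).

Definition Ex f : R := \int[P]_w f w.

Lemma integrable_bounded f M : measurable_fun setT f -> (forall w, `|f w| <= M) ->
  P.-integrable setT (EFin \o f).
Proof.
move=> mf fM; apply: measurable_bounded_integrable => //.
  by rewrite (le_lt_trans (probability_le1 _ _)) ?ltry.
by exists M; split; [exact: num_real|move=> x Mx w _ /=; rewrite (le_trans (fM w))// ltW].
Qed.

Lemma expectation_Ex f M : measurable_fun setT f -> (forall w, `|f w| <= M) ->
  ('E_P[f])%E = (Ex f)%:E.
Proof.
move=> mf fM; rewrite unlock /Ex /Rintegral fineK//.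
exact: integrable_fin_num (integrable_bounded mf fM).
Qed.

Lemma Ex_cst x : Ex (fun=> x) = x.
Proof.
rewrite /Ex Rintegral_cst//; change (x * fine (P setT) = x).
by rewrite probability_setT/= mulr1.
Qed.

Lemma Ex_indic A : measurable A -> Ex \1_A = pr P A.
Proof. by move=> mA; rewrite /Ex /Rintegral integral_indic// setIT. Qed.

Lemma Ex_le f g M : measurable_fun setT f -> measurable_fun setT g ->
  (forall w, `|f w| <= M) -> (forall w, `|g w| <= M) ->
  (forall w, f w <= g w) -> Ex f <= Ex g.
Proof.
move=> mf mg fM gM fg; apply: le_Rintegral => //; exact: integrable_bounded.
Qed.

Lemma ExD f g M : measurable_fun setT f -> measurable_fun setT g ->
  (forall w, `|f w| <= M) -> (forall w, `|g w| <= M) ->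
  Ex (fun w => f w + g w) = Ex f + Ex g.
Proof. by move=> mf mg fM gM; apply: RintegralD => //; exact: integrable_bounded. Qed.

Lemma ExZ f c M : measurable_fun setT f -> (forall w, `|f w| <= M) ->
  Ex (fun w => c * f w) = c * Ex f.
Proof. by move=> mf fM; apply: RintegralZl => //; exact: integrable_bounded. Qed.

Lemma ExN f M : measurable_fun setT f -> (forall w, `|f w| <= M) ->
  Ex (fun w => - f w) = - Ex f.
Proof.
move=> mf fM; rewrite -mulN1r -(ExZ (-1) mf fM); congr Rintegral.
by apply/funext => w; rewrite mulN1r.
Qed.

Lemma Ex_le_indic f g M e c A : measurable_fun setT f -> measurable_fun setT g ->
  (forall w, `|f w| <= M) -> (forall w, `|g w| <= M) -> measurable A ->
  (forall w, f w <= g w + (e + c * \1_A w)) -> Ex f <= Ex g + (e + c * pr P A).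
Proof.
move=> mf mg fM gM mA fg.
have mI : measurable_fun setT (\1_A : Omega -> R) by exact: measurable_indic.
have bI w : `|\1_A w : R| <= 1 by rewrite indicE; case: (_ \in _); rewrite ?normr1 ?normr0.
have mcI : measurable_fun setT (fun w => c * \1_A w : R) by exact: measurable_funM.
have bcI w : `|c * \1_A w : R| <= `|c| by rewrite normrM ler_piMr.
have meI : measurable_fun setT (fun w => e + c * \1_A w : R) by exact: measurable_funD.
have beI w : `|e + c * \1_A w : R| <= `|e| + `|c|.
  by rewrite (le_trans (ler_normD _ _))// lerD2l.
have <- : Ex (fun w => e + c * \1_A w) = e + c * pr P A.
  rewrite (@ExD (fun=> e) (fun w => c * \1_A w) (`|e| + `|c|)) ?Ex_cst//.
  - by rewrite (ExZ c mI bI) Ex_indic.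
  - by move=> _; rewrite lerDl.
  - by move=> w; rewrite (le_trans (bcI w))// lerDr.
pose N := `|M| + (`|e| + `|c|).
have fN w : `|f w| <= N.
  by rewrite (le_trans (fM w))// (le_trans (ler_norm M))// lerDl addr_ge0.
have gN w : `|g w| <= N.
  by rewrite (le_trans (gM w))// (le_trans (ler_norm M))// lerDl addr_ge0.
have eN w : `|e + c * \1_A w : R| <= N.
  by rewrite (le_trans (beI w))// lerDr.
rewrite -(ExD mg meI gN eN).
apply: (@Ex_le _ _ (N + N)) => //.
- exact: measurable_funD.
- by move=> w; rewrite (le_trans (fN w))// lerDl (le_trans _ (fN w)).
- by move=> w; rewrite (le_trans (ler_normD _ _))// lerD.
Qed.

Lemma Ex_close f g M e A : measurable_fun setT f -> measurable_fun setT g ->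
  (forall w, `|f w| <= M) -> (forall w, `|g w| <= M) -> measurable A -> 0 <= e ->
  {ae P, forall w, ~ A w -> `|f w - g w| <= e} ->
  `|Ex f - Ex g| <= e + 2 * M * pr P A.
Proof.
move=> mf mg fM gM mA e0 [N [mN N0 sN]].
pose B := A `|` N.
have mB : measurable B by exact: measurableU.
have fg w : `|f w - g w| <= e + 2 * M * \1_B w.
  have [Bw|nBw] := pselect (B w).
    rewrite indicE mem_set// mulr1; have := ler_normB (f w) (g w).
    by have := fM w; have := gM w; lra.
  rewrite indicE memNset// mulr0 addr0; apply: contrapT => H; apply: (nBw); right.
  by apply: sN => /= h; apply: H; apply: h => Aw; apply: nBw; left.
have prB : pr P B <= pr P A.
  apply: (le_trans (prU _ mA mN)); have PN : P N = 0%E by [].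
  by rewrite {2}/pr PN/= addr0.
(* A point of the space is needed to see that [M] is nonnegative. *)
have [w0] : exists w : Omega, True.
  apply: contrapT => H; have := probability_setT P.
  have -> : [set: Omega] = set0 by apply/seteqP; split => // w _; apply: H; exists w.
  by rewrite measure0 => -[] /eqP; rewrite eq_sym oner_eq0.
move=> _.
have M2 : 0 <= 2 * M by rewrite mulr_ge0// (le_trans (normr_ge0 _) (fM w0)).
have h : e + 2 * M * pr P B <= e + 2 * M * pr P A by rewrite lerD2l ler_wpM2l.
have h1 := @Ex_le_indic f g M e (2 * M) B mf mg fM gM mB.
have h2 := @Ex_le_indic g f M e (2 * M) B mg mf gM fM mB.
rewrite ler_norml; apply/andP; split.
- suff : Ex g <= Ex f + (e + 2 * M * pr P B) by lra.
  by apply: h2 => w; have /ler_normlP[h3 h4] := fg w; lra.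
- suff : Ex f <= Ex g + (e + 2 * M * pr P B) by lra.
  by apply: h1 => w; have /ler_normlP[h3 h4] := fg w; lra.
Qed.

Lemma Ex_sum (I : finType) (F : I -> Omega -> R) M :
  (forall i, measurable_fun setT (F i)) -> (forall i w, `|F i w| <= M) ->
  Ex (fun w => \sum_i F i w) = \sum_i Ex (F i).
Proof.
move=> mF FM.
have bsum (s : seq I) w : `|\sum_(i <- s) F i w| <= \sum_(i <- s) M.
  by rewrite (le_trans (ler_norm_sum _ _ _))// ler_sum.
elim: (index_enum I) => [|i s ih].
  under eq_fun do rewrite big_nil.
  by rewrite big_nil Ex_cst.
under eq_fun do rewrite big_cons.
rewrite big_cons -ih; apply: (@ExD _ _ (`|M| + `|\sum_(i <- s) M|)) => //.
- exact: measurable_sum.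
- by move=> w; rewrite (le_trans (FM i w))// (le_trans (ler_norm M))// lerDl.
- by move=> w; rewrite (le_trans (bsum s w))// (le_trans (ler_norm _))// lerDr.
Qed.

End expectation_toolkit.

Section clamp.
Context {R : realType}.
Implicit Types (a b c e x : R).

Definition clamp a : R := Num.min 1 (Num.max 0 a).

Lemma clamp_itv a : 0 <= clamp a <= 1.
Proof. by rewrite /clamp le_min ler01 le_max lexx ge_min lexx. Qed.

Lemma clamp_ge1 a : 1 <= a -> clamp a = 1.
Proof.
move=> a1; rewrite /clamp; have -> : Num.max 0 a = a by apply/max_idPr; lra.
exact/min_idPl.
Qed.

Lemma clamp_le0 a : a <= 0 -> clamp a = 0.
Proof.
move=> a1; rewrite /clamp; have -> : Num.max 0 a = 0 by apply/max_idPl.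
by apply/min_idPr.
Qed.

Lemma clamp_lipschitz a b : `|clamp a - clamp b| <= `|a - b|.
Proof.
have := ler_norm (a - b); have := ler_norm (- (a - b)); rewrite normrN => h1 h2.
rewrite /clamp ler_norml /Num.min /Num.max.
by do 4 (case: ifP => [|/negbT]; rewrite -?leNgt); move=> *; apply/andP; split; lra.
Qed.

Lemma clamp_continuous : continuous clamp.
Proof.
move=> x; apply/cvgrPdist_le => e e0; near=> y.
apply: (le_trans (clamp_lipschitz _ _)); near: y.
exact: cvgr_dist_le e0.
Unshelve. all: by end_near. Qed.

End clamp.

Lemma measurable_fun_open (R : realType) d (T : measurableType d) (f : T -> R) :
  (forall U : set R, open U -> measurable (f @^-1` U)) -> measurable_fun setT f.
Proof.
move=> mf; apply: (measurability _ (RGenOInfty.measurableE R)) => _ [_ [a ->] <-].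
by rewrite setTI; apply: mf; exact: interval_open.
Qed.

Section ramp.
Context {R : realType}.
Implicit Types (c e x : R).

Lemma bounded_clamp d1 (T : measurableType d1) (f : T -> R) w : `|clamp (f w)| <= 1.
Proof. by have /andP[h1 h2] := clamp_itv (f w); rewrite ger0_norm. Qed.

(** A Lipschitz function between the indicators of [x <= c] and [x <= c + e]. *)
Definition ramp c e x : R := clamp ((c + e - x) / e).

Lemma ramp_continuous c e : continuous (ramp c e).
Proof.
move=> x; apply: (@continuous_comp _ _ _ (fun y : R => (c + e - y) / e) clamp); last exact: clamp_continuous.
by apply: cvgM; [apply: cvgB; [exact: cvg_cst|exact: cvg_id]|exact: cvg_cst].
Qed.

Lemma ramp1 c e x : 0 < e -> x <= c -> ramp c e x = 1.
Proof. by move=> e0 xc; rewrite /ramp clamp_ge1// ler_pdivlMr//; lra. Qed.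

Lemma ramp0 c e x : 0 < e -> c + e <= x -> ramp c e x = 0.
Proof. by move=> e0 xc; rewrite /ramp clamp_le0// ler_pdivrMr//; lra. Qed.

Lemma ramp_indic d1 (T : measurableType d1) (Q : probability T R) (V : T -> R) c e :
  measurable_fun setT V -> 0 < e ->
  pr Q [set w | V w <= c] <= Ex Q (ramp c e \o V) <= pr Q [set w | V w <= c + e].
Proof.
move=> mV e0.
have mle x : measurable [set w | V w <= x] by exact: measurable_le_set.
have mr : measurable_fun setT (ramp c e \o V).
  by apply: measurableT_comp => //; apply: continuous_measurable_fun; exact: ramp_continuous.
have br w : `|(ramp c e \o V) w| <= 1 by exact: bounded_clamp.
have bI A (w : T) : `|\1_A w : R| <= 1 by rewrite indicE; case: (_ \in _); rewrite ?normr1 ?normr0.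
have ramp01 x : 0 <= ramp c e x <= 1 by exact: clamp_itv.
apply/andP; split; rewrite -Ex_indic//.
  apply: (@Ex_le _ _ _ Q _ _ 1) => // w; rewrite indicE.
  have [Vw|Vw] := pselect (V w <= c); first by rewrite mem_set//= ramp1.
  by rewrite memNset//=; have /andP[] := ramp01 (V w).
apply: (@Ex_le _ _ _ Q _ _ 1) => // w; rewrite indicE.
have [Vw|Vw] := pselect (V w <= c + e).
  by rewrite mem_set//=; have /andP[] := ramp01 (V w).
by rewrite memNset//= ramp0// leNgt; apply/negP => h; apply: Vw; exact: ltW.
Qed.

Lemma ramp_itv c e x : 0 <= ramp c e x <= 1.
Proof. exact: clamp_itv. Qed.

Lemma ramp_lipschitz c e x y : 0 < e -> `|ramp c e x - ramp c e y| <= e^-1 * `|x - y|.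
Proof.
move=> e0; apply: (le_trans (clamp_lipschitz _ _)).
have -> : (c + e - x) / e - (c + e - y) / e = e^-1 * (y - x) by field; rewrite gt_eqF.
by rewrite normrM (@gtr0_norm _ e^-1) ?invr_gt0// distrC.
Qed.

End ramp.

(** * Convergence of distribution functions *)

Section cdf.
Context {R : realType} d d' (Omega : measurableType d) (Omega' : measurableType d').
Variables (P : probability Omega R) (P' : probability Omega' R).
Implicit Types (c e x : R).

Variables (Y : R -> Omega -> R) (Z : Omega' -> R).
Hypotheses (mY : forall T, 0 < T -> measurable_fun setT (Y T)) (mZ : measurable_fun setT Z).

(** The versions in [cvg_in_law] can be replaced by the variables themselves, which are measurable
    here and almost surely equal to them. *)
Lemma cvg_in_law_Ex : cvg_in_law P P' Y Z ->
  forall f : R -> R, continuous f -> (exists M, forall x, `|f x| <= M) ->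
  Ex P (f \o Y T) @[T --> +oo] --> Ex P' (f \o Z).
Proof.
move=> [Y' [Z' [vY vZ cvgE]]] f cf [M fM].
have mf : measurable_fun setT f by exact: continuous_measurable_fun.
have mY' T : 0 < T -> measurable_fun setT (Y' T).
  by move=> T0; apply: measurable_fun_open => U oU; have [mYU _] := vY T T0; exact: mYU.
have mZ' : measurable_fun setT Z'.
  by apply: measurable_fun_open => U oU; have [mYU _] := vZ; exact: mYU.
have EY T : 0 < T -> Ex P (f \o Y T) = Ex P (f \o Y' T).
  move=> T0; apply/eqP; rewrite -subr_eq0 -normr_le0.
  have [_ YY'] := vY T T0.
  have := @Ex_close _ _ _ P (f \o Y T) (f \o Y' T) M 0 set0.
  rewrite /pr measure0 mulr0 addr0; apply => //.
  - by apply: measurableT_comp => //; exact: mY.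
  - by apply: measurableT_comp => //; exact: mY'.
  - by move=> w; exact: fM.
  - by move=> w; exact: fM.
  - by apply: filterS YY' => w /= -> _; rewrite subrr normr0.
have EZ : Ex P' (f \o Z) = Ex P' (f \o Z').
  apply/eqP; rewrite -subr_eq0 -normr_le0.
  have [_ ZZ'] := vZ.
  have := @Ex_close _ _ _ P' (f \o Z) (f \o Z') M 0 set0.
  rewrite /pr measure0 mulr0 addr0; apply => //.
  - exact: measurableT_comp.
  - exact: measurableT_comp.
  - by move=> w; exact: fM.
  - by move=> w; exact: fM.
  - by apply: filterS ZZ' => w /= -> _; rewrite subrr normr0.
rewrite EZ.
have : ('E_P[f \o Y' T])%E @[T --> +oo] --> (Ex P' (f \o Z'))%:E.
  rewrite -(@expectation_Ex _ _ _ P' _ M); last by move=> w; exact: fM.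
    by apply: cvgE => //; exists M.
  exact: measurableT_comp.
move=> /fine_cvg; apply: cvg_trans; apply: near_eq_cvg; near=> T.
have T0 : 0 < T by near: T; exact: nbhs_pinfty_gt.
rewrite EY//= (@expectation_Ex _ _ _ P _ M)//; last by move=> w; exact: fM.
by apply: measurableT_comp => //; exact: mY'.
Unshelve. all: by end_near. Qed.

Hypothesis cvgYZ : forall f : R -> R, continuous f -> (exists M, forall x, `|f x| <= M) ->
  Ex P (f \o Y T) @[T --> +oo] --> Ex P' (f \o Z).

Hypothesis atomless : forall x, pr P' [set w | Z w = x] = 0.

Let mle x : measurable [set w | Z w <= x].
Proof. exact: measurable_le_set. Qed.

Lemma cdf_right c e : 0 < e ->
  exists2 h, 0 < h & pr P' [set w | Z w <= c + h] <= pr P' [set w | Z w <= c] + e.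
Proof.
move=> e0.
have : pr P' [set w | Z w <= c + n.+1%:R^-1] @[n --> \oo] --> pr P' [set w | Z w <= c].
  apply: cvg_pr_nonincr => // [w|n m w nm /=].
    split => [/= Zc k|/= H]; first by rewrite (le_trans Zc)// lerDl.
    apply/ler_addgt0Pr => x x0.
    have := @cvg_harmonic R; move/cvgrPdist_le => /(_ _ x0)[k _ /(_ k (leqnn _))].
    rewrite /= sub0r normrN ger0_norm// => h; apply: (le_trans (H k)); rewrite lerD2l; exact: h.
  move=> h; apply: (le_trans h); rewrite lerD2l lef_pV2 ?posrE//.
  by rewrite ler_nat ltnS.
move=> /cvgrPdist_le/(_ _ e0)[k _ /(_ k (leqnn _))].
by rewrite distrC ler_norml => /andP[_ h]; exists k.+1%:R^-1 => //; lra.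
Qed.

Lemma cdf_left c e : 0 < e ->
  exists2 h, 0 < h & pr P' [set w | Z w <= c] - e <= pr P' [set w | Z w <= c - h].
Proof.
move=> e0.
have mlt : measurable [set w | Z w < c] by exact: measurable_lt_set.
have -> : pr P' [set w | Z w <= c] = pr P' [set w | Z w < c].
  have mE : measurable [set w | Z w = c].
    rewrite (_ : [set _ | _] = [set w | Z w <= c] `\` [set w | Z w < c]).
      exact: measurableD.
    apply/seteqP; split => w /=; first by move=> ->; rewrite lexx ltxx.
    by move=> [h /negP]; rewrite -leNgt => h'; apply/eqP; rewrite eq_le h.
  apply/eqP; rewrite eq_le; apply/andP; split; last first.
    by apply: pr_le => // w /=; exact: ltW.
  rewrite -[leRHS]addr0 -(atomless c); apply: (le_trans _ (prU _ mlt mE)).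
  apply: pr_le => //; first exact: measurableU.
  by move=> w /=; rewrite le_eqVlt => /orP[/eqP|]; [right|left].
have : pr P' [set w | Z w <= c - n.+1%:R^-1] @[n --> \oo] --> pr P' [set w | Z w < c].
  apply: cvg_pr_nondecr => // [w|n m w nm /= h].
    split => [/= Zc|/= [k h]].
      have x0 : 0 < c - Z w by lra.
      have := @cvg_harmonic R; move/cvgrPdist_le => /(_ _ x0)[k _ /(_ k (leqnn _))].
      by rewrite /= sub0r normrN ger0_norm// => h; exists k; rewrite lerBrDl -lerBrDr; exact: h.
    by apply: (le_lt_trans h); rewrite ltrBlDr ltrDl.
  apply: (le_trans h); rewrite lerD2l lerN2 lef_pV2 ?posrE//.
  by rewrite ler_nat ltnS.
move=> /cvgrPdist_le/(_ _ e0)[k _ /(_ k (leqnn _))].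
by rewrite ler_norml => /andP[_ h]; exists k.+1%:R^-1 => //; lra.
Qed.

(** Ramps on either side of [c] squeeze the distribution functions; the two ramps have close
    expectations in the limit because the limit law has no atom at [c]. *)
Lemma cvg_cdf c : pr P [set w | Y T w <= c] @[T --> +oo] --> pr P' [set w | Z w <= c].
Proof.
apply/cvgrPdist_le => e e0.
have e2 : 0 < e / 2 by lra.
have [h h0 Hh] := cdf_right c e2.
have [k k0 Hk] := cdf_left c e2.
have bnd x y : exists M, forall z, `|ramp x y z| <= M.
  by exists 1 => z; have /andP[h1 h2] := clamp_itv ((x + y - z) / y); rewrite ger0_norm.
have /cvgrPdist_le/(_ _ e2) n1 := cvgYZ (@ramp_continuous _ c h) (bnd c h).
have /cvgrPdist_le/(_ _ e2) n2 := cvgYZ (@ramp_continuous _ (c - k) k) (bnd (c - k) k).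
near=> T.
have T0 : 0 < T by near: T; exact: nbhs_pinfty_gt.
have : `|Ex P' (ramp c h \o Z) - Ex P (ramp c h \o Y T)| <= e / 2 by near: T.
have : `|Ex P' (ramp (c - k) k \o Z) - Ex P (ramp (c - k) k \o Y T)| <= e / 2 by near: T.
have /andP[a1 a2] := ramp_indic P c (mY T0) h0.
have /andP[a3 a4] := ramp_indic P' c mZ h0.
have /andP[a5 a6] := ramp_indic P (c - k) (mY T0) k0.
have /andP[a7 a8] := ramp_indic P' (c - k) mZ k0.
rewrite subrK in a6 a8.
rewrite !ler_norml => /andP[b1 b2] /andP[b3 b4].
by apply/andP; split; lra.
Unshelve. all: by end_near. Qed.

End cdf.

(** * Atoms of sums of independent variables *)

Section atoms.
Context {R : realType} d (Omega : measurableType d) (P : probability Omega R).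
Implicit Types (x y z q : R) (Y : Omega -> R).

Lemma measurable_eq_set d' (T : measurableType d') (f : T -> R) x :
  measurable_fun setT f -> measurable [set w | f w = x].
Proof.
move=> mf; rewrite (_ : [set _ | _] = [set w | f w <= x] `\` [set w | f w < x]).
  by apply: measurableD; [exact: measurable_le_set|exact: measurable_lt_set].
apply/seteqP; split => w /=; first by move=> ->; rewrite lexx ltxx.
by move=> [h /negP]; rewrite -leNgt => h'; apply/eqP; rewrite eq_le h.
Qed.

(** By Fubini, [P (Y0 + Y1 = z)] is the mean of [h (Y0)], where [h x = P (Y1 = z - x)] is at most
    [q]. A mean of at least [q] forces [h (Y0) = q] almost surely. *)
Lemma independent_sum_max_atom Y0 Y1 z q :
  measurable_fun setT Y0 -> measurable_fun setT Y1 ->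
  (forall A B : set R, measurable A -> measurable B ->
    pr P (Y0 @^-1` A `&` Y1 @^-1` B) = pr P (Y0 @^-1` A) * pr P (Y1 @^-1` B)) ->
  (forall x, pr P [set w | Y1 w = x] <= q) ->
  q <= pr P [set w | Y0 w + Y1 w = z] ->
  {ae P, forall w, pr P [set w' | Y1 w' = z - Y0 w] = q}.
Proof.
move=> mY0 mY1 iY Yq qz.
pose Z0 : {mfun Omega >-> R} := mfun_Sub (mem_set mY0).
pose Z1 : {mfun Omega >-> R} := mfun_Sub (mem_set mY1).
pose m0 := distribution P Z0.
pose m1 := distribution P Z1.
have mY01 : measurable_fun setT (fun w => (Y0 w, Y1 w)) by exact: measurable_fun_pair.
pose Z01 : {mfun Omega >-> (R * R)%type} := mfun_Sub (mem_set mY01).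
pose X := [set p : R * R | p.1 + p.2 = z].
have mX : measurable X.
  by apply: measurable_eq_set; exact: measurable_funD.
have mpre Y (A : set R) : measurable_fun setT Y -> measurable A -> measurable (Y @^-1` A).
  by move=> mY mA; rewrite -[X in measurable X]setTI; exact: mY.
have mX1 x : [set w | Y1 w = z - x] = Y1 @^-1` xsection X x.
  apply/seteqP; split => w /= => [E|].
    by apply/xsectionP; rewrite /X/= E addrC subrK.
  by move=> /xsectionP; rewrite /X/= => <-; rewrite addrC addKr.
pose h x := pr P [set w | Y1 w = z - x].
have hE x : m1 (xsection X x) = (h x)%:E.
  by rewrite /h mX1 -prE//; apply: mpre => //; exact: measurable_xsection.
have mh : measurable_fun setT h.
  have EX : EFin \o h = m1 \o xsection X by apply/funext => x /=; rewrite hE.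
  have mEh : measurable_fun setT (EFin \o h).
    by rewrite EX; exact: measurable_fun_xsection.
  by move/measurable_EFinP : mEh.
have E : (\int[m0]_x (h x)%:E = P [set w | (Y0 w + Y1 w)%R = z])%E.
  transitivity ((m0 \x m1)%E X); first by apply: eq_integral => x _; rewrite /= hE.
  rewrite (@product_measure_unique _ _ _ _ _ m0 m1 (distribution P Z01))//.
  move=> A B mA mB.
  have := congr1 EFin (iY A B mA mB); rewrite EFinM.
  rewrite -!prE//; [exact: mpre|exact: mpre|].
  by apply: measurableI; exact: mpre.
have hq x : 0 <= h x <= q by rewrite pr_ge0/=; exact: Yq.
have q0 : 0 <= q by apply: le_trans (Yq 0); exact: pr_ge0.
have bh x : `|h x| <= q by have /andP[h0 h1] := hq x; rewrite ger0_norm.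
have mqh : measurable_fun setT (fun x => q - h x) by exact: measurable_funB.
have bqh x : `|q - h x| <= q by have /andP[h0 h1] := hq x; rewrite ger0_norm; lra.
have mE : measurable [set w | Y0 w + Y1 w = z].
  by apply: measurable_eq_set; exact: measurable_funD.
have Eh : Ex m0 h = pr P [set w | Y0 w + Y1 w = z] by rewrite /Ex /Rintegral E.
have Eqh : Ex m0 (fun x => q - h x) <= 0.
  rewrite (@ExD _ _ _ m0 (fun=> q) (fun x => - h x) q) ?Ex_cst//.
  - by rewrite (ExN m0 mh bh) Eh; lra.
  - exact: measurable_funN.
  - by move=> _; rewrite ger0_norm.
  - by move=> x; rewrite normrN.
have Iqh := integrable_bounded m0 mqh bqh.
have : (\int[m0]_x `|(q - h x)%:E| = 0)%E.
  under eq_integral => x _.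
    have /andP[h0 h1] := hq x.
    rewrite gee0_abs; last by rewrite lee_fin subr_ge0.
    over.
  apply/eqP; rewrite eq_le integral_ge0 ?andbT; last first.
    by move=> x _; rewrite lee_fin subr_ge0; have /andP[] := hq x.
  by rewrite -(fineK (integrable_fin_num _ Iqh))//= lee_fin.
have mqhE : measurable_fun setT (EFin \o (fun x => q - h x)) by exact/measurable_EFinP.
move=> /(ae_eq_integral_abs m0 measurableT mqhE).1 [N [mN N0 sN]].
exists (Y0 @^-1` N); split => //; first exact: mpre.
move=> w /= H; apply: sN => /= HN; apply: H.
by have := HN Logic.I => -[] /eqP; rewrite subr_eq0 => /eqP.
Qed.

Lemma finitely_many_atoms Y (u : nat -> R) q : measurable_fun setT Y -> 0 < q ->
  (forall i k, (i < k)%N -> u i <> u k) -> (forall n, q <= pr P [set w | Y w = u n]) ->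
  False.
Proof.
move=> mY q0 uinj uq.
have le1 n : n%:R * q <= 1.
  apply: (@le_trans _ _ (\sum_(k < n) pr P [set w | Y w = u k])).
    rewrite mulr_natl -[X in _ *+ X](card_ord n) -sumr_const.
    by apply: ler_sum => k _; exact: uq.
  apply: (@pr_disjoint _ _ _ P n (fun k => [set w | Y w = u k])).
    by move=> k; exact: measurable_eq_set.
  by move=> i k w /andP[ik _] /= -> /(uinj _ _ ik).
have := le1 (Num.truncn q^-1).+1; rewrite leNgt => /negP; apply.
by rewrite -ltr_pdivrMr// div1r truncnS_gt.
Qed.

(** Otherwise ever heavier atoms could be chosen one after another, all of mass at least that of
    [x], which is impossible. *)
Lemma max_atom Y x : measurable_fun setT Y -> 0 < pr P [set w | Y w = x] ->
  exists x0, 0 < pr P [set w | Y w = x0] /\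
    forall y, pr P [set w | Y w = y] <= pr P [set w | Y w = x0].
Proof.
move=> mY px; pose m y := pr P [set w | Y w = y].
apply: contrapT => H.
have next y : exists z, 0 < m y -> m y < m z.
  have [my|my] := ltP 0 (m y); last by exists y.
  apply: contrapT => K; apply: H; exists y; split => // z.
  by rewrite leNgt; apply/negP => yz; apply: K; exists z.
have [f Hf] := choice next.
pose u n := iter n f x.
have mu n : 0 < m (u n) by elim: n => [//|n ih]; exact: lt_trans (Hf _ ih).
have um i k : (i < k)%N -> m (u i) < m (u k).
  elim: k => // k ih; rewrite ltnS leq_eqVlt => /orP[/eqP ->|/ih h].
    exact: Hf.
  by apply: (lt_trans h); exact: Hf.
apply: (@finitely_many_atoms Y u (m x)) => //.
  by move=> i k /um + E; rewrite E ltxx.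
by case=> [|n]; [exact: lexx|exact: (ltW (um 0%N n.+1 isT))].
Qed.

(* If [x] is an atom of maximal mass [q], then [2 * x] is an atom of the sum,
   whose atoms also have mass [q]; hence reflecting in [x] preserves the atoms,
   and two of them would generate an infinite arithmetic progression. *)
Lemma self_similar_atomless Y Y0 Y1 c b :
  measurable_fun setT Y -> measurable_fun setT Y0 -> measurable_fun setT Y1 -> 0 < c ->
  (forall x, pr P [set w | Y0 w = x] = pr P [set w | Y w = x]) ->
  (forall x, pr P [set w | Y1 w = x] = pr P [set w | Y w = x]) ->
  (forall A B : set R, measurable A -> measurable B ->
    pr P (Y0 @^-1` A `&` Y1 @^-1` B) = pr P (Y0 @^-1` A) * pr P (Y1 @^-1` B)) ->
  (forall x, pr P [set w | Y0 w + Y1 w = x] = pr P [set w | c * Y w + b = x]) ->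
  (forall m : R, ~ {ae P, forall w, Y w = m}) ->
  forall x, pr P [set w | Y w = x] = 0.
Proof.
move=> mY mY0 mY1 c0 L0 L1 iY L01 nd x; pose m y := pr P [set w | Y w = y].
apply/eqP; rewrite eq_le pr_ge0 andbT leNgt; apply/negP => px.
have [x0 [q0 qmax]] := max_atom mY px; rewrite -/(m x0) in q0 qmax.
have meq y : measurable [set w | Y w = y] by exact: measurable_eq_set.
have msum z : pr P [set w | Y0 w + Y1 w = z] = m ((z - b) / c).
  rewrite L01 /m; congr pr; apply/seteqP; split => w /=.
    by move=> <-; rewrite addrK mulrC mulKf// gt_eqF.
  by move=> ->; rewrite mulrC divfK ?gt_eqF// subrK.
have mres z : m x0 <= pr P [set w | Y0 w + Y1 w = z] ->
    {ae P, forall w, m (z - Y0 w) = m x0}.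
  move=> qz; have := independent_sum_max_atom mY0 mY1 iY (q := m x0) _ qz.
  by move=> /(_ (fun y => ltac:(by rewrite L1; exact: qmax))); apply: filterS => w; rewrite L1.
have at0 := @mres (c * x0 + b) ltac:(by rewrite msum addrK mulrC mulKf ?gt_eqF).
(* An almost sure property of [Y0] holds at each of its atoms. *)
have atom_pos A y : {ae P, forall w, A (Y0 w)} -> 0 < m y -> A y.
  move=> aeA my; apply: contrapT => nA.
  have : pr P [set w | Y0 w = y] <= pr P set0.
    apply: pr_le_ae => //; first exact: measurable_eq_set.
    by apply: filterS aeA => w Aw /= E; apply: nA; rewrite -E.
  by rewrite L0 -/(m y) /(pr P set0) measure0 leNgt my.
(* The reflection [z - y] has mass [m x0], so it is an atom too; reflecting it again returns to
   [y]. *)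
have mz y : 0 < m y -> m y = m x0.
  move=> my; pose z := c * x0 + b.
  have h1 := atom_pos (fun y => m (z - y) = m x0) y at0 my.
  have h2 := atom_pos (fun y => m (z - y) = m x0) (z - y) at0.
  by have := h2 (ltac:(by rewrite h1)); rewrite opprB addrCA subrr addr0.
(* Since [Y0 = Y1 = y] has positive probability, [2 * y] is an atom of the sum. All atoms weigh
   [m x0], so [2 * y] can take the place of [z]. *)
have sym y : 0 < m y -> {ae P, forall w, m (2 * y - Y0 w) = m x0}.
  move=> my; apply: mres; rewrite msum.
  suff -> : m ((2 * y - b) / c) = m x0 by [].
  apply: mz; rewrite -msum.
  have : 0 < pr P (Y0 @^-1` [set y] `&` Y1 @^-1` [set y]).
    by rewrite iY// (L0 y : pr P (Y0 @^-1` [set y]) = m y)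
      (L1 y : pr P (Y1 @^-1` [set y]) = m y) mulr_gt0.
  move=> /lt_le_trans; apply; apply: pr_le.
  - by apply: measurableI; exact: measurable_eq_set.
  - by apply: measurable_eq_set; exact: measurable_funD.
  - by move=> w [/= -> ->]; rewrite mulr2n mulrDl mul1r.
have uniq y y' : 0 < m y -> 0 < m y' -> y = y'.
  move=> my my'; apply: contrapT => yy'.
  pose u n := y + n%:R * (y' - y).
  have refl a a' : 0 < m a -> 0 < m a' -> 0 < m (2 * a - a').
    by move=> ma ma'; rewrite (atom_pos (fun y => m (2 * a - y) = m x0) a' (sym a ma)).
  have un n : 0 < m (u n) /\ 0 < m (u n.+1).
    elim: n => [|n [h1 h2]].
      by rewrite /u mul0r addr0 mul1r addrC subrK.
    split => //; have := refl _ _ h2 h1.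
    suff -> : u n.+2 = 2 * u n.+1 - u n by [].
    by rewrite /u -addn2 -addn1 !natrD; ring.
  apply: (@finitely_many_atoms Y u (m x0)) => //.
    move=> i k ik /eqP; rewrite /u (inj_eq (addrI _)) => /eqP/mulIf.
    have : y' - y != 0 by rewrite subr_eq0; apply/eqP => E; apply: yy'.
    by move=> h /(_ h)/eqP; rewrite eqr_nat ltn_eqF.
  by move=> n; have [/mz + _] := un n; rewrite /m => ->.
apply: (nd x0).
(* Almost surely [2 * x0 - Y0] is an atom, hence equal to the only one, [x0]; so the law is
   degenerate. *)
have ae0 : {ae P, forall w, Y0 w = x0}.
  apply: filterS (sym x0 q0) => w E.
  have := uniq (2 * x0 - Y0 w) x0 (ltac:(by rewrite E)) q0.
  lra.
have m1 : m x0 = 1.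
  rewrite /m -L0; have -> : 1 = pr P [set: Omega] :> R by rewrite /pr probability_setT.
  apply: pr_eq_ae => //; first exact: measurable_eq_set.
  by apply: filterS ae0 => w /= ->.
exists (~` [set w | Y w = x0]); split => //; first exact: measurableC.
apply: (eq_trans (prE P (measurableC (meq x0)))).
by rewrite prC// (m1 : pr P [set w | Y w = x0] = 1) subrr.
Qed.

End atoms.

Section stable.
Context {R : realType} d (Omega : measurableType d) (P : probability Omega R).
Variables (alpha : R) (S : R -> Omega -> R).
Hypothesis stableS : stable_process P alpha S.
Implicit Types (x c t : R) (B : set R).

Lemma stable_levy : levy_process P S.
Proof. by case: stableS. Qed.

Lemma stable_law c : 0 < c -> exists b, forall B, measurable B ->
  pr P [set w | B (S c w)] = pr P [set w | B (c `^ alpha^-1 * S 1 w + b)].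
Proof.
move=> c0; have [_ _ /(_ c c0)[b Hb]] := stableS; exists b => B mB.
have := Hb 1%N (fun=> 1) (fun=> B) (fun=> ler01) (fun=> mB).
rewrite /pr; move=> /(congr1 fine).
have E (Y : Omega -> R) : [set w | 'I_1 -> B (Y w)] = [set w | B (Y w)].
  by apply/seteqP; split => w /=; [apply; exact: ord0|move=> Bw _].
by rewrite !E !mulr1.
Qed.

(** The increments over [[0, 1]] and [[1, 2]] are independent copies of [S 1], and by stability
    their sum has the law of an affine image of [S 1]. *)
Lemma stable1_atomless x : pr P [set w | S 1 w = x] = 0.
Proof.
have lS := stable_levy.
have mS t : 0 <= t -> measurable_fun setT (S t) by exact: (levy_measurable lS).
have m1 : measurable_fun setT (S 1) by exact: mS.
have m0 : measurable_fun setT (S 0) by exact: mS.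
have m2 : measurable_fun setT (S (1 + 1)) by apply: mS; lra.
have [b Hb] := stable_law (ltr0Sn R 1).
have m1' (y : R) : measurable [set y] by exact: measurable_set1.
apply: (@self_similar_atomless _ _ _ P (S 1) (fun w => S 1 w - S 0 w)
  (fun w => S (1 + 1) w - S 1 w) (2 `^ alpha^-1) b) => //.
- exact: measurable_funB.
- exact: measurable_funB.
- by move=> y; have := levy_stationary lS (lexx 0) ler01 (m1' y); rewrite add0r.
- by move=> y; have := levy_stationary lS ler01 ler01 (m1' y).
- move=> A B mA mB; have [_ _ _ /(_ 2 (fun n => n%:R)) iS _] := lS.
  have mono (i : nat) : i%:R <= i.+1%:R :> R by rewrite ler_nat.
  have {}iS := iS (lexx 0) mono.
  have mAB (i : 'I_2) : measurable (if (i : nat) == 0%N then A else B) by case: ifP.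
  have := congr1 fine (iS _ mAB); rewrite big_ord_recr big_ord1/= /pr.
  rewrite (_ : (1 : R) + 1 = 2%:R)// => <-; congr (fine (P _)).
  apply/seteqP; split => w /=.
    by move=> [Aw Bw] [[|[|//]] ?].
  by move=> H; split; [have := H ord0|have := H (lift ord0 ord0)].
- move=> y.
  have := levy_stationary lS (lexx 0) (ltac:(lra) : 0 <= 1 + 1 :> R) (m1' y).
  rewrite add0r (_ : (1 : R) + 1 = 2)//.
  move=> H; have {}Hb := Hb _ (m1' y).
  transitivity (pr P [set w | S 2 w = y]); last exact: Hb.
  rewrite -[RHS]H; congr pr; apply/seteqP; split => w /= <-; lra.
- by have [_ nd _] := stableS.
Qed.

Lemma stable_atomless t x : 0 < t -> pr P [set w | S t w = x] = 0.
Proof.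
move=> t0; have [b Hb] := stable_law t0.
have := Hb _ (measurable_set1 x) => /= ->.
have c0 : 0 < t `^ alpha^-1 by rewrite powR_gt0.
rewrite -(stable1_atomless ((x - b) / t `^ alpha^-1)); congr pr.
apply/seteqP; split => w /=; first by move=> <-; rewrite addrK mulrC mulKf// gt_eqF.
by move=> ->; rewrite mulrC divfK ?gt_eqF// subrK.
Qed.

End stable.

(** * Expectations of independent variables by finite grids *)

Section boxes.
Context {R : realType}.
Implicit Types (delta e c M L : R) (N K : nat).

(** Centred so that the [2 * K] cells cover the interval from [- (K * delta)] to [K * delta]. *)
Definition grid delta K k : R := (k%:R - K%:R) * delta.

Definition cell delta K k : set R := `]grid delta K k, grid delta K k.+1]%classic.

Lemma measurable_cell delta K k : measurable (cell delta K k).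
Proof. exact: measurable_itv. Qed.

Lemma cell_exists delta K x : 0 < delta -> - (K%:R * delta) < x <= K%:R * delta ->
  exists2 k, (k < 2 * K)%N & cell delta K k x.
Proof.
move=> d0 /andP[x1 x2].
have E : exists k, x <= grid delta K k.
  by exists (2 * K)%N; rewrite /grid natrM; lra.
have [k xk kmin] := ex_minnP E; case: k xk kmin => [|k] xk kmin.
  by move: xk; rewrite /grid; lra.
have gk : grid delta K k < x.
  by rewrite ltNge; apply/negP => /kmin; rewrite ltnn.
exists k; last by rewrite /cell/= in_itv/= gk.
have : grid delta K k < grid delta K (2 * K) by apply: (lt_le_trans gk); rewrite /grid natrM; lra.
by rewrite /grid ltr_pM2r// ltrD2r ltr_nat.
Qed.

Lemma grid_inj delta K i k x : 0 < delta -> cell delta K i x -> cell delta K k x -> i = k.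
Proof.
move=> d0; rewrite /cell/= !in_itv/= => /andP[i1 i2] /andP[k1 k2].
have h1 := lt_le_trans i1 k2; have h2 := lt_le_trans k1 i2.
move: h1 h2; rewrite /grid !ltr_pM2r// !ltrD2r !ltr_nat !ltnS => h1 h2.
by apply/eqP; rewrite eqn_leq h1.
Qed.

Section one_space.
Context d (Omega : measurableType d) (P : probability Omega R).
Variables (N : nat) (Y : 'I_N -> Omega -> R) (G : ('I_N -> R) -> R) (M L : R).
Hypotheses (mY : forall i, measurable_fun setT (Y i)) (iY : independent P Y).
Hypotheses (mG : measurable_fun setT (fun w => G (fun i => Y i w))).
Hypotheses (GM : forall x, `|G x| <= M).
Hypothesis GL : forall x y e, (forall i, `|x i - y i| <= e) -> `|G x - G y| <= L * e.

(** A Riemann sum for the expectation of [G]. By independence it involves the laws only through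
    finitely many values of the distribution functions [F], so their pointwise convergence
    suffices. *)
Definition box_sum (F : 'I_N -> R -> R) delta K : R :=
  \sum_(k : {ffun 'I_N -> 'I_(2 * K)}) G (fun i => grid delta K (k i)) *
    \prod_i (F i (grid delta K (k i).+1) - F i (grid delta K (k i))).

Definition box_tail (F : 'I_N -> R -> R) delta K : R :=
  \sum_i (F i (- (K%:R * delta)) + (1 - F i (K%:R * delta))).

Let F i x := pr P [set w | Y i w <= x].

Lemma pr_cell i delta K k : 0 < delta ->
  pr P (Y i @^-1` cell delta K k) = F i (grid delta K k.+1) - F i (grid delta K k).
Proof.
move=> d0.
have mle x : measurable [set w | Y i w <= x] by exact: measurable_le_set.
have gk : grid delta K k <= grid delta K k.+1.
  by rewrite /grid ler_pM2r// lerD2r ler_nat.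
have -> : Y i @^-1` cell delta K k =
    [set w | Y i w <= grid delta K k.+1] `\` [set w | Y i w <= grid delta K k].
  apply/seteqP; split => w /=; rewrite /cell/= in_itv/=.
    by move=> /andP[h ->]; split => //; apply/negP; rewrite -ltNge.
  by move=> [-> /negP]; rewrite -ltNge => ->.
apply: EFin_inj; rewrite EFinB -!prE//; last exact: measurableD.
rewrite measureD//; last by rewrite (le_lt_trans (probability_le1 _ _)) ?ltry.
congr (_ - P _)%E; apply/seteqP; split => w /=; first by case.
by move=> h; split => //; exact: le_trans gk.
Qed.

(** [G] is replaced by its value at the lower corner of the cell: the error is [L * delta] inside
    the grid, and [2 * M] when a coordinate leaves it, an event of probability at most
    [box_tail]. *)
Lemma box_approximation delta K : 0 < delta -> 0 <= L ->
  `|Ex P (fun w => G (fun i => Y i w)) - box_sum F delta K| <=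
  L * delta + 2 * M * box_tail F delta K.
Proof.
move=> d0 L0.
pose box (k : {ffun 'I_N -> 'I_(2 * K)}) := [set w | forall i, cell delta K (k i) (Y i w)].
have mbox k : measurable (box k).
  by apply: (@measurable_rectangle _ _ _ N Y (fun i => cell delta K (k i))) => // i; exact: measurable_cell.
pose corner (k : {ffun 'I_N -> 'I_(2 * K)}) := G (fun i => grid delta K (k i)).
pose g w := \sum_k corner k * \1_(box k) w.
have mI A : measurable A -> measurable_fun setT (\1_A : Omega -> R).
  by move=> mA; exact: measurable_indic.
have bI A (w : Omega) : `|\1_A w : R| <= 1.
  by rewrite indicE; case: (_ \in _); rewrite ?normr1 ?normr0.
have Eg : Ex P g = box_sum F delta K.
  rewrite /g (@Ex_sum _ _ _ P _ (fun k w => corner k * \1_(box k) w) M).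
  - apply: eq_bigr => k _; rewrite (ExZ P (corner k) (mI _ (mbox k)) (bI _)).
    rewrite Ex_indic//; congr (_ * _).
    have := congr1 fine (iY (fun i => measurable_cell delta K (k i))).
    by rewrite /pr /= => ->; apply: eq_bigr => i _; exact: pr_cell.
  - by move=> k; apply: measurable_funM => //; exact: mI.
  - move=> k w; rewrite normrM; apply: (@le_trans _ _ `|corner k|); last exact: GM.
    by rewrite ler_piMr.
have g_in k w : box k w -> g w = corner k.
  move=> bw; rewrite /g (bigD1 k)//= indicE mem_set// mulr1 big1 ?addr0// => k' kk'.
  rewrite indicE memNset ?mulr0// => bw'; move/eqP: kk'; apply.
  by apply/ffunP => i; apply/val_inj; exact: (grid_inj d0 (bw' i) (bw i)).
have g_out w : (forall k, ~ box k w) -> g w = 0.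
  by move=> nb; rewrite /g big1// => k _; rewrite indicE memNset ?mulr0//; exact: nb.
have M0 : 0 <= M := le_trans (normr_ge0 _) (GM (fun=> 0)).
have bg w : `|g w| <= M.
  have [[k bk]|nb] := pselect (exists k, box k w); first by rewrite (g_in k)//; exact: GM.
  by rewrite g_out ?normr0// => k bk; apply: nb; exists k.
have mg : measurable_fun setT g.
  by apply: measurable_sum => k; apply: measurable_funM => //; exact: mI.
pose D i := [set w | Y i w <= - (K%:R * delta)] `|` [set w | K%:R * delta < Y i w].
have mD i : measurable (D i).
  by apply: measurableU; [exact: measurable_le_set|exact: measurable_lt_set].
have prD i : pr P (D i) <= F i (- (K%:R * delta)) + (1 - F i (K%:R * delta)).
  have mle x : measurable [set w | Y i w <= x] by exact: measurable_le_set.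
  have mgt : measurable [set w | K%:R * delta < Y i w] by exact: measurable_lt_set.
  apply: (le_trans (prU _ (mle _) mgt)); rewrite lerD2l -prC//.
  have -> : ~` [set w | Y i w <= K%:R * delta] = [set w | K%:R * delta < Y i w].
    by apply/seteqP; split => w /=; [move/negP; rewrite -ltNge|rewrite ltNge => /negP].
  by [].
pose A := \bigcup_(i in [set i : nat | (i < N)%N])
  (if insub i is Some j then D j else set0).
pose A' (i : nat) := if insub i is Some j then D (j : 'I_N) else set0.
have mA' i : measurable (A' i) by rewrite /A'; case: insubP.
have mA : measurable A by apply: bigcup_measurable => i _; exact: mA'.
have prA : pr P A <= box_tail F delta K.
  apply: (@le_trans _ _ (\sum_(i < N) pr P (A' i))).
    by apply: (@pr_bigU _ _ _ P N A') => // w [i /= iN Aw]; exists i.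
  by apply: ler_sum => i _; rewrite /A' (valK i).
rewrite -Eg.
apply: (@le_trans _ _ (L * delta + 2 * M * pr P A)); last first.
  by rewrite lerD2l ler_wpM2l// mulr_ge0.
apply: Ex_close => //; first by rewrite mulr_ge0// ltW.
apply: aeW => w nA.
have inside i : - (K%:R * delta) < Y i w <= K%:R * delta.
  rewrite ltNge; apply/andP; split.
    apply/negP => h; apply: nA; exists (val i) => //=.
    by rewrite (valK i); left.
  rewrite leNgt; apply/negP => h; apply: nA; exists (val i) => //=.
  by rewrite (valK i); right.
have ck i : exists k : 'I_(2 * K), cell delta K k (Y i w).
  by have [k k2 ck] := cell_exists d0 (inside i); exists (Ordinal k2).
have [kf Hkf] := choice ck.
pose k := [ffun i => kf i].
have bk : box k w by move=> i; rewrite ffunE; exact: Hkf.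
rewrite (g_in k)//; apply: GL => i.
have := bk i; rewrite /cell/= in_itv/= => /andP[h1 h2].
move: h1 h2; rewrite {2}/grid -natr1 => h1 h2.
rewrite ger0_norm; last by rewrite subr_ge0 ltW.
by move: h1 h2; rewrite /grid; lra.
Qed.

End one_space.
End boxes.

Section cvg_independent.
Context {R : realType} d d' (Omega : measurableType d) (Omega' : measurableType d').
Variables (P : probability Omega R) (P' : probability Omega' R).
Variables (N : nat) (Y : R -> 'I_N -> Omega -> R) (Z : 'I_N -> Omega' -> R).
Hypotheses (mY : forall T i, 0 < T -> measurable_fun setT (Y T i))
  (iY : forall T, 0 < T -> independent P (Y T)).
Hypotheses (mZ : forall i, measurable_fun setT (Z i)) (iZ : independent P' Z).
Hypothesis cvgF : forall i c,
  pr P [set w | Y T i w <= c] @[T --> +oo] --> pr P' [set w | Z i w <= c].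

Lemma cvg_sumr I (s : seq I) (f : I -> R -> R) (l : I -> R) :
  (forall i, f i T @[T --> +oo] --> l i) ->
  \sum_(i <- s) f i T @[T --> +oo] --> \sum_(i <- s) l i.
Proof.
move=> fl; elim: s => [|i s ih].
  by under eq_fun do rewrite big_nil; rewrite big_nil; exact: cvg_cst.
by under eq_fun do rewrite big_cons; rewrite big_cons; exact: cvgD.
Qed.

Lemma cvg_prodr I (s : seq I) (f : I -> R -> R) (l : I -> R) :
  (forall i, f i T @[T --> +oo] --> l i) ->
  \prod_(i <- s) f i T @[T --> +oo] --> \prod_(i <- s) l i.
Proof.
move=> fl; elim: s => [|i s ih].
  by under eq_fun do rewrite big_nil; rewrite big_nil; exact: cvg_cst.
by under eq_fun do rewrite big_cons; rewrite big_cons; exact: cvgM.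
Qed.

Lemma cvg_box_tail delta : 0 < delta ->
  box_tail (fun i x => pr P' [set w | Z i w <= x]) delta K @[K --> \oo] --> 0.
Proof.
move=> d0; rewrite /box_tail.
have mle i x : measurable [set w | Z i w <= x] by exact: measurable_le_set.
have bound x : exists K : nat, x < K%:R * delta.
  by exists (Num.truncn (x / delta)).+1; rewrite -ltr_pdivrMr// truncnS_gt.
have mono n m : (n <= m)%N -> n%:R * delta <= m%:R * delta.
  by move=> nm; rewrite ler_pM2r// ler_nat.
have one i : pr P' [set w | Z i w <= - (K%:R * delta)] +
    (1 - pr P' [set w | Z i w <= K%:R * delta]) @[K --> \oo] --> 0.
  have -> : 0 = 0 + (1 - 1) :> R by rewrite subrr addr0.
  apply: cvgD; last apply: cvgB; last 2 first.
  - exact: cvg_cst.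
  - have prT : pr P' setT = 1 by rewrite /pr probability_setT.
    rewrite -[X in _ --> X]prT.
    apply: cvg_pr_nondecr => // [w|n m w nm h].
      by split => // _; have [K /ltW ZK] := bound (Z i w); exists K.
    exact: (le_trans h (mono _ _ nm)).
  - apply: cvg_pr0 => // [|n m w nm h].
      apply: aeW => w H; have [K ZK] := bound (- Z i w).
      have := H K => /=; lra.
    by apply: (le_trans h); rewrite lerN2; exact: mono.
elim: (index_enum 'I_N) => [|i s ih].
  by under eq_fun do rewrite big_nil; exact: cvg_cst.
under eq_fun do rewrite big_cons.
by have := cvgD (one i) ih; rewrite addr0 => h; exact: h.
Qed.

Lemma cvg_independent (G : ('I_N -> R) -> R) (M L : R) : 0 <= L ->
  (forall T, 0 < T -> measurable_fun setT (fun w => G (fun i => Y T i w))) ->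
  measurable_fun setT (fun w => G (fun i => Z i w)) ->
  (forall x, `|G x| <= M) ->
  (forall x y e, (forall i, `|x i - y i| <= e) -> `|G x - G y| <= L * e) ->
  Ex P (fun w => G (fun i => Y T i w)) @[T --> +oo] -->
  Ex P' (fun w => G (fun i => Z i w)).
Proof.
move=> L0 mGY mGZ GM GL.
have M0 : 0 <= M := le_trans (normr_ge0 _) (GM (fun=> 0)).
apply/cvgrPdist_le => e e0.
pose delta := e / (8 * (L + 1)).
have d0 : 0 < delta by rewrite divr_gt0//; lra.
have dL : L * delta <= e / 8.
  rewrite /delta mulrA ler_pdivrMr; last by lra.
  by rewrite mulrA divfK; [nra|lra].
have t0 : 0 < e / (16 * (M + 1)) by rewrite divr_gt0//; lra.
have tM : 2 * M * (e / (16 * (M + 1))) <= e / 8.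
  rewrite mulrA ler_pdivrMr; last by lra.
  by nra.
have /cvgrPdist_lt/(_ _ t0)[K _ /(_ K (leqnn _))] := cvg_box_tail d0.
rewrite /= sub0r normrN.
set FZ := (fun (i : 'I_N) (x : R) => pr P' [set w | Z i w <= x]).
pose FY T := (fun (i : 'I_N) (x : R) => pr P [set w | Y T i w <= x]).
move=> /ltr_normlP[_ tailZ].
have cS : box_sum G (FY T) delta K @[T --> +oo] --> box_sum G FZ delta K.
  apply: cvg_sumr => k; apply: cvgM; first exact: cvg_cst.
  by apply: cvg_prodr => i; apply: cvgB; exact: cvgF.
have cT : box_tail (FY T) delta K @[T --> +oo] --> box_tail FZ delta K.
  apply: cvg_sumr => i; apply: cvgD; first exact: cvgF.
  by apply: cvgB; [exact: cvg_cst|exact: cvgF].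
have e4 : 0 < e / 4 by lra.
have /cvgrPdist_le/(_ _ e4) n1 := cS.
have /cvgr_le/(_ _ tailZ) n2 := cT.
near=> T.
have T0 : 0 < T by near: T; exact: nbhs_pinfty_gt.
have h1 := @box_approximation _ _ _ P N (Y T) G M L (fun i => mY i T0) (iY T0) (mGY T T0) GM GL delta K d0 L0.
have h2 := @box_approximation _ _ _ P' N Z G M L mZ iZ mGZ GM GL delta K d0 L0.
have h3 : `|box_sum G FZ delta K - box_sum G (FY T) delta K| <= e / 4 by near: T.
have h4 : box_tail (FY T) delta K <= e / (16 * (M + 1)) by near: T.
have h5 : 2 * M * box_tail (FY T) delta K <= e / 8.
  by apply: le_trans tM; rewrite ler_wpM2l// mulr_ge0.
have h6 : 2 * M * box_tail FZ delta K <= e / 8.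
  by apply: le_trans tM; rewrite ler_wpM2l ?mulr_ge0// ltW.
move: h1 h2 h3; rewrite -/FZ -/(FY T) !ler_norml => /andP[a1 a2] /andP[a3 a4] /andP[a5 a6].
by apply/andP; split; lra.
Unshelve. all: by end_near. Qed.

End cvg_independent.

Section levy_transform.
Context {R : realType} d (Omega : measurableType d) (P : probability Omega R).
Variable X : R -> Omega -> R.
Hypothesis levyX : levy_process P X.

Lemma independent_comp n (Y : 'I_n -> Omega -> R) (g : R -> R) :
  measurable_fun setT g -> independent P Y -> independent P (fun i w => g (Y i w)).
Proof.
move=> mg iY B mB; apply: (iY (fun i => g @^-1` B i)) => i.
by rewrite -[X in measurable X]setTI; exact: mg.
Qed.

Lemma levy_rescale T a : 0 < T -> 0 < a -> levy_process P (fun t w => X (T * t) w / a).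
Proof.
move=> T0 a0; case: levyX => mX X0 cX iX sX.
have mdiv : measurable_fun setT (fun x : R => x / a) by exact: measurable_funM.
have Tt t : 0 <= t -> 0 <= T * t by move=> t0; rewrite mulr_ge0// ltW.
split.
- by move=> t t0; apply: measurable_funM => //; apply: mX; exact: Tt.
- by apply: filterS X0 => w; rewrite mulr0 => ->; rewrite mul0r.
- by apply: filterS cX => w cw; exact: (@cadlag_rescale _ T a (X^~ w)).
- move=> n t t0 tt.
  have := iX n (fun i => T * t i) (Tt _ t0) (fun i => ler_wpM2l (ltW T0) (tt i)).
  move=> /(independent_comp mdiv); congr independent.
  by apply/funext => i; apply/funext => w; rewrite mulrBl.
- move=> s t B s0 t0 mB.
  have mB' : measurable ((fun x : R => x / a) @^-1` B).
    by rewrite -[X in measurable X]setTI; exact: mdiv.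
  have := sX (T * s) (T * t) _ (Tt _ s0) (Tt _ t0) mB'.
  rewrite -mulrDr /= => H; rewrite -H; congr (P _).
  by apply/seteqP; split => w /=; rewrite mulrBl.
Qed.

Lemma levy_opp : levy_process P (fun t w => - X t w).
Proof.
case: levyX => mX X0 cX iX sX.
have mopp : measurable_fun setT (fun x : R => - x) by exact: measurable_funN.
split.
- by move=> t t0; apply: measurable_funN; exact: mX.
- by apply: filterS X0 => w ->; rewrite oppr0.
- by apply: filterS cX => w /cadlag_opp.
- move=> n t t0 tt; have := iX n t t0 tt.
  move=> /(independent_comp mopp); congr independent.
  by apply/funext => i; apply/funext => w; rewrite opprB addrC opprK.
- move=> s t B s0 t0 mB.
  have mB' : measurable ((fun x : R => - x) @^-1` B).
    by rewrite -[X in measurable X]setTI; exact: mopp.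
  have := sX s t _ s0 t0 mB'; rewrite /= => H; rewrite -H; congr (P _).
  by apply/seteqP; split => w /=; rewrite opprB opprK addrC.
Qed.

Definition increments r (i : 'I_(2 ^ r)) (w : Omega) : R :=
  X (dy r i.+1) w - X (dy r i) w.

Lemma increments_measurable r i : measurable_fun setT (@increments r i).
Proof. by apply: measurable_funB; exact: (levy_measurable_dy levyX). Qed.

Lemma increments_independent r : independent P (@increments r).
Proof.
by have := levy_increments levyX r => /(_ (2 ^ r)%N id (fun i => leqnSn i)).
Qed.

Lemma increments_law r i (B : set R) : measurable B ->
  pr P [set w | B (@increments r i w)] = pr P [set w | B (X (dy r 1) w)].
Proof.
move=> mB; have := levy_stationary levyX (dy_ge0 r i) (dy_ge0 r 1) mB.
suff -> : dy r i + dy r 1 = dy r i.+1 :> R by [].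
by have := @dyB R r i _ (leqnSn i); rewrite subSnn => <-; rewrite addrC subrK.
Qed.

(* If [Y] and [Y'] are independent with the same law, then
   [P(|Y - x| <= 2 e)^2 = P(|Y - x| <= 2 e, |Y' - x| <= 2 e)]. *)
Lemma increments_concentration r (i j : 'I_(2 ^ r)) e q x : i != j -> 0 <= q ->
  pr P [set w | `|increments i w - increments j w| <= 4 * e] <= q ^+ 2 ->
  pr P [set w | `|X (dy r 1) w - x| <= 2 * e] <= q.
Proof.
move=> ij q0 pq.
pose I := [set y : R | `|y - x| <= 2 * e].
have mI : measurable I.
  by apply: measurable_le_set => //; apply: measurableT_comp => //; exact: measurable_funB.
rewrite -(@ler_pXn2r _ 2) ?nnegrE ?pr_ge0//; apply: le_trans pq.
pose B k := if (k == i) || (k == j) then I else setT.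
have mB k : measurable (B k) by rewrite /B; case: ifP.
have E := congr1 fine (@increments_independent r B mB).
have {}E : pr P [set w | forall k, B k (@increments r k w)] =
    pr P [set w | I (X (dy r 1) w)] ^+ 2.
  rewrite /pr E /= (bigD1 i)//= (bigD1 j) 1?eq_sym//= big1.
    rewrite mulr1 /B !eqxx orbT/= expr2.
    by congr (_ * _); exact: increments_law.
  move=> k /andP[ki kj]; rewrite /B (negbTE ki) (negbTE kj)/=.
  by rewrite preimage_setT probability_setT.
rewrite -E; apply: pr_le.
- apply: measurable_rectangle => // k; exact: increments_measurable.
- apply: measurable_le_set => //; apply: measurableT_comp => //.
  by apply: measurable_funB; exact: increments_measurable.
- move=> w /= H; have := H i; have := H j; rewrite /B !eqxx orbT/= /I/=.
  rewrite !ler_norml => /andP[h1 h2] /andP[h3 h4].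
  by apply/andP; split; lra.
Qed.

End levy_transform.

(** * Increments in the domain of attraction *)

Section domain_of_attraction.
Context {R : realType} d d' (Omega : measurableType d) (Omega' : measurableType d').
Variables (P : probability Omega R) (P' : probability Omega' R).
Variables (alpha : R) (X : R -> Omega -> R) (S : R -> Omega' -> R) (a l : R -> R).
Hypotheses (alpha01 : 0 < alpha < 1) (levyX : levy_process P X)
  (stableS : stable_process P' alpha S) (svl : slowly_varying l)
  (aE : forall T, 0 < T -> 0 < a T /\ a T = T `^ alpha^-1 * l T)
  (lawX : cvg_in_law P P' (fun T w => X T w / a T) (S 1)).
Implicit Types (T h c e x : R).

Let levyS : levy_process P' S := stable_levy stableS.

Definition scaled T t w := X (T * t) w / a T.

Lemma levy_scaled T : 0 < T -> levy_process P (scaled T).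
Proof. by move=> T0; apply: levy_rescale => //; have [] := aE T0. Qed.

Let mXa T : 0 < T -> measurable_fun setT (fun w => X T w / a T).
Proof. by move=> T0; apply: measurable_funM => //; apply: (levy_measurable levyX); exact: ltW. Qed.

Let mS1 : measurable_fun setT (S 1).
Proof. exact: (levy_measurable levyS). Qed.

Lemma cvg_cdf_domain c :
  pr P [set w | X T w / a T <= c] @[T --> +oo] --> pr P' [set w | S 1 w <= c].
Proof.
apply: cvg_cdf => //.
- by move=> f; exact: (cvg_in_law_Ex mXa mS1 lawX).
- by move=> x; exact: (stable1_atomless stableS).
Qed.

(** The variable is [X (h * T) / a (h * T)] times [a (h * T) / a T], and the factor tends to
    [h ^ (1 / alpha)]. The threshold thus moves with T; it is squeezed between fixed ones near [c'],
    where the limit law has no atom. *)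
Lemma cvg_cdf_scaled h c : 0 < h ->
  pr P [set w | scaled T h w <= c] @[T --> +oo] -->
  pr P' [set w | h `^ alpha^-1 * S 1 w <= c].
Proof.
move=> h0; set s := h `^ alpha^-1.
have s0 : 0 < s by rewrite powR_gt0.
have -> : [set w | s * S 1 w <= c] = [set w | S 1 w <= c / s].
  by apply/seteqP; split => w /=; rewrite ler_pdivlMr// mulrC.
set c' := c / s.
have hT : h * T @[T --> +oo] --> +oo by apply: gt0_cvgMry.
have cvgh x : pr P [set w | X (h * T) w / a (h * T) <= x] @[T --> +oo] -->
    pr P' [set w | S 1 w <= x].
  apply: (@cvg_comp _ _ _ (fun T => h * T)
    (fun T => pr P [set w | X T w / a T <= x]) _ _ _ hT).
  exact: cvg_cdf_domain.
have lim : c * (a (h * T) / a T)^-1 @[T --> +oo] --> c'.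
  apply: cvgM; first exact: cvg_cst.
  by apply: cvgV (regular_variation svl aE h0); rewrite gt_eqF.
apply/cvgrPdist_le => e e0.
have e2 : 0 < e / 2 by lra.
have at0 x := stable1_atomless stableS x.
have [k1 k10 Hk1] := cdf_right P' mS1 c' e2.
have [k2 k20 Hk2] := cdf_left mS1 at0 c' e2.
have /cvgrPdist_le/(_ _ k10) n1 := lim.
have /cvgrPdist_le/(_ _ k20) n2 := lim.
have /cvgrPdist_le/(_ _ e2) n3 := cvgh (c' + k1).
have /cvgrPdist_le/(_ _ e2) n4 := cvgh (c' - k2).
near=> T.
have T0 : 0 < T by near: T; exact: nbhs_pinfty_gt.
have hT0 : 0 < h * T by rewrite mulr_gt0.
have [aT _] := aE T0; have [ahT _] := aE hT0.
have h1 : `|c' - c * (a (h * T) / a T)^-1| <= k1 by near: T.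
have h2 : `|c' - c * (a (h * T) / a T)^-1| <= k2 by near: T.
have h3 : `|pr P' [set w | S 1 w <= c' + k1] -
  pr P [set w | X (h * T) w / a (h * T) <= c' + k1]| <= e / 2 by near: T.
have h4 : `|pr P' [set w | S 1 w <= c' - k2] -
  pr P [set w | X (h * T) w / a (h * T) <= c' - k2]| <= e / 2 by near: T.
have mle x : measurable [set w | X (h * T) w / a (h * T) <= x].
  by apply: measurable_le_set => //; exact: mXa.
have E : [set w | scaled T h w <= c] =
    [set w | X (h * T) w / a (h * T) <= c * (a (h * T) / a T)^-1].
  apply/seteqP; split => w /=; rewrite /scaled (mulrC T h).
    rewrite ler_pdivrMr// => H; rewrite ler_pdivrMr// invf_div mulrA divfK ?gt_eqF//.
  rewrite ler_pdivrMr// invf_div mulrA divfK ?gt_eqF// => H.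
  by rewrite ler_pdivrMr.
rewrite E; move: h1 h2 h3 h4; rewrite !ler_norml => /andP[a1 a2] /andP[a3 a4] /andP[a5 a6] /andP[a7 a8].
have u1 : pr P [set w | X (h * T) w / a (h * T) <= c * (a (h * T) / a T)^-1] <=
    pr P [set w | X (h * T) w / a (h * T) <= c' + k1].
  by apply: pr_le => // w /= H; apply: (le_trans H); lra.
have u2 : pr P [set w | X (h * T) w / a (h * T) <= c' - k2] <=
    pr P [set w | X (h * T) w / a (h * T) <= c * (a (h * T) / a T)^-1].
  by apply: pr_le => // w /= H; apply: (le_trans H); lra.
by apply/andP; split; lra.
Unshelve. all: by end_near. Qed.

(** Scaled increments converge to a multiple of [S 1], whereas an increment of [S] may a priori
    carry the drift [b] that stability in the wide sense allows; hence the shift. *)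
Lemma cvg_increments_shifted r b (G : ('I_(2 ^ r) -> R) -> R) M L :
  (forall B : set R, measurable B -> pr P' [set w | B (S (dy r 1) w)] =
    pr P' [set w | B (dy r 1 `^ alpha^-1 * S 1 w + b)]) -> 0 <= L ->
  (forall T, 0 < T -> measurable_fun setT (fun w => G (fun i => increments (scaled T) i w))) ->
  measurable_fun setT (fun w => G (fun i => increments S i w - b)) ->
  (forall u, `|G u| <= M) ->
  (forall u v e, (forall i, `|u i - v i| <= e) -> `|G u - G v| <= L * e) ->
  Ex P (fun w => G (fun i => increments (scaled T) i w)) @[T --> +oo] -->
  Ex P' (fun w => G (fun i => increments S i w - b)).
Proof.
move=> lawS L0 mGX mGS GM GL.
have dy10 : 0 < dy r 1 :> R by rewrite divr_gt0// exprn_gt0.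
have mshift : measurable_fun setT (fun x : R => x - b) by exact: measurable_funB.
have mle (x : R) : measurable [set y : R | y <= x] by exact: measurable_le_set.
apply: (@cvg_independent _ _ _ _ _ P P' _ (fun T i => increments (scaled T) i)
  (fun i w => increments S i w - b) _ _ _ _ _ G M L) => //.
- by move=> T i T0; exact: (increments_measurable (levy_scaled T0)).
- by move=> T T0; exact: (increments_independent (levy_scaled T0)).
- by move=> i; apply: measurable_funB => //; exact: (increments_measurable levyS).
- by apply: (independent_comp mshift); exact: (increments_independent levyS).
move=> i c.
have mB : measurable [set y : R | y - b <= c] by exact: measurable_le_set.
have -> : pr P' [set w | increments S i w - b <= c] =
    pr P' [set w | dy r 1 `^ alpha^-1 * S 1 w <= c].
  rewrite (increments_law levyS i mB) (lawS _ mB); congr pr.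
  by apply/seteqP; split => w /=; rewrite addrK.
have := @cvg_cdf_scaled (dy r 1) c dy10; apply: cvg_trans; apply: near_eq_cvg; near=> T.
have T0 : 0 < T by near: T; exact: nbhs_pinfty_gt.
by rewrite (increments_law (levy_scaled T0) i (mle c)).
Unshelve. all: by end_near. Qed.

(* X T / a T is also a sum of 2 ^ r increments, so that S 1 and S 1 - 2 ^ r * b
   have the same law. *)
Lemma stable_drift0 r (B : set R) : measurable B ->
  pr P' [set w | B (S (dy r 1) w)] = pr P' [set w | B (dy r 1 `^ alpha^-1 * S 1 w)].
Proof.
have dy10 : 0 < dy r 1 :> R by rewrite divr_gt0// exprn_gt0.
have [b lawS] := stable_law stableS dy10.
suff b0 : b = 0.
  move=> mB; rewrite lawS// b0; congr pr.
  by apply/seteqP; split => w /=; rewrite addr0.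
set s := (2 ^ r)%:R * b.
have sumE d1 (Q : measurableType d1) (V : R -> Q -> R) (w : Q) :
    \sum_(i < 2 ^ r) increments V i w = V 1 w - V 0 w.
  rewrite /increments -(big_mkord xpredT (fun i => V (dy r i.+1) w - V (dy r i) w)).
  by rewrite telescope_sumr// dy0 dy1.
(* Both sides are limits of the same expectations, taken once from [X T / a T] and once from its
   [2 ^ r] increments. *)
have rampE c e : 0 < e -> Ex P' (ramp c e \o S 1) = Ex P' (ramp c e \o (fun w => S 1 w - s)).
  move=> e0.
  have cr := @ramp_continuous R c e.
  have mr : measurable_fun setT (ramp c e) by exact: continuous_measurable_fun.
  have br (x : R) : `|ramp c e x| <= 1.
    by have /andP[h1 h2] := ramp_itv c e x; rewrite ger0_norm.
  pose G (u : 'I_(2 ^ r) -> R) := ramp c e (\sum_i u i).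
  have c1 : Ex P (ramp c e \o (fun w => X T w / a T)) @[T --> +oo] --> Ex P' (ramp c e \o S 1).
    by apply: (cvg_in_law_Ex mXa mS1 lawX) => //; exists 1.
  have c2 := @cvg_increments_shifted r b G 1 (e^-1 * (2 ^ r)%:R) lawS.
  have m1 T : 0 < T -> measurable_fun setT (fun w => G (fun i => increments (scaled T) i w)).
    move=> T0; apply: measurableT_comp => //; apply: measurable_sum => i.
    exact: (increments_measurable (levy_scaled T0)).
  have m2 : measurable_fun setT (fun w => G (fun i => increments S i w - b)).
    apply: measurableT_comp => //; apply: measurable_sum => i.
    by apply: measurable_funB => //; exact: (increments_measurable levyS).
  have {}c2 := c2 (ltac:(by rewrite mulr_ge0 ?invr_ge0 ?(ltW e0))) m1 m2 (fun u => br _).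
  have GL : forall u v e0, (forall i, `|u i - v i| <= e0) ->
      `|G u - G v| <= e^-1 * (2 ^ r)%:R * e0.
    move=> x y e1 xy; apply: (le_trans (ramp_lipschitz _ _ _ e0)).
    rewrite -mulrA ler_pM2l ?invr_gt0// -sumrB (le_trans (ler_norm_sum _ _ _))//.
    apply: (@le_trans _ _ (\sum_(i < 2 ^ r) e1)); first exact: ler_sum.
    by rewrite sumr_const card_ord mulr_natl.
  have {GL} c2 := c2 GL.
  have EX : {near +oo, forall T, Ex P (fun w => G (fun i => increments (scaled T) i w)) =
      Ex P (ramp c e \o (fun w => X T w / a T))}.
    near=> T.
    have T0 : 0 < T by near: T; exact: nbhs_pinfty_gt.
    apply/eqP; rewrite -subr_eq0 -normr_le0.
    have := @Ex_close _ _ _ P (fun w => G (fun i => increments (scaled T) i w))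
      (ramp c e \o (fun w => X T w / a T)) 1 0 set0.
    rewrite /pr measure0 mulr0 addr0; apply => //.
    - exact: m1.
    - by apply: measurableT_comp => //; exact: mXa.
    - by move=> w; exact: br.
    - by move=> w; exact: br.
    - have [_ X0 _ _ _] := levyX; apply: filterS X0 => w X0w _.
      by rewrite /G sumE /scaled mulr1 mulr0 X0w mul0r subr0 subrr normr0.
  have ES : Ex P' (fun w => G (fun i => increments S i w - b)) =
      Ex P' (ramp c e \o (fun w => S 1 w - s)).
    apply/eqP; rewrite -subr_eq0 -normr_le0.
    have := @Ex_close _ _ _ P' (fun w => G (fun i => increments S i w - b))
      (ramp c e \o (fun w => S 1 w - s)) 1 0 set0.
    rewrite /pr measure0 mulr0 addr0; apply => //.
    - by apply: measurableT_comp => //; exact: measurable_funB.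
    - by move=> w; exact: br.
    - by move=> w; exact: br.
    - have [_ S0 _ _ _] := levyS; apply: filterS S0 => w S0w _.
      rewrite /G sumrB sumE S0w subr0 sumr_const card_ord -mulr_natl.
      by rewrite subrr normr0.
  rewrite ES in c2.
  apply: cvg_unique c1 _ => //.
  apply: cvg_trans c2; exact: near_eq_cvg.
have mle (x : R) : measurable [set w | S 1 w <= x] by exact: measurable_le_set.
pose F (x : R) := pr P' [set w | S 1 w <= x].
have Fs x : pr P' [set w | S 1 w - s <= x] = F (x + s).
  by rewrite /F; congr pr; apply/seteqP; split => w /=; rewrite lerBlDr.
have msh : measurable_fun setT (fun w => S 1 w - s) by exact: measurable_funB.
have Fle c e : 0 < e -> F c <= F (c + e + s) /\ F (c + s) <= F (c + e).
  move=> e0.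
  have /andP[h1 h2] := ramp_indic P' c mS1 e0.
  have /andP[h3 h4] := ramp_indic P' c msh e0.
  rewrite !Fs in h3 h4; rewrite (rampE _ _ e0) in h1 h2.
  by split; [apply: le_trans h4|apply: le_trans h2].
have Fmono x y : x <= y -> F x <= F y.
  by move=> xy; apply: pr_le => // w /=; move=> h; exact: le_trans xy.
(* A distribution function with a nonzero period would be constant along multiples of it, against
   its limits 0 and 1. *)
have FE c : F (c + s) = F c.
  apply/eqP; rewrite eq_le; apply/andP; split; apply/ler_addgt0Pr => e e0.
    have [h h0 Fh] := cdf_right P' mS1 c e0; apply: le_trans Fh.
    by have [] := Fle c h h0.
  have [h h0 Fh] := cdf_right P' mS1 (c + s) e0; apply: le_trans Fh.
  by have [+ _] := Fle c h h0; rewrite -/F addrAC.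
have Fn (n : nat) : F (n%:R * s) = F 0 /\ F (- (n%:R * s)) = F 0.
  elim: n => [|n [ih1 ih2]]; first by rewrite mul0r oppr0.
  rewrite -natr1 mulrDl mul1r FE ih1; split => //.
  by rewrite -(FE (- _)) opprD subrK.
have s0 : s = 0.
  apply/eqP; rewrite -normr_le0 leNgt; apply/negP => sp.
  have Fabs (n : nat) : F (n%:R * `|s|) = F 0 /\ F (- (n%:R * `|s|)) = F 0.
    have [h1 h2] := Fn n; have [sge|slt] := leP 0 s; first by rewrite ger0_norm.
    by rewrite ltr0_norm// mulrN opprK.
  have tail := @cvg_box_tail R d' Omega' P' 1 (fun _ => S 1) (fun _ => mS1) `|s| sp.
  move/cvgrPdist_lt : tail => /(_ (1 / 2) ltac:(lra))[K _ /(_ K (leqnn _))].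
  rewrite /= /box_tail big_ord1; have [h1 h2] := Fabs K.
  by rewrite -!/(F _) h1 h2 addrCA subrr addr0 sub0r normrN normr1; lra.
move: s0 => /eqP; rewrite /s mulf_eq0 pnatr_eq0 => /orP[|/eqP//].
by rewrite expn_eq0.
Unshelve. all: by end_near. Qed.

Lemma cvg_increments r (G : ('I_(2 ^ r) -> R) -> R) M L : 0 <= L ->
  (forall T, 0 < T -> measurable_fun setT (fun w => G (fun i => increments (scaled T) i w))) ->
  measurable_fun setT (fun w => G (fun i => increments S i w)) ->
  (forall u, `|G u| <= M) ->
  (forall u v e, (forall i, `|u i - v i| <= e) -> `|G u - G v| <= L * e) ->
  Ex P (fun w => G (fun i => increments (scaled T) i w)) @[T --> +oo] -->
  Ex P' (fun w => G (fun i => increments S i w)).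
Proof.
move=> L0 mX mS GM GL.
have E : (fun w => G (fun i => increments S i w)) = (fun w => G (fun i => increments S i w - 0)).
  by apply/funext => w; congr G; apply/funext => i; rewrite subr0.
rewrite E in mS *; apply: (@cvg_increments_shifted r 0 G M L) => //.
move=> B mB; rewrite stable_drift0//; congr pr.
by apply/seteqP; split => w /=; rewrite addr0.
Qed.

End domain_of_attraction.

(** * Uniform tail and concentration bounds *)

Section levy_tails.
Context {R : realType} d (Omega : measurableType d) (P : probability Omega R).
Variable X : R -> Omega -> R.
Hypothesis levyX : levy_process P X.
Implicit Types (A c e s q : R).

(** A countable union, hence measurable; by right-continuity it almost surely contains [c < |X s|]
    for every [s < A], which makes the bounds uniform in [s]. *)
Definition dyadic_exceedance A c : set Omega :=
  \bigcup_r \bigcup_(k in [set k | dy r k <= A]) [set w | c < `|X (dy r k) w| ].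

Lemma measurable_dyadic_exceedance A c : measurable (dyadic_exceedance A c).
Proof.
apply: bigcup_measurable => r _; apply: bigcup_measurable => k _.
by apply: measurable_lt_set => //; apply: measurableT_comp => //; exact: (levy_measurable_dy levyX).
Qed.

Lemma pr_exceedance A c s : 0 <= s < A ->
  pr P [set w | c < `|X s w| ] <= pr P (dyadic_exceedance A c).
Proof.
move=> /andP[s0 sA]; have [_ _ cX _ _] := levyX.
apply: pr_le_ae.
- apply: measurable_lt_set => //; apply: measurableT_comp => //.
  exact: (levy_measurable levyX).
- exact: measurable_dyadic_exceedance.
- apply: filterS cX => w cw /= cX.
  have e0 : 0 < (`|X s w| - c) / 2 by lra.
  have [r r0 Hr] := cadlag_right cw s0 e0.
  have d0 : 0 < Num.min (r / 2) (A - s).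
    by rewrite lt_min; apply/andP; split; lra.
  have [j _ /(_ j (leqnn _))[l /andP[sl ls]]] := exists_dy 0 s0 d0.
  have l1 : dy (0 + j) l <= A.
    by apply: (le_trans ls); rewrite -lerBrDl ge_min lexx orbT.
  have l2 : dy (0 + j) l < s + r.
    apply: (le_lt_trans ls); rewrite ltrD2l gt_min; apply/orP; left; lra.
  exists (0 + j)%N => //; exists l => //=.
  have := Hr (dy (0 + j) l); rewrite (ltW sl) l2 => /(_ isT) h.
  have := ler_distD (X (dy (0 + j) l) w) (X s w) 0; rewrite !subr0 (distrC (X s w)).
  lra.
Qed.

Lemma levy_tight A e : 0 < e ->
  exists K, forall s, 0 <= s <= A -> pr P [set w | K < `|X s w| ] <= e.
Proof.
move=> e0; have [_ _ cX _ _] := levyX.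
(* The range is enlarged because [pr_exceedance] needs [s] strictly below its end. *)
have : pr P (dyadic_exceedance (A + 1) n%:R) @[n --> \oo] --> 0.
  apply: cvg_pr0 => [n| |n m w nm [r _ [k rk /= H]]].
  - exact: measurable_dyadic_exceedance.
  - apply: filterS cX => w cw H; have [M HM] := cadlag_bounded (A + 1) cw.
    have [r _ [k /= rk]] := H (Num.truncn M).+1.
    have := HM (dy r k); rewrite dy_ge0 rk => /(_ isT).
    by have := truncnS_gt M; lra.
  - exists r => //; exists k => //=; apply: le_lt_trans H; by rewrite ler_nat.
move=> /cvgrPdist_le/(_ _ e0)[n _ /(_ n (leqnn _))] /=; rewrite sub0r normrN => Hn.
exists n%:R => s /andP[s0 sA]; apply: le_trans (le_trans (ler_norm _) Hn).
by apply: pr_exceedance; rewrite s0/=; lra.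
Qed.

Lemma levy_small c e : 0 < c -> 0 < e ->
  exists2 h, 0 < h & forall s, 0 <= s <= h -> pr P [set w | c < `|X s w| ] <= e.
Proof.
move=> c0 e0; have [_ X0 cX _ _] := levyX.
have : pr P (dyadic_exceedance (2 / n.+1%:R) c) @[n --> \oo] --> 0.
  apply: cvg_pr0 => [n| |n m w nm [r _ [k /= rk H]]].
  - exact: measurable_dyadic_exceedance.
  - apply: filterS2 X0 cX => w Xw cw H; have [r r0 Hr] := cadlag_right cw (lexx 0) c0.
    have [q _ [k /= qk]] := H (Num.truncn (2 / r)).
    have : dy q k < 0 + r :> R.
      rewrite add0r; apply: (le_lt_trans qk).
      by rewrite ltr_pdivrMr ?ltr0n// mulrC -ltr_pdivrMr// truncnS_gt.
    move=> qr; have := Hr (dy q k); rewrite dy_ge0 qr => /(_ isT).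
    rewrite Xw subr0; lra.
  - exists r => //; exists k => //=; apply: (le_trans rk).
    by rewrite ler_pM2l// lef_pV2 ?posrE ?ltr0n// ler_nat.
move=> /cvgrPdist_le/(_ _ e0)[n _ /(_ n (leqnn _))] /=; rewrite sub0r normrN => Hn.
exists (n.+1%:R^-1); first by rewrite invr_gt0.
move=> s /andP[s0 sn]; apply: le_trans (le_trans (ler_norm _) Hn).
apply: pr_exceedance; rewrite s0/=; apply: (le_lt_trans sn).
by rewrite ltr_pMl ?invr_gt0//; lra.
Qed.

End levy_tails.

Section domain_tails.
Context {R : realType} d d' (Omega : measurableType d) (Omega' : measurableType d').
Variables (P : probability Omega R) (P' : probability Omega' R).
Variables (alpha : R) (X : R -> Omega -> R) (S : R -> Omega' -> R) (a l : R -> R).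
Hypotheses (alpha01 : 0 < alpha < 1) (levyX : levy_process P X)
  (stableS : stable_process P' alpha S) (svl : slowly_varying l)
  (aE : forall T, 0 < T -> 0 < a T /\ a T = T `^ alpha^-1 * l T)
  (lawX : cvg_in_law P P' (fun T w => X T w / a T) (S 1)).
Implicit Types (T h c e s x y : R).

Let levyS : levy_process P' S := stable_levy stableS.
Let lX T (T0 : 0 < T) : levy_process P (scaled X a T) := @levy_scaled _ _ _ _ _ _ _ _ levyX aE T T0.

Let mtail V (lV : levy_process P V) c s : 0 <= s -> measurable [set w | c < `|V s w| ].
Proof.
move=> s0; apply: measurable_lt_set => //; apply: measurableT_comp => //.
exact: (levy_measurable lV).
Qed.

Lemma domain_tight e : 0 < e -> exists A K, [/\ 0 < A, 0 < K &
  forall y, A <= y -> pr P [set w | K * a y < `|X y w| ] <= e].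
Proof.
move=> e0; have e4 : 0 < e / 4 by lra.
have [K0 HK0] := levy_tight levyS 1 e4.
have mS1 : measurable_fun setT (S 1) by exact: (levy_measurable levyS).
have mS x : measurable [set w | S 1 w <= x] by exact: measurable_le_set.
have := HK0 1; rewrite ler01 lexx => /(_ isT) {}HK0.
set K := `|K0| + 1; have KK : K0 <= `|K0| by exact: ler_norm.
have K0p : 0 <= `|K0| by [].
have mSa : measurable [set w | K0 < `|S 1 w| ].
  by apply: measurable_lt_set => //; exact: measurableT_comp.
have S1 : 1 - pr P' [set w | S 1 w <= K] <= e / 4.
  rewrite -prC//; apply: le_trans HK0; apply: pr_le => //; first exact: measurableC.
  move=> w /= /negP; rewrite -ltNge => h.
  by have := ler_norm (S 1 w); rewrite /K in h; lra.
have S2 : pr P' [set w | S 1 w <= - K] <= e / 4.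
  apply: le_trans HK0; apply: pr_le => // w /= h.
  by have := ler_norm (- S 1 w); rewrite normrN; rewrite /K in h; lra.
have cK x := @cvg_cdf_domain R _ _ _ _ P P' alpha X S a levyX stableS lawX x.
have /cvgrPdist_le/(_ _ e4) n1 := cK K.
have /cvgrPdist_le/(_ _ e4) n2 := cK (- K).
have : \forall y \near +oo, pr P [set w | K * a y < `|X y w| ] <= e.
  near=> y.
  have y0 : 0 < y by near: y; exact: nbhs_pinfty_gt.
  have [ay _] := aE y0.
  have h1 : `|pr P' [set w | S 1 w <= K] - pr P [set w | X y w / a y <= K]| <= e / 4 by near: y.
  have h2 : `|pr P' [set w | S 1 w <= - K] - pr P [set w | X y w / a y <= - K]| <= e / 4 by near: y.
  have mX x : measurable [set w | X y w / a y <= x].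
    apply: measurable_le_set => //; apply: measurable_funM => //.
    exact: (levy_measurable levyX (ltW y0)).
  apply: (@le_trans _ _ (pr P ([set w | X y w / a y <= - K] `|` ~` [set w | X y w / a y <= K]))).
    apply: pr_le.
    - exact: (mtail levyX _ (ltW y0)).
    - by apply: measurableU => //; exact: measurableC.
    - move=> w /=; rewrite ler_pdivrMr// ler_pdivrMr// ltr_normr => /orP[h|h].
        by right; apply/negP; rewrite -ltNge.
      by left; rewrite mulNr; lra.
  apply: (le_trans (prU _ _ _)) => //; first exact: measurableC.
  rewrite prC//; move: h1 h2; rewrite !ler_norml => /andP[h1 h2] /andP[h3 h4]; lra.
move=> [A [_ HA]]; exists (`|A| + 1), K; split; rewrite ?/K ?ltr_wpDl//.
by move=> y Ay; apply: HA; have := ler_norm A; lra.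
Unshelve. all: by end_near. Qed.

(** Times [T * s] beyond [A] are measured on their own scale, with [a (T * s) <= K1 * a T]. Earlier
    times form a bounded range, on which X is tight, and there [1 <= a T] suffices. *)
Lemma scaled_tight e : 0 < e ->
  exists K, \forall T \near +oo, forall s, 0 <= s <= 1 ->
    pr P [set w | K < `|scaled X a T s w| ] <= e.
Proof.
move=> e0; have [A0 [K0 [A00 K00 HK0]]] := domain_tight e0.
have [A1 [K1 [A10 K10 HK1]]] := regular_variation_bound alpha01 svl aE.
set A := Num.max A0 A1.
have A0A : A0 <= A by rewrite le_max lexx.
have A1A : A1 <= A by rewrite le_max lexx orbT.
have [K2 HK2] := levy_tight levyX A e0.
exists (Num.max (K0 * K1) `|K2|).
have n1 := regular_variation_pinfty alpha01 svl aE 1.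
near=> T.
have T0 : 0 < T by near: T; exact: nbhs_pinfty_gt.
have a1 : 1 <= a T by near: T.
have [aT _] := aE T0.
move=> s /andP[s0 s1].
have Ts : T * s <= T by rewrite -subr_ge0 -{1}(mulr1 T) -mulrBr mulr_ge0 ?subr_ge0 ?(ltW T0).
have Ts0 : 0 <= T * s by rewrite mulr_ge0 ?(ltW T0).
have [yA|/ltW yA] := leP A (T * s).
  apply: (le_trans _ (HK0 _ (le_trans A0A yA))); apply: pr_le.
  - exact: mtail (lX T0) _ _ s0.
  - exact: mtail levyX _ _ Ts0.
  - move=> w /=; rewrite /scaled normrM (@gtr0_norm _ (a T)^-1) ?invr_gt0// ltr_pdivlMr//.
    apply: le_lt_trans; apply: (@le_trans _ _ (K0 * K1 * a T)); last first.
      by rewrite ler_pM2r// le_max lexx.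
    by rewrite -mulrA ler_pM2l// HK1// (le_trans A1A).
apply: (le_trans _ (HK2 (T * s) _)); last by rewrite Ts0.
apply: pr_le.
- exact: mtail (lX T0) _ _ s0.
- exact: mtail levyX _ _ Ts0.
- move=> w /=; rewrite /scaled normrM (@gtr0_norm _ (a T)^-1) ?invr_gt0// ltr_pdivlMr//.
  apply: le_lt_trans; apply: (le_trans (ler_norm K2)); apply: (@le_trans _ _ (`|K2| * a T)).
    by rewrite ler_peMr.
  by rewrite ler_pM2r// le_max lexx orbT.
Unshelve. all: by end_near. Qed.

(** The same splitting at [A], with [a (T * s) <= c / K0 * a T] as soon as [T * s <= h * T]; for the
    bounded range of times [a T] has to exceed [K2 / c]. *)
Lemma scaled_small c e : 0 < c -> 0 < e ->
  exists2 h, 0 < h & \forall T \near +oo, forall s, 0 <= s <= h ->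
    pr P [set w | c < `|scaled X a T s w| ] <= e.
Proof.
move=> c0 e0; have [A0 [K0 [A00 K00 HK0]]] := domain_tight e0.
have cK : 0 < c / K0 by rewrite divr_gt0.
have [A1 [h [A10 h0 HK1]]] := regular_variation_small alpha01 svl aE cK.
set A := Num.max A0 A1.
have A0A : A0 <= A by rewrite le_max lexx.
have A1A : A1 <= A by rewrite le_max lexx orbT.
have [K2 HK2] := levy_tight levyX A e0.
exists h => //.
have n1 := regular_variation_pinfty alpha01 svl aE (K2 / c).
near=> T.
have T0 : 0 < T by near: T; exact: nbhs_pinfty_gt.
have a1 : K2 / c <= a T by near: T.
have [aT _] := aE T0.
move=> s /andP[s0 s1].
have Ts0 : 0 <= T * s by rewrite mulr_ge0 ?(ltW T0).
have [yA|/ltW yA] := leP A (T * s).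
  apply: (le_trans _ (HK0 _ (le_trans A0A yA))); apply: pr_le.
  - exact: mtail (lX T0) _ _ s0.
  - exact: mtail levyX _ _ Ts0.
  - move=> w /=; rewrite /scaled normrM (@gtr0_norm _ (a T)^-1) ?invr_gt0// ltr_pdivlMr//.
    apply: le_lt_trans; have -> : c * a T = K0 * (c / K0 * a T).
      by rewrite mulrA mulrCA divff ?gt_eqF// mulr1.
    by rewrite ler_pM2l// HK1// ?(le_trans A1A)// mulrC ler_pM2r.
apply: (le_trans _ (HK2 (T * s) _)); last by rewrite Ts0.
apply: pr_le.
- exact: mtail (lX T0) _ _ s0.
- exact: mtail levyX _ _ Ts0.
- move=> w /=; rewrite /scaled normrM (@gtr0_norm _ (a T)^-1) ?invr_gt0// ltr_pdivlMr//.
  by apply: le_lt_trans; rewrite mulrC -ler_pdivrMr.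
Unshelve. all: by end_near. Qed.

(** A tie is an atom at 0 of a difference of independent variables, which would force an atom of
    [increments S j]. *)
Lemma increments_tie r (i j : 'I_(2 ^ r)) : i != j ->
  pr P' [set w | increments S i w = increments S j w] = 0.
Proof.
move=> ij.
have mI k : measurable_fun setT (@increments _ _ _ S r k) by exact: (increments_measurable levyS).
have mN : measurable_fun setT (fun w => - increments S i w) by exact: measurableT_comp.
have ind (A B : set R) : measurable A -> measurable B ->
    pr P' ((fun w => - increments S i w) @^-1` A `&` increments S j @^-1` B) =
    pr P' ((fun w => - increments S i w) @^-1` A) * pr P' (increments S j @^-1` B).
  move=> mA mB; pose D k := if k == i then -%R @^-1` A else if k == j then B else setT.
  have mNA : measurable (-%R @^-1` A : set R) by rewrite -[X in measurable X]setTI; exact: oppr_measurable.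
  have mD k : measurable (D k) by rewrite /D; case: ifP => // _; case: ifP.
  have E := congr1 fine (increments_independent levyS mD).
  have -> : (fun w => - increments S i w) @^-1` A `&` increments S j @^-1` B =
      [set w | forall k, D k (@increments _ _ _ S r k w)].
    apply/seteqP; split => w /=.
      by move=> [h1 h2] k; rewrite /D; case: eqP => [->//|_]; case: eqP => [->//|_].
    by move=> H; have := H i; have := H j; rewrite /D !eqxx eq_sym (negbTE ij).
  rewrite /pr E /= (bigD1 i)//= (bigD1 j) 1?eq_sym//= big1.
    by rewrite mulr1 /D !eqxx eq_sym (negbTE ij).
  move=> k /andP[ki kj]; rewrite /D (negbTE ki) (negbTE kj)/=.
  by rewrite preimage_setT probability_setT.
have at0 x : pr P' [set w | increments S j w = x] = 0.
  rewrite (increments_law levyS j (measurable_set1 x)).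
  by apply: (stable_atomless stableS); rewrite divr_gt0// exprn_gt0.
have E : [set w | increments S i w = increments S j w] =
    [set w | - increments S i w + increments S j w = 0].
  apply/seteqP; split => w /=; first by move=> ->; rewrite addNr.
  by move=> /eqP; rewrite addrC subr_eq0 => /eqP.
apply/eqP; rewrite eq_le pr_ge0 andbT leNgt; apply/negP => p0.
have := independent_sum_max_atom mN (mI j) ind (z := 0)
  (q := pr P' [set w | increments S i w = increments S j w]).
move=> /(_ (fun x => ltac:(by rewrite at0 ltW)) (ltac:(by rewrite E))) ae.
have : pr P' setT <= pr P' set0.
  apply: pr_le_ae => //; apply: filterS ae => w; rewrite at0 => h.
  by rewrite -h ltxx in p0.
by rewrite /pr probability_setT measure0 ler10.
Qed.

Lemma increments_close_small r (i j : 'I_(2 ^ r)) e : i != j -> 0 < e ->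
  exists2 c, 0 < c &
    pr P' [set w | `|increments S i w - increments S j w| <= c] <= e.
Proof.
move=> ij e0.
have mI k : measurable_fun setT (@increments _ _ _ S r k) by exact: (increments_measurable levyS).
have : pr P' [set w | `|increments S i w - increments S j w| <= n.+1%:R^-1] @[n --> \oo] -->
    pr P' [set w | increments S i w = increments S j w].
  apply: cvg_pr_nonincr => [n| |w|n m w nm /=].
  - apply: measurable_le_set => //; apply: measurableT_comp => //; exact: measurable_funB.
  - rewrite (_ : [set _ | _] = [set w | increments S i w - increments S j w = 0]).
      by apply: measurable_eq_set; exact: measurable_funB.
    apply/seteqP; split => w /=; first by move=> ->; rewrite subrr.
    by move/eqP; rewrite subr_eq0 => /eqP.
  - split => /= [-> n|H]; first by rewrite subrr normr0 invr_ge0.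
    apply/eqP; rewrite -subr_eq0 -normr_le0; apply/ler_addgt0Pr => c c0; rewrite add0r.
    apply: (le_trans (H (Num.truncn c^-1))).
    by rewrite invf_ple ?posrE ?ltr0n// ltW// truncnS_gt.
  - by move=> /le_trans; apply; rewrite lef_pV2 ?posrE ?ltr0n// ler_nat.
rewrite increments_tie// => /cvgrPdist_le/(_ _ e0)[n _ /(_ n (leqnn _))] /=.
rewrite sub0r normrN => Hn; exists n.+1%:R^-1; first by rewrite invr_gt0.
exact: le_trans (ler_norm _) Hn.
Qed.

Let two_increments r : (0 < r)%N -> exists i j : 'I_(2 ^ r), i != j.
Proof.
move=> r0; have h1 : (1 < 2 ^ r)%N by rewrite -{1}(expn0 2) ltn_exp2l.
by exists (Ordinal (ltnW h1)), (Ordinal h1).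
Qed.

Lemma stable_concentration r e : (0 < r)%N -> 0 < e ->
  exists2 c, 0 < c & forall c', c' <= c ->
    forall x, pr P' [set w | `|S (dy r 1) w - x| <= 2 * c'] <= e.
Proof.
move=> r0 e0; have [i [j ij]] := two_increments r0.
have e2 : 0 < e ^+ 2 by rewrite exprn_gt0.
have [c c0 Hc] := increments_close_small ij e2.
exists (c / 4) => [|c' cc' x]; first by rewrite divr_gt0.
have := @increments_concentration _ _ _ _ _ levyS r i j c' e x ij (ltW e0); apply.
apply: le_trans Hc.
have mI k : measurable_fun setT (@increments _ _ _ S r k) by exact: (increments_measurable levyS).
have mc y : measurable [set w | `|increments S i w - increments S j w| <= y].
  apply: measurable_le_set => //; apply: measurableT_comp => //; exact: measurable_funB.
by apply: pr_le => // w /= h; lra.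
Qed.

(** The bound must hold for all [x] simultaneously once T is large. [increments_concentration]
    removes [x]: it is enough that two increments are rarely close, and a ramp of their distance
    carries this from [S] to the scaled process. *)
Lemma scaled_concentration r e : (0 < r)%N -> 0 < e ->
  exists2 c, 0 < c & forall c', c' <= c -> \forall T \near +oo, forall x,
    pr P [set w | `|scaled X a T (dy r 1) w - x| <= 2 * c'] <= e.
Proof.
move=> r0 e0; have [i [j ij]] := two_increments r0.
have e2 : 0 < e ^+ 2 / 2 by rewrite divr_gt0// exprn_gt0.
have [c c0 Hc] := increments_close_small ij e2.
have c20 : 0 < c / 2 by rewrite divr_gt0.
(* With [c' <= c / 8], a distance of at most [4 * c'] is at most [c / 2], where the ramp below
   equals 1; the ramp vanishes from [c] on. *)
exists (c / 8) => [|c' cc']; first by rewrite divr_gt0.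
pose G (u : 'I_(2 ^ r) -> R) := ramp (c / 2) (c / 2) `|u i - u j|.
have mG d0 (Q : measurableType d0) (Q' : probability Q R) V : levy_process Q' V ->
    measurable_fun setT (fun w => G (fun i => increments V i w)).
  move=> lV; apply: measurableT_comp; first exact: continuous_measurable_fun (@ramp_continuous _ _ _).
  by apply: measurableT_comp => //; apply: measurable_funB; exact: (increments_measurable lV).
have L0 : 0 <= (c / 2)^-1 * 2 by rewrite mulr_ge0// invr_ge0 ltW.
have cG := cvg_increments levyX stableS svl aE lawX (G := G) (M := 1) L0.
have mGX T : 0 < T -> measurable_fun setT (fun w => G (fun i => increments (scaled X a T) i w)).
  by move=> T0; exact: mG (lX T0).
have {}cG := cG mGX (mG _ _ _ _ levyS).
have {}cG : Ex P (fun w => G (fun i => increments (scaled X a T) i w)) @[T --> +oo] -->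
    Ex P' (fun w => G (fun i => increments S i w)).
  apply: cG => [u|u v h uv].
    by have /andP[h1 h2] := ramp_itv (c / 2) (c / 2) `|u i - u j|; rewrite ger0_norm.
  apply: (le_trans (ramp_lipschitz _ _ _ c20)); rewrite -mulrA ler_pM2l ?invr_gt0//.
  apply: (le_trans (ler_dist_dist _ _)).
  have := ler_normB (u i - v i) (u j - v j); have := uv i; have := uv j.
  have -> : u i - v i - (u j - v j) = u i - u j - (v i - v j) by ring.
  lra.
have ESle : Ex P' (fun w => G (fun i => increments S i w)) <= e ^+ 2 / 2.
  apply: le_trans Hc.
  have m1 : measurable_fun setT (fun w => `|increments S i w - increments S j w|).
    by apply: measurableT_comp => //; apply: measurable_funB; exact: (increments_measurable levyS).
  have /andP[_ h] := ramp_indic P' (c / 2) m1 c20; apply: (le_trans h).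
  by rewrite -splitr.
have /cvgrPdist_le/(_ _ e2) n1 := cG.
near=> T => x.
have T0 : 0 < T by near: T; exact: nbhs_pinfty_gt.
have h1 : `|Ex P' (fun w => G (fun i => increments S i w)) -
  Ex P (fun w => G (fun i => increments (scaled X a T) i w))| <= e ^+ 2 / 2 by near: T.
have := @increments_concentration _ _ _ _ _ (lX T0) r i j c' e x ij (ltW e0); apply.
have m1 : measurable_fun setT (fun w => `|increments (scaled X a T) i w - increments (scaled X a T) j w|).
  by apply: measurableT_comp => //; apply: measurable_funB; exact: (increments_measurable (lX T0)).
have /andP[h _] := ramp_indic P (c / 2) m1 c20.
move: h1; rewrite ler_norml => /andP[h1 _].
apply: (@le_trans _ _ (pr P [set w | `|increments (scaled X a T) i w - increments (scaled X a T) j w| <= c / 2])).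
  by apply: pr_le; [exact: measurable_le_set|exact: measurable_le_set|move=> w /=; lra].
apply: (le_trans h); lra.
Unshelve. all: by end_near. Qed.

End domain_tails.

(** * Measurable versions *)

Section borel_pairs.
Context {R : realType} d (Omega : measurableType d).

Definition borel_map (E : topologicalType) (Y : Omega -> E) :=
  forall U : set E, open U -> measurable (Y @^-1` U).

(** Versions are Borel for the product topology, whereas the coordinates are measurable one by one;
    a countable base reconciles the two. *)
Definition countable_base (E : topologicalType) (B : nat -> set E) :=
  (forall n, open (B n)) /\
  forall x U, nbhs x U -> exists2 n, B n x & B n `<=` U.

Lemma countable_base_real : exists B : nat -> set R, countable_base B.
Proof.
pose q n : rat * rat := odflt (0, 0) (unpickle n).
exists (fun n => `]ratr (q n).1, ratr (q n).2[%classic); split.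
  by move=> n; exact: interval_open.
move=> x U /nbhs_ballP[e /= e0 xU].
have /rat_in_itvoo[q1] : x - e < x by rewrite ltrBlDr ltrDl.
have /rat_in_itvoo[q2] : x < x + e by rewrite ltrDl.
rewrite !in_itv/= => /andP[xq2 q2x] /andP[xq1 q1x].
exists (pickle (q1, q2)); rewrite /q pickleK/=; first by rewrite in_itv/= q1x.
move=> y /=; rewrite in_itv/= => /andP[y1 y2]; apply: xU; rewrite /ball/= ltr_norml.
by apply/andP; split; lra.
Qed.

Lemma countable_base_prod (E F : topologicalType) (B : nat -> set E) (C : nat -> set F) :
  countable_base B -> countable_base C ->
  exists D : nat -> set (E * F), countable_base D.
Proof.
move=> [oB hB] [oC hC]; pose q n : nat * nat := odflt (0, 0)%N (unpickle n).
exists (fun n => B (q n).1 `*` C (q n).2); split.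
  move=> n; rewrite openE => -[x y] /= [Bx Cy].
  by exists (B (q n).1, C (q n).2) => //=; split; apply: open_nbhs_nbhs.
move=> [x y] U [[V W] /= [Vx Wy] VW].
have [n Bn BV] := hB _ _ Vx; have [m Cm CW] := hC _ _ Wy.
exists (pickle (n, m)); rewrite /q pickleK//= => -[u v] /= [Bu Cv].
by apply: VW; split; [exact: BV|exact: CW].
Qed.

(** An open set of the product is a countable union of the basic rectangles that it contains. *)
Lemma borel_map_pair (E F : topologicalType) (B : nat -> set E) (C : nat -> set F)
    (Y : Omega -> E) (Z : Omega -> F) : countable_base B -> countable_base C ->
  borel_map Y -> borel_map Z -> borel_map (fun w => (Y w, Z w)).
Proof.
move=> [oB hB] [oC hC] mY mZ U oU.
have -> : (fun w => (Y w, Z w)) @^-1` U =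
    \bigcup_n \bigcup_(m in [set m | B n `*` C m `<=` U])
      (Y @^-1` B n `&` Z @^-1` C m).
  apply/seteqP; split => w /=.
    move=> Uw; have [[V W] /= [Vx Wy] VW] := open_nbhs_nbhs (conj oU Uw).
    have [n Bn BV] := hB _ _ Vx; have [m Cm CW] := hC _ _ Wy.
    exists n => //; exists m => //= -[u v] /= [Bu Cv].
    by apply: VW; split; [exact: BV|exact: CW].
  by move=> [n _ [m /= nU [Yw Zw]]]; apply: (nU (Y w, Z w)).
apply: bigcup_measurable => n _; apply: bigcup_measurable => m _.
by apply: measurableI; [exact: mY|exact: mZ].
Qed.

Lemma measurable_borel_map (Y : Omega -> R) : measurable_fun setT Y -> borel_map Y.
Proof.
by move=> mY U oU; rewrite -[X in measurable X]setTI; apply: mY => //; exact: open_measurable.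
Qed.

Lemma borel_map_quadruple (Y1 Y2 Y3 Y4 : Omega -> R) :
  measurable_fun setT Y1 -> measurable_fun setT Y2 ->
  measurable_fun setT Y3 -> measurable_fun setT Y4 ->
  borel_map (fun w => (Y1 w, Y2 w, Y3 w, Y4 w)).
Proof.
move=> m1 m2 m3 m4; have [B hB] := countable_base_real.
have [C hC] := countable_base_prod hB hB.
have [D hD] := countable_base_prod hC hB.
by do 3 ?[apply: (borel_map_pair _ hB); first eassumption];
  try exact: measurable_borel_map.
Qed.

Lemma borel_map_octuple (Y1 Y2 Y3 Y4 Z1 Z2 Z3 Z4 : Omega -> R) :
  measurable_fun setT Y1 -> measurable_fun setT Y2 ->
  measurable_fun setT Y3 -> measurable_fun setT Y4 ->
  measurable_fun setT Z1 -> measurable_fun setT Z2 ->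
  measurable_fun setT Z3 -> measurable_fun setT Z4 ->
  borel_map (fun w => ((Y1 w, Y2 w, Y3 w, Y4 w), (Z1 w, Z2 w, Z3 w, Z4 w))).
Proof.
move=> *; have [B hB] := countable_base_real.
have [C hC] := countable_base_prod hB hB.
have [D hD] := countable_base_prod hC hB.
have [F hF] := countable_base_prod hD hB.
by apply: (borel_map_pair hF hF); exact: borel_map_quadruple.
Qed.

End borel_pairs.

Section ae_measurable.
Context {R : realType} d (Omega : measurableType d) (P : probability Omega R).
Implicit Types (Y Z : Omega -> R).

(** This notion is stable under almost sure limits although [P] need not be complete. *)
Definition ae_measurable Y :=
  exists2 Y', measurable_fun setT Y' & {ae P, forall w, Y w = Y' w}.

Lemma measurable_ae_measurable Y : measurable_fun setT Y -> ae_measurable Y.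
Proof. by move=> mY; exists Y => //; exact: aeW. Qed.

Lemma ae_measurable_eq Y Z : {ae P, forall w, Y w = Z w} ->
  ae_measurable Y -> ae_measurable Z.
Proof.
by move=> YZ [Y' mY' YY']; exists Y' => //; apply: filterS2 YZ YY' => w -> .
Qed.

Lemma ae_measurable_map2 (g : R -> R -> R) Y Z :
  (forall U V : Omega -> R, measurable_fun setT U -> measurable_fun setT V ->
    measurable_fun setT (fun w => g (U w) (V w))) ->
  ae_measurable Y -> ae_measurable Z -> ae_measurable (fun w => g (Y w) (Z w)).
Proof.
move=> mg [Y' mY' YY'] [Z' mZ' ZZ']; exists (fun w => g (Y' w) (Z' w)); first exact: mg.
by apply: filterS2 YY' ZZ' => w -> ->.
Qed.

Lemma ae_measurable_map (g : R -> R) Y : measurable_fun setT g ->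
  ae_measurable Y -> ae_measurable (fun w => g (Y w)).
Proof.
move=> mg mY; apply: (@ae_measurable_map2 (fun y _ => g y) Y Y) => // U V mU _.
exact: measurableT_comp.
Qed.

Lemma ae_measurable_sum I (s : seq I) (p : pred I) (Y : I -> Omega -> R) :
  (forall i, p i -> ae_measurable (Y i)) -> ae_measurable (fun w => \sum_(i <- s | p i) Y i w).
Proof.
move=> mY; elim: s => [|i s ih].
  by under eq_fun do rewrite big_nil; apply: measurable_ae_measurable; exact: measurable_cst.
under eq_fun do rewrite big_cons.
case pi : (p i); last exact: ih.
apply: (@ae_measurable_map2 (fun x y => x + y) (Y i)) => //; last exact: mY.
by move=> U V mU mV; exact: measurable_funD.
Qed.

Lemma ae_measurable_cvg (Y : nat -> Omega -> R) Z : (forall n, ae_measurable (Y n)) ->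
  {ae P, forall w, Y n w @[n --> \oo] --> Z w} -> ae_measurable Z.
Proof.
move=> mY YZ; have /choice[Y' HY'] : forall n, exists Y', measurable_fun setT Y' /\
    {ae P, forall w, Y n w = Y' w}.
  by move=> n; have [Y' ? ?] := mY n; exists Y'.
have : {ae P, forall w, (forall n, Y n w = Y' n w) /\ Y n w @[n --> \oo] --> Z w}.
  apply: filterS2 _ YZ; last by apply: (ae_foralln (fun n => (HY' n).2)).
  by move=> w.
move=> [N [mN N0 HN]].
(* Multiplying by [chi] makes the sequence converge everywhere, so that its limit is measurable. *)
pose chi (w : Omega) : R := \1_(~` N) w.
have mchi : measurable_fun setT chi by apply: measurable_indic; exact: measurableC.
have good w : ~ N w -> (forall n, Y n w = Y' n w) /\ Y n w @[n --> \oo] --> Z w.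
  by move=> Nw; apply: contrapT => h; apply: Nw; exact: HN.
have chi0 w : N w -> chi w = 0 by move=> Nw; rewrite /chi indicE memNset// => /(_ Nw).
have chi1 w : ~ N w -> chi w = 1 by move=> Nw; rewrite /chi indicE mem_set.
exists (fun w => chi w * Z w).
  apply: (@measurable_fun_cvg _ _ _ _ (fun n w => chi w * Y' n w)).
    by move=> n; apply: measurable_funM => //; exact: (HY' n).1.
  move=> w _; have [Nw|Nw] := pselect (N w).
    by rewrite chi0//; under eq_fun do rewrite mul0r; rewrite mul0r; exact: cvg_cst.
  have [E cv] := good w Nw; rewrite chi1// mul1r.
  by apply: cvg_trans cv; apply: near_eq_cvg; apply: nearW => n; rewrite mul1r E.
exists N; split => // w /= h; apply: contrapT => Nw; apply: h.
by rewrite chi1// mul1r.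
Qed.

End ae_measurable.

(** * The concave majorant as a countable infimum *)

Section concave_slopes.
Context {R : realType}.
Implicit Types (f C : R -> R) (T t b e : R).

(** The supremum of the slopes to the right of [t] is at most every slope to its left, so it is a
    supergradient. *)
Lemma concave_support C T t : concave_on T C -> 0 < t < T ->
  exists b, forall s, 0 <= s <= T -> C s <= C t + b * (s - t).
Proof.
move=> cC /andP[t0 tT].
pose D := [set (C s - C t) / (s - t) | s in [set s | t < s <= T]].
have slope x s : 0 <= x -> x < t -> t < s -> s <= T ->
    (C s - C t) / (s - t) <= (C t - C x) / (t - x).
  move=> x0 xt ts sT; rewrite ler_pdivrMr ?subr_gt0// mulrAC ler_pdivlMr ?subr_gt0//.
  by have := cC x t s x0 xt ts sT; lra.
have ubD x : 0 <= x -> x < t -> ubound D ((C t - C x) / (t - x)).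
  by move=> x0 xt _ [s /andP[ts sT] <-]; exact: slope.
have supD : has_sup D.
  split; first by exists ((C T - C t) / (T - t)); exists T => //=; rewrite tT lexx.
  by exists ((C t - C 0) / (t - 0)); exact: ubD.
exists (sup D) => s /andP[s0 sT]; have [ts|st|->] := ltgtP t s; last by rewrite subrr mulr0 addr0.
  rewrite -lerBlDl -ler_pdivrMr ?subr_gt0//; apply: sup_ubound; first by case: supD.
  by exists s => //=; rewrite ts sT.
have : sup D <= (C t - C s) / (t - s) by apply: ge_sup; [case: supD|exact: ubD].
by rewrite ler_pdivlMr ?subr_gt0//; lra.
Qed.

Lemma cadlag_subZ f b : cadlag f -> cadlag (fun t => f t - b * t).
Proof.
move=> cf t t0; have [h1 h2] := cf t t0.
have lin (F : set_system R) : Filter F -> F --> t -> b * x @[x --> F] --> b * t.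
  by move=> FF Ft; apply: cvgM => //; exact: cvg_cst.
split=> [|tp].
  apply: cvgB => //; apply: lin; exact: cvg_at_right_filter cvg_id.
have /cvg_ex[m hm] := h2 tp; apply/cvg_ex; exists (m - b * t).
by apply: cvgB => //; apply: lin; exact: cvg_at_left_filter cvg_id.
Qed.

(* Concave conjugation: the concave majorant is the infimum of these over b, and
   rational values of b suffice. *)
Definition slope_bound f T t b := sup_on (fun s => f s - b * s) T + b * t.

Lemma concave_majorant_le_slope f T t b : cadlag f -> 0 < T -> 0 <= t <= T ->
  concave_majorant f T t <= slope_bound f T t b.
Proof.
move=> cf T0 tT; have [M fM] := cadlag_bounded T cf.
have {}fM s : 0 <= s <= T -> f s <= M by move=> /fM; apply: le_trans; exact: ler_norm.
apply: (concave_majorant_le fM (c := fun s => sup_on (fun s => f s - b * s) T + b * s)) => //.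
  by move=> x y z *; lra.
move=> s sT; rewrite -lerBlDr.
exact: (le_sup_int (cadlag_subZ b cf) (lexx 0) sT).
Qed.

(** A supergradient at [t] gives equality; moving it to a rational within [e / T] costs at most [e]
    over [[0, T]]. At an end point a supergradient may fail to exist, but there the majorant equals
    the path. *)
Lemma concave_majorant_slope f T t e : cadlag f -> 0 < t < T -> 0 < e ->
  exists q : rat, slope_bound f T t (ratr q) <= concave_majorant f T t + e.
Proof.
move=> cf /andP[t0 tT] e0; have T0 : 0 < T := lt_trans t0 tT.
have [M fM] := cadlag_bounded T cf.
have {}fM s : 0 <= s <= T -> f s <= M by move=> /fM; apply: le_trans; exact: ler_norm.
have [b Hb] := concave_support (concave_majorant_concave fM) (ltac:(by rewrite t0 tT) : 0 < t < T).
have /rat_in_itvoo[q] : b < b + e / T by rewrite ltrDl divr_gt0.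
rewrite in_itv/= => /andP[bq qb]; exists q.
have qbT : (ratr q - b) * T <= e by rewrite -ler_pdivlMr//; lra.
rewrite /slope_bound -lerBrDr; apply: sup_int_le => [|s /andP[s0 sT]]; first exact: ltW.
have sI : 0 <= s <= T by rewrite s0.
have := Hb s sI; have := concave_majorant_ge fM sI.
nra.
Qed.

(** Minimum over the first [n] codes of rationals; slope 0 is both the seed and the value for codes
    of no rational. *)
Definition slope_approx f T t n :=
  \big[Num.min/slope_bound f T t 0]_(i < n) slope_bound f T t (ratr (odflt 0 (unpickle i))).

Lemma cvg_slope_approx f T t : cadlag f -> 0 < t < T ->
  slope_approx f T t n @[n --> \oo] --> concave_majorant f T t.
Proof.
move=> cf /andP[t0 tT]; have T0 : 0 < T := lt_trans t0 tT.
have tI : 0 <= t <= T by rewrite !ltW.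
apply/cvgrPdist_le => e e0.
have [q Hq] := concave_majorant_slope cf (ltac:(by rewrite t0 tT) : 0 < t < T) e0.
exists (pickle q).+1 => // n /= qn.
have h1 : concave_majorant f T t <= slope_approx f T t n.
  by apply: le_bigmin => *; exact: concave_majorant_le_slope.
have h2 : slope_approx f T t n <= slope_bound f T t (ratr q).
  rewrite /slope_approx; have := bigmin_le (slope_bound f T t 0) (Ordinal qn)
    (fun i : 'I_n => slope_bound f T t (ratr (odflt 0 (unpickle i)))).
  by rewrite /= pickleK.
rewrite distrC ger0_norm; lra.
Qed.

End concave_slopes.

Section sup_functional.
Context {R : realType} d (Omega : measurableType d) (P : probability Omega R).
Variable V : R -> Omega -> R.
Hypotheses (mV : forall t, 0 <= t -> measurable_fun setT (V t))
  (cV : {ae P, forall w, cadlag (V^~ w)}).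
Implicit Types (T t b : R).

Lemma ae_measurable_sup_on T : 0 <= T -> ae_measurable P (fun w => sup_on (V^~ w) T).
Proof.
rewrite le_eqVlt => /orP[/eqP<-|T0].
  apply: (@ae_measurable_eq _ _ _ _ (V 0)).
    apply: aeW => w; apply/eqP; rewrite eq_le; apply/andP; split.
      apply: sup_ubound; last by exists 0 => //=; rewrite in_itv/= lexx.
      by exists (V 0 w) => _ [y /= + <-]; rewrite in_itv/= => /le_anti <-.
    by apply: sup_int_le => // t /le_anti<-.
  by apply: measurable_ae_measurable; exact: mV.
apply: (@ae_measurable_cvg _ _ _ _
  (fun j w => gmax (rescale T 1 (V^~ w)) (0 + j) (0 * 2 ^ j) (1 * 2 ^ j))).
  move=> j; apply: measurable_ae_measurable; apply: measurable_bigmax => [|l _];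
    by rewrite /rescale; apply: measurable_funM => //; apply: mV; rewrite mulr_ge0 ?dy_ge0 ?ltW.
apply: filterS cV => w cw.
have := @cvg_gmax _ _ 0 0 1 (cadlag_rescale T0 ltr01 cw) isT.
rewrite dy0 (_ : dy 0 1 = 1 :> R) ?dy1//.
have -> : sup_int (rescale T 1 (V^~ w)) 0 1 = sup_on (rescale T 1 (V^~ w)) 1 by [].
by rewrite sup_on_rescale// mulr1 divr1.
Qed.

End sup_functional.

Section path_functionals.
Context {R : realType} d (Omega : measurableType d) (P : probability Omega R).
Variable V : R -> Omega -> R.
Hypotheses (mV : forall t, 0 <= t -> measurable_fun setT (V t))
  (cV : {ae P, forall w, cadlag (V^~ w)}).
Implicit Types (T t b : R).

Lemma ae_measurable_slope_bound T t b : 0 < T ->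
  ae_measurable P (fun w => slope_bound (V^~ w) T t b).
Proof.
move=> /ltW T0; apply: (@ae_measurable_map _ _ _ _ (fun y => y + b * t)); first exact: measurable_funD.
apply: (ae_measurable_sup_on (V := fun s w => V s w - b * s)) => //.
  by move=> s s0; apply: measurable_funB => //; exact: mV.
by apply: filterS cV => w; exact: cadlag_subZ.
Qed.

Lemma ae_measurable_concave_majorant T t : 0 <= t <= T -> 0 < T ->
  ae_measurable P (fun w => concave_majorant (V^~ w) T t).
Proof.
move=> /andP[]; rewrite le_eqVlt => /orP[/eqP<- _|t0] => [T0|].
  apply: (@ae_measurable_eq _ _ _ _ (V 0)).
    apply: filterS cV => w cw; have [M fM] := cadlag_bounded T cw.
    by rewrite (concave_majorant0 T0 (fun s sT => le_trans (ler_norm _) (fM s sT))).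
  by apply: measurable_ae_measurable; exact: mV.
rewrite le_eqVlt => /orP[/eqP-> T0|tT T0].
  apply: (@ae_measurable_eq _ _ _ _ (V T)).
    apply: filterS cV => w cw; have [M fM] := cadlag_bounded T cw.
    by rewrite (concave_majorantT T0 (fun s sT => le_trans (ler_norm _) (fM s sT))).
  by apply: measurable_ae_measurable; apply: mV; exact: ltW.
apply: (@ae_measurable_cvg _ _ _ _ (fun n w => slope_approx (V^~ w) T t n)).
  move=> n; rewrite /slope_approx; elim: (index_enum _) => [|i s ih].
    by under eq_fun do rewrite big_nil; exact: ae_measurable_slope_bound.
  under eq_fun do rewrite big_cons/=.
  apply: (@ae_measurable_map2 _ _ _ _ Num.min _ _ _ _ ih); last exact: ae_measurable_slope_bound.
  by move=> U W mU mW; exact: measurable_minr.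
by apply: filterS cV => w cw; apply: cvg_slope_approx => //; rewrite t0.
Qed.

Lemma ae_measurable_graph_length T : 0 < T ->
  ae_measurable P (fun w => graph_length (concave_majorant (V^~ w) T) 0 T).
Proof.
move=> T0; apply: (@ae_measurable_cvg _ _ _ _
  (fun n w => mesh_length (concave_majorant (V^~ w) T) T n)).
  move=> n; rewrite /mesh_length; under eq_fun do rewrite big_nat.
  apply: ae_measurable_sum => k /andP[_ kn]; rewrite /chord.
  apply: (@ae_measurable_map2 _ _ _ _
    (fun x y => Num.sqrt ((mesh T n k.+1 - mesh T n k) ^+ 2 + (y - x) ^+ 2))).
  - move=> U W mU mW; apply: measurableT_comp.
      exact: continuous_measurable_fun (@sqrt_continuous R).
    by apply: measurable_funD => //; apply: measurable_funX; exact: measurable_funB.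
  - by apply: ae_measurable_concave_majorant => //; apply: mesh_itv => //; exact: ltnW.
  - by apply: ae_measurable_concave_majorant => //; exact: mesh_itv.
apply: filterS cV => w cw; have [M fM] := cadlag_bounded T cw.
have {}fM s : 0 <= s <= T -> V s w <= M by move=> /fM; apply: le_trans; exact: ler_norm.
apply: (@cvg_mesh_length _ _ _ M) => //; first exact: (concave_majorant_concave fM).
exact: (concave_majorant_le_bound fM).
Qed.

(** By [sup_on_lt], [before p k] is the indicator of [k / 2 ^ p < g], and the proportion of such [k]
    is within [2 ^ (- p)] of [g]. *)
Lemma ae_measurable_time_of_sup : ae_measurable P (fun w => time_of_sup (V^~ w) 1).
Proof.
pose before p k w : R := (sup_on (V^~ w) (dy p k) < sup_on (V^~ w) 1)%R%:R.
apply: (@ae_measurable_cvg _ _ _ _ (fun p w => (2 ^+ p)^-1 * \sum_(k < 2 ^ p) before p k w)).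
  move=> p; apply: (@ae_measurable_map _ _ _ _ (fun y => (2 ^+ p)^-1 * y)); first exact: measurable_funM.
  apply: ae_measurable_sum => k _.
  apply: (@ae_measurable_map2 _ _ _ _ (fun x y => (x < y)%R%:R)).
  - move=> U W mU mW; rewrite (_ : (fun w => _) = (fun w => if U w < W w then 1 else 0)).
      by apply: measurable_fun_ifT => //; exact: measurable_fun_ltr.
    by apply/funext => w; case: ifP.
  - by apply: ae_measurable_sup_on => //; exact: dy_ge0.
  - exact: ae_measurable_sup_on.
apply: filterS cV => w cw; set g := time_of_sup _ _.
have g01 : 0 <= g <= 1 by exact: time_of_sup_itv.
have close p : g <= (2 ^+ p)^-1 * \sum_(k < 2 ^ p) before p k w <= g + (2^-1) ^+ p.
  have p0 : 0 < 2 ^+ p :> R by rewrite exprn_gt0.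
  have E : \sum_(k < 2 ^ p) before p k w = \sum_(k < 2 ^ p) ((k%:R < 2 ^+ p * g)%R%:R : R).
    apply: eq_bigr => k _; rewrite /before sup_on_lt//.
      by rewrite /dy ltr_pdivrMr// (mulrC g).
    rewrite dy_ge0 /dy ler_pdivrMr// mul1r -natrX ler_nat; exact/ltnW.
  have := @sum_lt_nat R (2 ^ p) (2 ^+ p * g); rewrite natrX.
  have [g0 g1] := andP g01.
  rewrite mulr_ge0 ?(ltW p0)//= ler_piMr ?(ltW p0)// => /(_ isT)/andP[h1 h2].
  by rewrite E exprVn ler_pdivlMl// ler_pdivrMl// mulrDr divff ?gt_eqF// h1.
apply: (@squeeze_cvgr _ _ _ _ (fun=> g) (fun p => g + (2^-1) ^+ p)).
- exact: nearW.
- exact: cvg_cst.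
rewrite -[X in _ --> X]addr0; apply: cvgD; first exact: cvg_cst.
by apply: cvg_expr; rewrite ger0_norm; lra.
Qed.

End path_functionals.

(** * Absence of a jump at a fixed time *)

Section left_continuity.
Context {R : realType} d (Omega : measurableType d) (P : probability Omega R).
Variable X : R -> Omega -> R.
Hypothesis levyX : levy_process P X.
Implicit Types (T t c e : R).

(** By stationarity [X t - X (t - u n)] has the law of [X (u n)], which tends to 0 in probability.
    So almost surely it is at most [1 / m.+1] for arbitrarily large [n], for every [m], and the left
    limit can only be [X t]. *)
Lemma levy_left_continuous t : 0 < t -> {ae P, forall w, X s w @[s --> t^'-] --> X t w}.
Proof.
move=> t0; have [_ _ cX _ _] := levyX.
pose u n : R := t / n.+1%:R.
have u0 n : 0 < u n by rewrite divr_gt0.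
have ut n : u n <= t by rewrite ler_pdivrMr ?ltr0n// ler_peMr ?ler1n// ltW.
have mX s : 0 <= s -> measurable_fun setT (X s) by exact: (levy_measurable levyX).
have mgt (c : R) (Y : Omega -> R) : measurable_fun setT Y -> measurable [set w | c < `|Y w| ].
  by move=> mY; apply: measurable_lt_set => //; exact: measurableT_comp.
have tu n : 0 <= t - u n by rewrite subr_ge0.
pose D m n := [set w | m.+1%:R^-1 < `|X t w - X (t - u n) w| ].
have mD m n : measurable (D m n).
  by apply: mgt; apply: measurable_funB; apply: mX => //; exact: ltW.
pose B m N := \bigcap_(n in [set n | (N <= n)%N]) D m n.
have mB m N : measurable (B m N) by apply: bigcap_measurableType => n _; exact: mD.
have prB m N : pr P (B m N) = 0.
  apply/eqP; rewrite eq_le pr_ge0 andbT; apply/ler_addgt0Pr => e e0; rewrite add0r.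
  have m0 : 0 < m.+1%:R^-1 :> R by rewrite invr_gt0.
  have [h h0 Hh] := levy_small levyX m0 e0.
  pose n := maxn N (Num.truncn (t / h)).
  have unh : u n <= h.
    rewrite ler_pdivrMr ?ltr0n// mulrC -ler_pdivrMr// ltW//.
    by apply: (lt_le_trans (truncnS_gt _)); rewrite ler_nat ltnS leq_maxr.
  apply: (@le_trans _ _ (pr P (D m n))).
    by apply: pr_le => // w; apply; rewrite /= leq_maxl.
  have mC : measurable [set y : R | m.+1%:R^-1 < `|y| ] by exact: measurable_lt_set.
  have := levy_stationary levyX (tu n) (ltW (u0 n)) mC; rewrite subrK /= => E.
  by rewrite /D E; apply: Hh; rewrite (ltW (u0 n)) unh.
have aeB : {ae P, forall w, forall m N, ~ B m N w}.
  apply: (ae_foralln (P := fun m w => forall N, ~ B m N w)) => m.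
  apply: (ae_foralln (P := fun N w => ~ B m N w)) => N.
  by exists (B m N); split => //; [by have := @prE _ _ _ P _ (mB m N); rewrite prB|move=> w /= /contrapT].
apply: filterS2 cX aeB => w cw nB.
have [l fl] := cadlag_left cw t0.
suff <- : l = X t w by [].
apply/eqP; rewrite eq_sym -subr_eq0 -normr_le0; apply/ler_addgt0Pr => e e0; rewrite add0r.
pose m := Num.truncn (2 / e).
have me : m.+1%:R^-1 <= e / 2.
  by rewrite invf_ple ?posrE ?ltr0n ?divr_gt0// invf_div ltW// truncnS_gt.
have e2 : 0 < e / 2 by rewrite divr_gt0.
have [r r0 Hr] := cvg_leftP fl e2.
pose N := Num.truncn (t / r).
have /existsNP[n /not_implyP[/= Nn /negP]] := nB m N; rewrite -leNgt => Xn.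
have unr : u n < r.
  rewrite ltr_pdivrMr ?ltr0n// mulrC -ltr_pdivrMr//.
  by apply: (lt_le_trans (truncnS_gt _)); rewrite ler_nat ltnS.
have := Hr (t - u n); rewrite (_ : t - r < t - u n < t); last first.
  by have := u0 n; move: unr => ? ?; apply/andP; split; lra.
move=> /(_ isT) /= h; have := ler_distD (X (t - u n) w) (X t w) l.
by move=> /le_trans; apply; rewrite [leRHS]splitr lerD// (le_trans Xn me).
Qed.

End left_continuity.

(* The second block is that of the convex minorant, obtained from the values
   l2, s2, v2 and g2 for the opposite path. *)
Definition assemble {R : realType} (l1 s1 v1 g1 l2 s2 v2 g2 : R) :
    (R * R * R * R) * (R * R * R * R) :=
  ((l1, s1, v1, g1), (l2, - s2, - v2, g2)).

(** The lengths are parameters because they alone differ in form: arc lengths for finite T,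
    [limit_length] in the limit. The other coordinates are the same functions of the scaled path and
    of [S]. *)
Definition functionals {R : realType} (l1 l2 : R) (z : R -> R) :=
  assemble l1 (sup_on z 1) (z 1) (time_of_sup z 1)
    l2 (sup_on (fun t => - z t) 1) (- z 1) (time_of_sup (fun t => - z t) 1).

Section versions.
Context {R : realType} d (Omega : measurableType d) (P : probability Omega R).
Variable V : R -> Omega -> R.
Hypothesis levyV : levy_process P V.

Lemma version_functionals (l1 l2 : Omega -> R) Y :
  ae_measurable P l1 -> ae_measurable P l2 ->
  {ae P, forall w, Y w = functionals (l1 w) (l2 w) (V^~ w)} -> exists Y', version P Y Y'.
Proof.
have [mV _ cV _ _] := levyV; have [mN _ cN _ _] := levy_opp levyV.
move=> [l1' ml1 l1E] [l2' ml2 l2E] YE.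
have [s1 ms1 s1E] := ae_measurable_sup_on mV cV ler01.
have [s2 ms2 s2E] := ae_measurable_sup_on mN cN ler01.
have [g1 mg1 g1E] := ae_measurable_time_of_sup mV cV.
have [g2 mg2 g2E] := ae_measurable_time_of_sup mN cN.
exists (fun w => assemble (l1' w) (s1 w) (V 1 w) (g1 w) (l2' w) (s2 w) (- V 1 w) (g2 w)).
split.
  apply: borel_map_octuple => //; try exact: mV.
    exact: measurableT_comp.
  by apply: measurableT_comp => //; exact: mN.
have E1 : {ae P, forall w, l1 w = l1' w /\ l2 w = l2' w} by apply: filterS2 l1E l2E.
have E2 : {ae P, forall w, sup_on (V^~ w) 1 = s1 w /\ sup_on (fun t => - V t w) 1 = s2 w}.
  by apply: filterS2 s1E s2E.
have E3 : {ae P, forall w, time_of_sup (V^~ w) 1 = g1 w /\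
    time_of_sup (fun t => - V t w) 1 = g2 w} by apply: filterS2 g1E g2E.
have E4 : {ae P, forall w, Y w = functionals (l1' w) (l2' w) (V^~ w)}.
  by apply: filterS2 YE E1 => w -> [-> ->].
apply: filterS3 E4 E2 E3 => w -> [s1w s2w] [g1w g2w].
by rewrite /functionals s1w s2w g1w g2w.
Qed.

End versions.

Definition limit_length {R : realType} (z : R -> R) := 2 * sup_on z 1 - z 1.

Lemma Lambda_functionals {R : realType} (z : R -> R) :
  (Lambda1 z, Lambda2 z) =
  functionals (limit_length z) (limit_length (fun t => - z t)) z.
Proof. by have := Lambda2E z; rewrite /Lambda1 => ->. Qed.

Lemma version_Lambda {R : realType} d (Omega : measurableType d) (P : probability Omega R)
    (V : R -> Omega -> R) : levy_process P V -> exists Y',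
  version P (fun w => (Lambda1 (V^~ w), Lambda2 (V^~ w))) Y'.
Proof.
move=> levyV.
have len W : levy_process P W -> ae_measurable P (fun w => limit_length (W^~ w)).
  move=> levyW; have [mW _ cW _ _] := levyW.
  apply: (@ae_measurable_map2 _ _ _ _ (fun s x => 2 * s - x) (fun w => sup_on (W^~ w) 1)).
  - by move=> U Z mU mZ; apply: measurable_funB => //; exact: measurable_funM.
  - exact: ae_measurable_sup_on.
  - by apply: measurable_ae_measurable; exact: mW.
apply: (version_functionals levyV (len _ levyV) (len _ (levy_opp levyV))).
by apply: aeW => w; exact: Lambda_functionals.
Qed.

Section process_versions.
Context {R : realType} d (Omega : measurableType d) (P : probability Omega R).
Variables (X : R -> Omega -> R) (a : R -> R) (T : R).
Hypotheses (levyX : levy_process P X) (T0 : 0 < T) (a0 : 0 < a T).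

Definition majorant_length f := graph_length (concave_majorant f T) 0 T / a T.

(** Almost sure because it needs left-continuity at the fixed time [T], for the path and for its
    opposite. *)
Lemma Lambda_functionals_ : {ae P, forall w,
  (Lambda1_ a T (X^~ w), Lambda2_ a T (X^~ w)) =
  functionals (majorant_length (X^~ w)) (majorant_length (fun t => - X t w))
    ((scaled X a T)^~ w)}.
Proof.
have [_ _ cX _ _] := levyX; have levyN := levy_opp levyX.
have [_ _ cN _ _] := levyN.
have l1 := levy_left_continuous levyX T0; have l2 := levy_left_continuous levyN T0.
have E1 : {ae P, forall w, Lambda1_ a T (X^~ w) = (majorant_length (X^~ w),
    sup_on ((scaled X a T)^~ w) 1, scaled X a T 1 w, time_of_sup ((scaled X a T)^~ w) 1)}.
  by apply: filterS2 cX l1 => w cw lw; rewrite (Lambda1_rescale cw T0 a0 lw).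
apply: filterS3 E1 cN l2 => w -> cw lw.
have := Lambda2_E a T (X^~ w) => ->; rewrite /functionals /assemble.
have [-> -> ->] := Lambda1_rescale cw T0 a0 lw.
rewrite (_ : rescale T (a T) _ = (fun t => - scaled X a T t w))//.
by apply/funext => t; rewrite /rescale mulNr.
Qed.

Lemma version_Lambda_ : exists Y',
  version P (fun w => (Lambda1_ a T (X^~ w), Lambda2_ a T (X^~ w))) Y'.
Proof.
have levyZ : levy_process P (scaled X a T) by exact: levy_rescale.
have len W : levy_process P W -> ae_measurable P (fun w => majorant_length (W^~ w)).
  move=> levyW; have [mW _ cW _ _] := levyW.
  apply: (@ae_measurable_map _ _ _ _ (fun s => s / a T)); first exact: measurable_funM.
  exact: ae_measurable_graph_length.
apply: (version_functionals levyZ (len _ levyX) (len _ (levy_opp levyX))).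
exact: Lambda_functionals_.
Qed.

Lemma majorant_length_close f : cadlag f -> f 0 = 0 ->
  `|majorant_length f - limit_length (rescale T (a T) f)| <= T / a T.
Proof.
move=> cf f0; rewrite /majorant_length /limit_length sup_on_rescale// mulr1.
rewrite /rescale mulr1 mulrA -!mulrBl normrM (@gtr0_norm _ (a T)^-1) ?invr_gt0//.
by rewrite ler_pM2r ?invr_gt0//; exact: graph_length_concave_majorant.
Qed.

End process_versions.

(** * Convergence in law *)

Section inf_convolution.
Context {R : realType} {E : normedModType R}.
Variables (f : E -> R) (M : R).
Hypotheses (fM : forall x, `|f x| <= M).
Implicit Types (x y : E) (e k : R) (n : nat).

(** The Pasch-Hausdorff envelope: for bounded [f] and [0 <= k], the largest [k]-Lipschitz function
    below [f]. *)
Definition inf_convolution k x : R := inf [set f y + k * `|x - y| | y in setT].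

Let lower k x y : 0 <= k -> - M <= f y + k * `|x - y|.
Proof.
by move=> k0; have := fM y; rewrite ler_norml => /andP[h _]; rewrite -[leLHS]addr0 lerD// mulr_ge0.
Qed.

Let has_inf_convolution k x : 0 <= k -> has_inf [set f y + k * `|x - y| | y in setT].
Proof.
move=> k0; split; first by exists (f x + k * `|x - x|), x.
by exists (- M) => _ [y _ <-]; exact: lower.
Qed.

Lemma inf_convolution_le k x y : 0 <= k -> inf_convolution k x <= f y + k * `|x - y|.
Proof. by move=> k0; apply: ge_inf; [case: (has_inf_convolution x k0)|exists y]. Qed.

Lemma inf_convolution_ge k x m : 0 <= k -> (forall y, m <= f y + k * `|x - y|) ->
  m <= inf_convolution k x.
Proof. by move=> k0 H; apply: lb_le_inf; [case: (has_inf_convolution x k0)|move=> _ [y _ <-]]. Qed.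

Lemma inf_convolution_le_self k x : 0 <= k -> inf_convolution k x <= f x.
Proof. by move=> k0; have := inf_convolution_le x x k0; rewrite subrr normr0 mulr0 addr0. Qed.

Lemma inf_convolution_bounded k x : 0 <= k -> `|inf_convolution k x| <= M.
Proof.
move=> k0; rewrite ler_norml; apply/andP; split.
  by apply: inf_convolution_ge => // y; exact: lower.
by apply: (le_trans (inf_convolution_le_self x k0)); apply: le_trans (fM x); exact: ler_norm.
Qed.

Lemma inf_convolution_lipschitz k x y : 0 <= k ->
  `|inf_convolution k x - inf_convolution k y| <= k * `|x - y|.
Proof.
move=> k0.
have half u v : inf_convolution k u <= inf_convolution k v + k * `|u - v|.
  rewrite -lerBlDr; apply: inf_convolution_ge => // z; rewrite lerBlDr.
  apply: (le_trans (inf_convolution_le u z k0)); rewrite -addrA lerD2l -mulrDr.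
  by rewrite ler_wpM2l// [leRHS]addrC ler_distD.
have h1 := half x y; have h2 := half y x; rewrite distrC in h2.
by rewrite ler_norml; apply/andP; split; lra.
Qed.

Lemma inf_convolution_mono k k' x : 0 <= k <= k' -> inf_convolution k x <= inf_convolution k' x.
Proof.
move=> /andP[k0 kk]; apply: inf_convolution_ge => [|y]; first exact: le_trans kk.
by apply: (le_trans (inf_convolution_le x y k0)); rewrite lerD2l ler_wpM2r.
Qed.

Lemma inf_convolution_close x e : continuous f -> 0 < e ->
  exists n, f x - e <= inf_convolution n%:R x.
Proof.
move=> cf e0; have M0 : 0 <= M := le_trans (normr_ge0 _) (fM x).
have /cvgrPdist_le/(_ _ e0) := cf x.
move=> /nbhs_ballP[r /= r0 Hr].
(* At distance [r] or more the penalty is at least [2 * M], so such points cannot bring the infimum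
   below [f x]. *)
exists (Num.truncn (2 * M / r)).+1; apply: inf_convolution_ge => // y.
have [xy|xy] := ltP `|x - y| r.
  have := Hr y; rewrite -ball_normE/= => /(_ xy) h.
  have := ler_norm (f x - f y).
  have : 0 <= (Num.truncn (2 * M / r)).+1%:R * `|x - y| by rewrite mulr_ge0.
  lra.
have h : 2 * M <= (Num.truncn (2 * M / r)).+1%:R * `|x - y|.
  apply: (@le_trans _ _ ((Num.truncn (2 * M / r)).+1%:R * r)).
    by rewrite -ler_pdivrMr// ltW// truncnS_gt.
  by rewrite ler_wpM2l.
have := fM x; have := fM y; rewrite !ler_norml => /andP[y1 y2] /andP[x1 x2].
lra.
Qed.

End inf_convolution.

(** * From Lipschitz to continuous test functions *)

Section lipschitz_portmanteau.
Context {R : realType} {E : normedModType R} d d' (Omega : measurableType d)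
  (Omega' : measurableType d').
Variables (P : probability Omega R) (P' : probability Omega' R).
Variables (Y : R -> Omega -> E) (Z : Omega' -> E).
Hypotheses (bY : forall T, 0 < T -> borel_map (Y T)) (bZ : borel_map Z).
Hypothesis cvg_lipschitz : forall (G : E -> R) (M L : R), 0 <= L ->
  (forall x, `|G x| <= M) -> (forall x y, `|G x - G y| <= L * `|x - y|) ->
  Ex P (G \o Y T) @[T --> +oo] --> Ex P' (G \o Z).

Lemma measurable_borel_comp d0 (Q : measurableType d0) (V : Q -> E) (f : E -> R) :
  borel_map V -> continuous f -> measurable_fun setT (f \o V).
Proof.
move=> bV /continuousP cf; apply: measurable_fun_open => U oU.
by rewrite comp_preimage; apply: bV; exact: cf.
Qed.

Lemma lipschitz_continuous (f : E -> R) L : 0 <= L ->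
  (forall x y, `|f x - f y| <= L * `|x - y|) -> continuous f.
Proof.
move=> L0 fL x; apply/cvgrPdist_le => e e0.
have eL : 0 < e / (L + 1) by rewrite divr_gt0//; lra.
near=> y; apply: (le_trans (fL x y)).
have : `|x - y| <= e / (L + 1).
  by near: y; have /cvgrPdist_le := @cvg_id _ (nbhs x); exact.
rewrite ler_pdivlMr; last lra.
by have := normr_ge0 (x - y); nra.
Unshelve. all: by end_near. Qed.

(** An envelope lies below [f] everywhere, so it has to be close to [f] only under the limit law.
    One [n] therefore serves all large T; the upper bound is the case of [- f]. *)
Lemma portmanteau_lower (f : E -> R) M e : continuous f -> (forall x, `|f x| <= M) -> 0 < e ->
  \forall T \near +oo, Ex P' (f \o Z) - e <= Ex P (f \o Y T).
Proof.
move=> cf fM e0; have M0 : 0 <= M := le_trans (normr_ge0 _) (fM 0).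
have e4 : 0 < e / 4 by lra.
have ck n : continuous (inf_convolution f n%:R).
  by apply: (@lipschitz_continuous _ n%:R) => [|x y]; [exact: ler0n|exact: (inf_convolution_lipschitz fM)].
have kM n x : `|inf_convolution f n%:R x| <= M by exact: inf_convolution_bounded.
have mk n : measurable_fun setT (inf_convolution f n%:R \o Z).
  exact: measurable_borel_comp.
have mf : measurable_fun setT (f \o Z) by exact: measurable_borel_comp.
pose A n := [set w | inf_convolution f n%:R (Z w) < f (Z w) - e / 4].
have mA n : measurable (A n).
  by apply: measurable_lt_set; [exact: mk|exact: measurable_funB].
have : pr P' (A n) @[n --> \oo] --> 0.
  apply: cvg_pr0 => // [|n m w nm /=].
    apply: aeW => w H; have [n Hn] := inf_convolution_close fM (Z w) cf e4.
    by have := H n; rewrite /A/= ltNge Hn.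
  apply: le_lt_trans; apply: (inf_convolution_mono fM).
  by rewrite ler0n ler_nat.
have eM : 0 < e / (8 * (M + 1)) by rewrite divr_gt0//; lra.
move=> /cvgrPdist_le/(_ _ eM)[n _ /(_ n (leqnn _))] /=; rewrite sub0r normrN => Hn.
have {}Hn := le_trans (ler_norm _) Hn.
have close : Ex P' (f \o Z) - e / 2 <= Ex P' (inf_convolution f n%:R \o Z).
  have := @Ex_close _ _ _ P' (f \o Z) (inf_convolution f n%:R \o Z) M (e / 4) (A n) mf (mk n).
  move=> /(_ (fun w => fM _) (fun w => kM n _) (mA n) (ltW e4)) h.
  have {}h : `|Ex P' (f \o Z) - Ex P' (inf_convolution f n%:R \o Z)| <= e / 4 + 2 * M * pr P' (A n).
    apply: h; apply: aeW => w; rewrite /A/= => /negP; rewrite -leNgt => h.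
    by rewrite ger0_norm ?subr_ge0 ?(inf_convolution_le_self fM)//; lra.
  have h2 : 2 * M * pr P' (A n) <= e / 4.
    apply: (@le_trans _ _ (2 * (M + 1) * (e / (8 * (M + 1))))).
      by apply: ler_pM => //; rewrite ?pr_ge0 ?mulr_ge0//; lra.
    have -> : 2 * (M + 1) * (e / (8 * (M + 1))) = e / 4 by field; lra.
    by [].
  by have := le_trans (ler_norm _) h; lra.
have e2 : 0 < e / 2 by lra.
have := cvg_lipschitz (ler0n _ n) (kM n) (fun x y => inf_convolution_lipschitz fM x y (ler0n _ n)).
move=> /cvgrPdist_le/(_ _ e2) near1.
near=> T.
have T0 : 0 < T by near: T; exact: nbhs_pinfty_gt.
have h1 : `|Ex P' (inf_convolution f n%:R \o Z) - Ex P (inf_convolution f n%:R \o Y T)| <= e / 2.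
  by near: T.
have h2 : Ex P (inf_convolution f n%:R \o Y T) <= Ex P (f \o Y T).
  apply: (@Ex_le _ _ _ _ _ _ M).
  - by apply: measurable_borel_comp => //; exact: bY.
  - by apply: measurable_borel_comp => //; exact: bY.
  - by move=> w; exact: kM.
  - by move=> w; exact: fM.
  - by move=> w; exact: (inf_convolution_le_self fM).
by have := le_trans (ler_norm _) h1; lra.
Unshelve. all: by end_near. Qed.

Lemma lipschitz_portmanteau (f : E -> R) M : continuous f -> (forall x, `|f x| <= M) ->
  Ex P (f \o Y T) @[T --> +oo] --> Ex P' (f \o Z).
Proof.
move=> cf fM; apply/cvgrPdist_le => e e0.
have cN : continuous (fun x => - f x) by move=> x; apply: cvgN; exact: cf.
have NM x : `|- f x| <= M by rewrite normrN.
have n1 := portmanteau_lower cf fM e0; have n2 := portmanteau_lower cN NM e0.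
near=> T.
have T0 : 0 < T by near: T; exact: nbhs_pinfty_gt.
have h1 : Ex P' (f \o Z) - e <= Ex P (f \o Y T) by near: T.
have : Ex P' ((fun x => - f x) \o Z) - e <= Ex P ((fun x => - f x) \o Y T) by near: T.
have -> : Ex P' ((fun x => - f x) \o Z) = - Ex P' (f \o Z).
  by apply: (@ExN _ _ _ _ (f \o Z) M); [exact: measurable_borel_comp|move=> w; exact: fM].
have -> : Ex P ((fun x => - f x) \o Y T) = - Ex P (f \o Y T).
  apply: (@ExN _ _ _ _ (f \o Y T) M); last by move=> w; exact: fM.
  by apply: measurable_borel_comp => //; exact: bY.
by move=> h2; rewrite ler_norml; apply/andP; split; lra.
Unshelve. all: by end_near. Qed.

End lipschitz_portmanteau.

(** * The functionals on a skeleton as functions of the increments *)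

Section skeleton.
Context {R : realType}.
Implicit Types (f g : R -> R) (e h t : R) (p j r k : nat).

Lemma gmax_close f g r n h : (forall k, (k <= n)%N -> `|f (dy r k) - g (dy r k)| <= h) ->
  `|gmax f r 0 n - gmax g r 0 n| <= h.
Proof.
move=> fg.
have half f' g' : (forall k, (k <= n)%N -> f' (dy r k) - g' (dy r k) <= h) ->
    gmax f' r 0 n - gmax g' r 0 n <= h.
  move=> H; rewrite lerBlDr; apply: gmax_le => // l ln.
  by rewrite -lerBlDr; apply: le_trans (H l ln); rewrite lerD2l lerN2; exact: gmax_ge.
rewrite ler_norml lerNl opprB !half// => k kn;
  by have := fg k kn; rewrite ler_norml => /andP[h1 h2]; lra.
Qed.

(** The lengths have the form of [limit_length]; its end value at the opposite path is [- f 1],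
    whence the double negation. *)
Definition skeleton e p j f :=
  let m g := gmax g (p + j) 0 (2 ^ (p + j)) in
  assemble (2 * m f - f 1) (m f) (f 1) (skeleton_location e p j f)
    (2 * m (fun t => - f t) - - f 1) (m (fun t => - f t)) (- f 1)
    (skeleton_location e p j (fun t => - f t)).

Lemma assemble_close (l1 s1 v1 g1 l2 s2 v2 g2 l1' s1' v1' g1' l2' s2' v2' g2' : R) h :
  `|l1 - l1'| <= h -> `|s1 - s1'| <= h -> `|v1 - v1'| <= h -> `|g1 - g1'| <= h ->
  `|l2 - l2'| <= h -> `|s2 - s2'| <= h -> `|v2 - v2'| <= h -> `|g2 - g2'| <= h ->
  `|assemble l1 s1 v1 g1 l2 s2 v2 g2 - assemble l1' s1' v1' g1' l2' s2' v2' g2'| <= h.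
Proof.
move=> L1 S1 V1 G1 L2 S2 V2 G2; rewrite /assemble !prod_normE/= !ge_max.
by rewrite L1 S1 V1 G1 L2 G2 -!opprD !normrN S2 V2.
Qed.

(** The 3 comes from the lengths [2 * m - v] and the [2 / e] from [location_lipschitz]. *)
Lemma skeleton_close e p j f g h : 0 < e ->
  (forall k, (k <= 2 ^ (p + j))%N -> `|f (dy (p + j) k) - g (dy (p + j) k)| <= h) ->
  `|skeleton e p j f - skeleton e p j g| <= (3 + 2 / e) * h.
Proof.
move=> e0 fg.
have h0 : 0 <= h := le_trans (normr_ge0 _) (fg 0%N (leq0n _)).
have he : 0 <= 2 * h / e by rewrite divr_ge0 ?mulr_ge0 ?(ltW e0).
have E : (3 + 2 / e) * h = 3 * h + 2 * h / e by ring.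
have Nfg k : (k <= 2 ^ (p + j))%N -> `|- f (dy (p + j) k) - - g (dy (p + j) k)| <= h.
  by move=> kn; rewrite -opprD normrN; exact: fg.
have fg1 : `|f 1 - g 1| <= h by have := fg _ (leqnn _); rewrite dy1.
have Nfg1 : `|- f 1 - - g 1| <= h by rewrite -opprD normrN.
have M f' g' n : (forall k, (k <= 2 ^ (p + j))%N ->
    `|f' (dy (p + j) k) - g' (dy (p + j) k)| <= h) -> (n <= 2 ^ (p + j))%N ->
    `|gmax f' (p + j) 0 n - gmax g' (p + j) 0 n| <= h.
  by move=> H np; apply: gmax_close => k kn; apply: H; exact: leq_trans np.
have loc f' g' : (forall k, (k <= 2 ^ (p + j))%N ->
    `|f' (dy (p + j) k) - g' (dy (p + j) k)| <= h) ->
    `|skeleton_location e p j f' - skeleton_location e p j g'| <= 2 * h / e.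
  move=> H; apply: location_lipschitz => // k kp; apply: M => //.
  by rewrite expnD leq_mul2r kp orbT.
have len (x x' y y' : R) : `|x - x'| <= h -> `|y - y'| <= h -> `|2 * x - y - (2 * x' - y')| <= 3 * h.
  rewrite !ler_norml => /andP[? ?] /andP[? ?]; apply/andP; split; lra.
have m1 := M _ _ _ fg (leqnn _); have m2 := M (fun t => - f t) (fun t => - g t) _ Nfg (leqnn _).
have c1 (x : R) : x <= h -> x <= (3 + 2 / e) * h by rewrite E; lra.
have c2 (x : R) : x <= 2 * h / e -> x <= (3 + 2 / e) * h by rewrite E; lra.
have c3 (x : R) : x <= 3 * h -> x <= (3 + 2 / e) * h by rewrite E; lra.
apply: assemble_close.
- by apply: c3; apply: len.
- exact: c1.
- exact: c1.
- by apply: c2; apply: loc.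
- by apply: c3; apply: len.
- exact: c1.
- exact: c1.
- by apply: c2; apply: loc.
Qed.

Lemma skeleton_borel e p j d (Omega : measurableType d) (W : R -> Omega -> R) :
  (forall t, 0 <= t -> measurable_fun setT (W t)) ->
  borel_map (fun w => skeleton e p j (W^~ w)).
Proof.
move=> mW.
have mm (W' : R -> Omega -> R) r n : (forall t, 0 <= t -> measurable_fun setT (W' t)) ->
    measurable_fun setT (fun w => gmax (W'^~ w) r 0 n).
  by move=> mW'; apply: measurable_bigmax => *; apply: mW'; exact: dy_ge0.
have mloc (W' : R -> Omega -> R) : (forall t, 0 <= t -> measurable_fun setT (W' t)) ->
    measurable_fun setT (fun w => skeleton_location e p j (W'^~ w)).
  move=> mW'; rewrite /skeleton_location /location; apply: measurable_funM => //.
  apply: measurable_sum => k; apply: measurable_minr => //; apply: measurable_funM => //.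
  by apply: measurable_funB; exact: mm.
have mN t : 0 <= t -> measurable_fun setT (fun w => - W t w).
  by move=> t0; apply: measurableT_comp => //; exact: mW.
rewrite /skeleton/= /assemble; apply: borel_map_octuple.
- by apply: measurable_funB; [apply: measurable_funM => //; exact: mm|exact: mW].
- exact: mm.
- exact: mW.
- exact: mloc.
- apply: measurable_funB; last exact: mN.
  by apply: measurable_funM => //; exact: (mm (fun t w => - W t w)).
- by apply: measurableT_comp => //; exact: (mm (fun t w => - W t w)).
- by apply: measurableT_comp => //; exact: mN.
- exact: (mloc (fun t w => - W t w)).
Qed.

(** The step path with increments [u]. The inequality is strict so that its value at [dy r k] is the
    sum of the first [k] increments. *)
Definition path_of r (u : 'I_(2 ^ r) -> R) t : R :=
  \sum_(i < 2 ^ r | i%:R < 2 ^+ r * t) u i.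

Lemma path_of_dy r u k : (k <= 2 ^ r)%N ->
  @path_of r u (dy r k) = \sum_(i < 2 ^ r | (i < k)%N) u i.
Proof.
move=> kr; apply: eq_bigl => i.
by rewrite /dy mulrC divfK ?gt_eqF ?exprn_gt0// ltr_nat.
Qed.

Lemma path_of_increments d (Omega : measurableType d) (V : R -> Omega -> R) r w k :
  V 0 w = 0 -> (k <= 2 ^ r)%N ->
  path_of (fun i => @increments _ _ _ V r i w) (dy r k) = V (dy r k) w.
Proof.
move=> V0 kr; rewrite path_of_dy//.
rewrite -(big_ord_widen _ (fun i => V (dy r i.+1) w - V (dy r i) w) kr).
rewrite -(big_mkord xpredT (fun i => V (dy r i.+1) w - V (dy r i) w)) telescope_sumr//.
by rewrite dy0 V0 subr0.
Qed.

Lemma path_of_close r (u v : 'I_(2 ^ r) -> R) h t : (forall i, `|u i - v i| <= h) ->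
  `|path_of u t - path_of v t| <= (2 ^ r)%:R * h.
Proof.
move=> uv; rewrite -sumrB (le_trans (ler_norm_sum _ _ _))//.
rewrite big_mkcond/=; apply: (@le_trans _ _ (\sum_(i < 2 ^ r) h)); last first.
  by rewrite sumr_const card_ord mulr_natl.
apply: ler_sum => i _; case: ifP => _; first exact: uv.
exact: le_trans (normr_ge0 _) (uv i).
Qed.

End skeleton.

Definition skeleton_of {R : realType} (e : R) p j (u : 'I_(2 ^ (p + j)) -> R) :=
  skeleton e p j (path_of u).

Arguments skeleton_of {R} e p j u.

Lemma skeleton_of_close {R : realType} (e : R) p j (u v : 'I_(2 ^ (p + j)) -> R) h :
  0 < e -> (forall i, `|u i - v i| <= h) ->
  `|skeleton_of e p j u - skeleton_of e p j v| <= (3 + 2 / e) * (2 ^ (p + j))%:R * h.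
Proof.
move=> e0 uv; rewrite -mulrA; apply: skeleton_close => // k _.
exact: path_of_close.
Qed.

Lemma skeleton_of_borel {R : realType} (e : R) p j d (Omega : measurableType d)
    (P : probability Omega R) (V : R -> Omega -> R) : levy_process P V ->
  borel_map (fun w => skeleton_of e p j (fun i => increments V i w)).
Proof.
move=> levyV.
apply: (@skeleton_borel _ _ _ _ _ _ (fun t w => path_of (fun i => increments V i w) t)) => t _.
rewrite /path_of; under eq_fun do rewrite big_mkcond/=.
apply: measurable_sum => i; case: (_ < _) => //; exact: (increments_measurable levyV).
Qed.

Section skeleton_expectation.
Context {R : realType} d (Omega : measurableType d) (P : probability Omega R).
Variable V : R -> Omega -> R.
Hypothesis levyV : levy_process P V.
Variables (p j L : nat) (K e e1 delta1 delta2 delta3 : R).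
Hypotheses (e0 : 0 < e) (e10 : 0 < e1) (d10 : 0 <= delta1) (d20 : 0 <= delta2)
  (d30 : 0 <= delta3) (KL : 2 * K <= L%:R * e1).
Hypothesis small : forall s, 0 <= s <= dy (p + j) 1 -> pr P [set w | e1 < `|V s w| ] <= delta1.
Hypothesis tight : forall s, 0 <= s <= 1 -> pr P [set w | K < `|V s w| ] <= delta2.
Hypothesis conc : forall x, pr P [set w | `|V (dy p 1) w - x| <= 2 * e] <= delta3.

Let b := (2 ^ p).+1%:R * (L.+1%:R * delta1 + 3 * delta2 + delta3).

(** The hypotheses on tails and concentration are invariant under change of sign, so [location_bad]
    serves the path and its opposite; hence the factor 2. *)
Lemma skeleton_bad : exists B, [/\ measurable B, pr P B <= 2 * b &
  forall w l1 l2 theta, V 0 w = 0 -> cadlag (V^~ w) -> ~ B w -> 0 <= theta ->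
    `|l1 - limit_length (V^~ w)| <= theta ->
    `|l2 - limit_length (fun t => - V t w)| <= theta ->
    `|functionals l1 l2 (V^~ w) - skeleton_of e p j (fun i => increments V i w)| <=
      theta + 4 * e1 + 2 / 2 ^+ p + 4 * e1 / e].
Proof.
have [B1 [mB1 pB1 HB1]] := location_bad levyV e0 e10 d10 d20 d30 KL small tight conc.
have [B2 [mB2 pB2 HB2]] : exists B, [/\ measurable B,
    pr P B <= b & forall w, cadlag (fun t => - V t w) -> ~ B w ->
    `|sup_on (fun t => - V t w) 1 - gmax (fun t => - V t w) (p + j) 0 (2 ^ (p + j))| <= 2 * e1 /\
    `|time_of_sup (fun t => - V t w) 1 - skeleton_location e p j (fun t => - V t w)| <=
        2 / 2 ^+ p + 4 * e1 / e].
  apply: (location_bad (levy_opp levyV) e0 e10 d10 d20 d30 KL).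
  - by move=> s /small; under eq_set do rewrite -normrN.
  - by move=> s /tight; under eq_set do rewrite -normrN.
  - by move=> x; have := conc (- x); under eq_set do rewrite -normrN opprD opprK.
exists (B1 `|` B2); split; first exact: measurableU.
  by apply: (le_trans (prU _ mB1 mB2)); rewrite mulr2n mulrDl mul1r lerD.
move=> w l1 l2 theta V0 cw nB t0 Hl1 Hl2.
have [s1 g1] := HB1 w cw (fun h => nB (or_introl h)).
have [s2 g2] := HB2 w (cadlag_opp cw) (fun h => nB (or_intror h)).
have -> : skeleton_of e p j (fun i => increments V i w) = skeleton e p j (V^~ w).
  apply/eqP; rewrite -subr_eq0 -normr_le0 -[leRHS](mulr0 (3 + 2 / e)).
  by apply: skeleton_close => // k kr; rewrite path_of_increments// subrr normr0.
set eta := theta + _ + _ + _.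
have x0 : 0 <= 2 / 2 ^+ p :> R by rewrite divr_ge0// exprn_ge0.
have y0 : 0 <= 4 * e1 / e by rewrite divr_ge0 ?mulr_ge0 ?ltW.
have z0 : 0 <= 4 * e1 by rewrite mulr_ge0// ltW.
have c1 (x : R) : x <= 2 * e1 -> x <= eta by rewrite /eta; lra.
have c2 (x : R) : x <= 2 / 2 ^+ p + 4 * e1 / e -> x <= eta by rewrite /eta; lra.
have len l (s v m : R) : `|l - (2 * s - v)| <= theta -> `|s - m| <= 2 * e1 ->
    `|l - (2 * m - v)| <= eta.
  rewrite !ler_norml => /andP[? ?] /andP[? ?].
  by apply/andP; split; rewrite /eta; lra.
apply: assemble_close.
- exact: (len _ (sup_on (V^~ w) 1)).
- exact: c1.
- by rewrite subrr normr0 /eta; lra.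
- exact: c2.
- exact: (len _ (sup_on (fun t => - V t w) 1)).
- exact: c1.
- by rewrite subrr normr0 /eta; lra.
- exact: c2.
Qed.

Lemma skeleton_Ex (Y : Omega -> (R * R * R * R) * (R * R * R * R)) (l1 l2 : Omega -> R)
    (G : (R * R * R * R) * (R * R * R * R) -> R) M C theta :
  borel_map Y -> 0 <= C -> 0 <= theta ->
  {ae P, forall w, Y w = functionals (l1 w) (l2 w) (V^~ w)} ->
  {ae P, forall w, `|l1 w - limit_length (V^~ w)| <= theta /\
    `|l2 w - limit_length (fun t => - V t w)| <= theta} ->
  (forall x, `|G x| <= M) -> (forall x y, `|G x - G y| <= C * `|x - y|) ->
  `|Ex P (G \o Y) - Ex P (fun w => G (skeleton_of e p j (fun i => increments V i w)))| <=
    C * (theta + 4 * e1 + 2 / 2 ^+ p + 4 * e1 / e) + 2 * M * (2 * b).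
Proof.
move=> bY C0 t0 YE ll GM GL; have [B [mB pB HB]] := skeleton_bad.
have M0 : 0 <= M := le_trans (normr_ge0 _) (GM (0, 0)).
have cG : continuous G by exact: lipschitz_continuous C0 GL.
have [_ V0 cV _ _] := levyV.
apply: (@le_trans _ _ (C * (theta + 4 * e1 + 2 / 2 ^+ p + 4 * e1 / e) + 2 * M * pr P B)).
  apply: Ex_close => //.
  - exact: measurable_borel_comp.
  - exact: (@measurable_borel_comp _ _ _ _
      (fun w => skeleton_of e p j (fun i => increments V i w)) G (skeleton_of_borel _ _ _ levyV) cG).
  - by move=> w; exact: GM.
  - by rewrite mulr_ge0// !addr_ge0// ?divr_ge0 ?mulr_ge0 ?exprn_ge0 ?(ltW e10) ?(ltW e0).
  - have E : {ae P, forall w, V 0 w = 0 /\ cadlag (V^~ w)} by apply: filterS2 V0 cV.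
    apply: filterS3 YE ll E => w /= -> [h1 h2] [h3 h4] nB.
    by apply: (le_trans (GL _ _)); rewrite ler_wpM2l//; exact: HB.
by rewrite lerD2l ler_wpM2l// mulr_ge0.
Qed.

End skeleton_expectation.

(** * Choice of the parameters and passage to the limit *)

Section convergence.
Context {R : realType} d d' (Omega : measurableType d) (Omega' : measurableType d').
Variables (P : probability Omega R) (P' : probability Omega' R).
Variables (alpha : R) (X : R -> Omega -> R) (S : R -> Omega' -> R) (a l : R -> R).
Hypotheses (alpha01 : 0 < alpha < 1) (levyX : levy_process P X)
  (stableS : stable_process P' alpha S) (svl : slowly_varying l)
  (aE : forall T, 0 < T -> 0 < a T /\ a T = T `^ alpha^-1 * l T)
  (lawX : cvg_in_law P P' (fun T w => X T w / a T) (S 1)).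
Variables (Y : R -> Omega -> (R * R * R * R) * (R * R * R * R))
  (Z : Omega' -> (R * R * R * R) * (R * R * R * R)).
Hypotheses (vY : forall T, 0 < T ->
    version P (fun w => (Lambda1_ a T (X^~ w), Lambda2_ a T (X^~ w))) (Y T))
  (vZ : version P' (fun w => (Lambda1 (S^~ w), Lambda2 (S^~ w))) Z).

Let levyS : levy_process P' S := stable_levy stableS.
Let lX T (T0 : 0 < T) : levy_process P (scaled X a T) := @levy_scaled _ _ _ _ _ _ _ _ levyX aE T T0.

Let tail_le d0 (Q : measurableType d0) (Q' : probability Q R) V (c c' s : R) :
  levy_process Q' V -> 0 <= s -> c <= c' ->
  pr Q' [set w | c' < `|V s w| ] <= pr Q' [set w | c < `|V s w| ].
Proof.
move=> lV s0 cc; have m x : measurable [set w | x < `|V s w| ].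
  apply: measurable_lt_set => //; apply: measurableT_comp => //.
  exact: (levy_measurable lV).
by apply: pr_le => // w /=; apply: le_lt_trans.
Qed.

(** The order of the choices is essential: [p] for the rounding of times, [e] for the ties at level
    [p], [e1] small against [e], [K] for tightness, [L] for the number of levels up to [2 * K], then
    [delta1] small against [L], and finally [j] so fine that increments over its cells rarely exceed
    [e1]. Every choice serves [S] and all large T at once, so the two skeletons have the same
    shape. *)
Lemma cvg_Lambda_lipschitz (G : (R * R * R * R) * (R * R * R * R) -> R) M C :
  0 <= C -> (forall x, `|G x| <= M) -> (forall x y, `|G x - G y| <= C * `|x - y|) ->
  Ex P (G \o Y T) @[T --> +oo] --> Ex P' (G \o Z).
Proof.
move=> C0 GM GL; have M0 : 0 <= M := le_trans (normr_ge0 _) (GM (0, 0)).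
apply/cvgrPdist_le => eps eps0.
(* Four errors of size [eta] give [(C + 1) * (4 * eta) = eps / 6]. *)
pose eta := eps / (24 * (C + 1)).
have eta0 : 0 < eta by rewrite divr_gt0// mulr_gt0//; lra.
(* The exceptional events have [b = 5 * kappa], so [2 * (M + 1) * (2 * b) = eps / 6]. With the term
   of [eta] this makes [eps / 3], one third of the budget. *)
pose kappa := eps / (120 * (M + 1)).
have kappa0 : 0 < kappa by rewrite divr_gt0// mulr_gt0//; lra.
have pow_ge n (x : R) : 0 < x -> (Num.truncn x^-1 < n)%N -> x^-1 <= 2 ^+ n.
  move=> x0 xn; apply: (le_trans (ltW (truncnS_gt _))).
  by rewrite -natrX ler_nat (leq_trans xn)// ltnW// ltn_expl.
pose p := (Num.truncn (eta / 2)^-1).+1.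
have p0 : (0 < p)%N by [].
have pE : 2 / 2 ^+ p <= eta.
  have := @pow_ge p (eta / 2); rewrite divr_gt0// ltnS leqnn => /(_ isT isT).
  rewrite invf_div ler_pdivrMr// => h.
  by rewrite ler_pdivrMr ?exprn_gt0// mulrC.
pose N : R := (2 ^ p).+1%:R.
have N0 : 0 < N by rewrite ltr0n.
have d30 : 0 < kappa / N by rewrite divr_gt0.
have [c1 c10 Hc1] := stable_concentration stableS p0 d30.
have [c2 c20 Hc2] := scaled_concentration levyX stableS svl aE lawX p0 d30.
pose e := Num.min c1 c2.
have e0 : 0 < e by rewrite lt_min c10.
have ec1 : e <= c1 by rewrite ge_min lexx.
have ec2 : e <= c2 by rewrite ge_min lexx orbT.
pose e1 := Num.min (eta / 4) (eta * e / 4).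
have e10 : 0 < e1 by rewrite lt_min; apply/andP; split; rewrite divr_gt0// mulr_gt0.
have e1E : 4 * e1 <= eta.
  have : e1 <= eta / 4 by rewrite ge_min lexx.
  lra.
have e1e : 4 * e1 / e <= eta.
  have : e1 <= eta * e / 4 by rewrite ge_min lexx orbT.
  by rewrite ler_pdivrMr//; lra.
have [K1 HK1] := scaled_tight alpha01 levyX stableS svl aE lawX d30.
have [K2 HK2] := levy_tight levyS 1 d30.
pose K := Num.max K1 K2.
have KK1 : K1 <= K by rewrite le_max lexx.
have KK2 : K2 <= K by rewrite le_max lexx orbT.
pose L := (Num.truncn (2 * K / e1)).+1.
have KL : 2 * K <= L%:R * e1 by rewrite -ler_pdivrMr// ltW// truncnS_gt.
pose delta1 := kappa / (N * L.+1%:R).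
have NL0 : 0 < N * L.+1%:R by rewrite mulr_gt0// ltr0n.
have d10 : 0 < delta1 by rewrite divr_gt0.
have [h1 h10 Hh1] := scaled_small alpha01 levyX stableS svl aE lawX e10 d10.
have [h2 h20 Hh2] := levy_small levyS e10 d10.
pose h := Num.min h1 h2.
have h0 : 0 < h by rewrite lt_min h10.
have hh1 : h <= h1 by rewrite ge_min lexx.
have hh2 : h <= h2 by rewrite ge_min lexx orbT.
pose j := (Num.truncn h^-1).+1.
have jE : dy (p + j) 1 <= h.
  rewrite /dy mul1r invf_ple ?posrE ?exprn_gt0//.
  by apply: pow_ge => //; rewrite /j addnS ltnS leq_addl.
pose b := (2 ^ p).+1%:R * (L.+1%:R * delta1 + 3 * (kappa / N) + kappa / N).
have bE : b = 5 * kappa by rewrite /b /delta1 -/N; field; rewrite ?gt_eqF.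
have b0 : 0 <= b by rewrite bE mulr_ge0// ltW.
have total theta : 0 <= theta <= eta ->
    C * (theta + 4 * e1 + 2 / 2 ^+ p + 4 * e1 / e) + 2 * M * (2 * b) <= eps / 3.
  move=> /andP[t0 te].
  have u1 : C * (theta + 4 * e1 + 2 / 2 ^+ p + 4 * e1 / e) <= (C + 1) * (4 * eta).
    apply: ler_pM => //; [|lra|lra].
    by rewrite !addr_ge0// ?divr_ge0 ?mulr_ge0 ?exprn_ge0 ?(ltW e10) ?(ltW e0).
  have u2 : (C + 1) * (4 * eta) = eps / 6 by rewrite /eta; field; rewrite gt_eqF// ltr_wpDl.
  have u3 : 2 * M * (2 * b) <= 2 * (M + 1) * (2 * b).
    by apply: ler_wpM2r; [rewrite mulr_ge0|rewrite ler_pM2l// lerDl].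
  have u4 : 2 * (M + 1) * (2 * b) = eps / 6 by rewrite bE /kappa; field; rewrite gt_eqF// ltr_wpDl.
  lra.
have eps3 : 0 < eps / 3 by lra.
have cG : continuous G by exact: lipschitz_continuous C0 GL.
pose H (u : 'I_(2 ^ (p + j)) -> R) := G (skeleton_of e p j u).
have mH d0 (Q : measurableType d0) (Q' : probability Q R) V : levy_process Q' V ->
    measurable_fun setT (fun w => H (fun i => increments V i w)).
  move=> lV; exact: (@measurable_borel_comp _ _ _ _
    (fun w => skeleton_of e p j (fun i => increments V i w)) G (skeleton_of_borel _ _ _ lV) cG).
have L0 : 0 <= C * ((3 + 2 / e) * (2 ^ (p + j))%:R).
  by rewrite !mulr_ge0// addr_ge0// divr_ge0// ltW.
have cH : Ex P (fun w => H (fun i => increments (scaled X a T) i w)) @[T --> +oo] -->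
    Ex P' (fun w => H (fun i => increments S i w)).
  apply: (cvg_increments levyX stableS svl aE lawX (M := M) L0).
  - by move=> T T0; exact: mH (lX T0).
  - exact: mH levyS.
  - by move=> u; exact: GM.
  - move=> u v c uv; apply: (le_trans (GL _ _)); rewrite -mulrA ler_wpM2l//.
    exact: skeleton_of_close.
have limit : `|Ex P' (G \o Z) - Ex P' (fun w => H (fun i => increments S i w))| <= eps / 3.
  have t0 : (0 : R) <= 0 <= eta by rewrite lexx ltW.
  apply: le_trans (total 0 t0).
  have [bZ ZE] := vZ.
  apply: (skeleton_Ex levyS e0 e10 (ltW d10) (ltW d30) (ltW d30) KL _ _ _
    (l1 := fun w => limit_length (S^~ w)) (l2 := fun w => limit_length (fun t => - S t w))) => //.
  - move=> s /andP[s0 sh]; apply: Hh2; rewrite s0/=; lra.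
  - move=> s s01; apply: le_trans (HK2 s s01); apply: tail_le => //.
    by case/andP: s01.
  - by move=> x; exact: Hc1.
  - by apply: filterS ZE => w <-; exact: Lambda_functionals.
  - by apply: aeW => w; rewrite !subrr normr0.
have /cvgrPdist_le/(_ _ eta0) n1 := regular_variation_superlinear alpha01 svl aE.
have /cvgrPdist_le/(_ _ eps3) n2 := cH.
have n3 := Hc2 e ec2.
near=> T.
have T0 : 0 < T by near: T; exact: nbhs_pinfty_gt.
have [aT _] := aE T0.
have k1 : `|0 - T / a T| <= eta by near: T.
have k2 : `|Ex P' (fun w => H (fun i => increments S i w)) -
  Ex P (fun w => H (fun i => increments (scaled X a T) i w))| <= eps / 3 by near: T.
have k3 : forall x, pr P [set w | `|scaled X a T (dy p 1) w - x| <= 2 * e] <= kappa / N by near: T.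
have k4 : forall s, 0 <= s <= 1 -> pr P [set w | K1 < `|scaled X a T s w| ] <= kappa / N by near: T.
have k5 : forall s, 0 <= s <= h1 -> pr P [set w | e1 < `|scaled X a T s w| ] <= delta1 by near: T.
have theta0 : 0 <= T / a T <= eta.
  rewrite divr_ge0 ?(ltW T0) ?(ltW aT)//=; move: k1; rewrite sub0r normrN.
  by apply: le_trans; exact: ler_norm.
have approx : `|Ex P (G \o Y T) - Ex P (fun w => H (fun i => increments (scaled X a T) i w))| <= eps / 3.
  apply: le_trans (total _ theta0); have [bY YE] := vY T0.
  apply: (skeleton_Ex (lX T0) e0 e10 (ltW d10) (ltW d30) (ltW d30) KL _ _ _
    (l1 := fun w => majorant_length a T (X^~ w))
    (l2 := fun w => majorant_length a T (fun t => - X t w))) => //.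
  - move=> s /andP[s0 sh]; apply: k5; rewrite s0/=; lra.
  - move=> s s01; apply: le_trans (k4 s s01); apply: tail_le => //; first exact: lX.
    by case/andP: s01.
  - by case/andP: theta0.
  - by apply: filterS2 YE (Lambda_functionals_ levyX T0 aT) => w <-.
  - have [_ X0 cX _ _] := levyX; apply: filterS2 X0 cX => w Xw cw; split.
      exact: (majorant_length_close T0 aT cw Xw).
    have -> : (fun t => - scaled X a T t w) = rescale T (a T) (fun t => - X t w).
      by apply/funext => t; rewrite /rescale mulNr.
    by apply: majorant_length_close => //; [exact: cadlag_opp|rewrite Xw oppr0].
move: limit k2 approx; rewrite !ler_norml => /andP[? ?] /andP[? ?] /andP[? ?].
by apply/andP; split; lra.
Unshelve. all: by end_near. Qed.

End convergence.

Theorem theorem1p7 (R : realType) (d d' : measure_display)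
    (Omega : measurableType d) (P : probability Omega R)
    (Omega' : measurableType d') (P' : probability Omega' R)
    (alpha : R) (X : R -> Omega -> R) (S : R -> Omega' -> R) (a l : R -> R) :
  0 < alpha < 1 ->
  levy_process P X ->
  stable_process P' alpha S ->
  slowly_varying l ->
  (forall T, 0 < T -> 0 < a T /\ a T = T `^ alpha^-1 * l T) ->
  cvg_in_law P P' (fun T w => X T w / a T) (S 1) ->
  cvg_in_law P P'
    (fun T w => (Lambda1_ a T (X^~ w), Lambda2_ a T (X^~ w)))
    (fun w => (Lambda1 (S^~ w), Lambda2 (S^~ w))).
Proof.
move=> alpha01 levyX stableS svl aE lawX.
have /choice[Y vY] : forall T, exists Y, 0 < T ->
    version P (fun w => (Lambda1_ a T (X^~ w), Lambda2_ a T (X^~ w))) Y.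
  (* For [T <= 0] nothing is required, and a constant completes the family. *)
  move=> T; have [T0|T0] := ltP 0 T; last by exists (fun=> 0).
  by have [aT _] := aE T T0; have [Y vY] := version_Lambda_ levyX T0 aT; exists Y.
have [Z vZ] := version_Lambda (stable_levy stableS).
exists Y, Z; split => // f cf [M fM].
have bY T : 0 < T -> borel_map (Y T) by move=> /vY[].
have bZ : borel_map Z by case: vZ.
have lim : Ex P (f \o Y T) @[T --> +oo] --> Ex P' (f \o Z).
  apply: (lipschitz_portmanteau bY bZ _ cf fM) => G M' L.
  exact: (cvg_Lambda_lipschitz alpha01 levyX stableS svl aE lawX vY vZ).
have E : {near +oo, forall T, (Ex P (f \o Y T))%:E = ('E_P[f \o Y T])%E}.
  near=> T; have T0 : 0 < T by near: T; exact: nbhs_pinfty_gt.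
  rewrite (@expectation_Ex _ _ _ P (f \o Y T) M)// => [|w]; last exact: fM.
  by apply: measurable_borel_comp => //; exact: bY.
rewrite (@expectation_Ex _ _ _ P' (f \o Z) M) => [||w]; last exact: fM.
  have limE : (Ex P (f \o Y T))%:E @[T --> +oo] --> (Ex P' (f \o Z))%:E.
    by apply: cvg_EFin; [exact: nearW|exact: lim].
  by apply: cvg_trans limE; exact: near_eq_cvg.
exact: measurable_borel_comp.
Unshelve. all: by end_near. Qed.
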